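(* Let $k\ge 1$, let $\mathbb{S}=S^{2k-1}$ be an odd-dimensional sphere, let $n\ge 1$, and let $X$ be a subcomplex of the standard CW-decomposition of $\mathbb{S}^{\times n}$. Then $X$ admits an optimal motion planner with $z(X)+1$ local domains. Hence, $\mathsf{TC}(X)=z(X)+1$.
   Context: Motion planners and topological complexity. Let $X$ be a path-connected (in particular nonempty) space with the homotopy type of a finite CW-complex. $PX$ is the space of all continuous paths $\gamma\colon[0,1]\to X$ with the compact-open topology, and $\pi\colon PX\to X\times X$ is $\pi(\gamma)=(\gamma(0),\gamma(1))$. A motion planner for $X$ is a collection of subsets $F_1,\dots,F_m$ of $X\times X$ (local domains) and continuous maps $s_i\colon F_i\to PX$ (local rules) such that: the $F_i$ are pairwise disjoint and cover $X\times X$; $\pi\circ s_i=\mathrm{id}_{F_i}$ for each $i$; and each $F_i$ is a Euclidean Neighborhood Retract. A motion planner is optimal if it has the minimal possible number of local domains; $\mathsf{TC}(X)$ is the number of local domains in an optimal motion planner for $X$. Cell structure. View $\mathbb{S}=S^{2k-1}=\{x\in\mathbb{C}^k : |x|=1\}$ and let $e=(1,0,\dots,0)$. The standard CW-decomposition of $\mathbb{S}^{\times n}$ has cells $\mathbb{S}^{\times n}_J=\{\mathbf{x}\in\mathbb{S}^{\times n} : x_i=e \text{ if } i\notin J,\ x_i\ne e \text{ if } i\in J\}$ for $J\subseteq[n]=\{1,\dots,n\}$. For $J\subseteq [n]$ let $\mathbb{T}_J=\{\mathbf{x}\in\mathbb{S}^{\times n} : x_i=e\text{ if } i\notin J\}$,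 a subcomplex homeomorphic to $\mathbb{S}^{\times|J|}$. If $J\cap K=\emptyset$, then $\mathbb{T}_J\cap\mathbb{T}_K$ is the point $(e,\dots,e)$ and one writes $\mathbb{T}_J\vee\mathbb{T}_K=\mathbb{T}_J\cup\mathbb{T}_K\subseteq\mathbb{S}^{\times n}$. Define $$z(X)=\max\{|J|+|K| : J,K\subseteq[n],\ J\cap K=\emptyset,\ \mathbb{T}_J\vee\mathbb{T}_K\text{ is a subcomplex of }X\},$$ where $J$ or $K$ may be empty. Subcomplexes are nonempty. *)

(* Defs.v *)
From HB Require Import structures.
From mathcomp Require Import all_boot all_order all_algebra.
From mathcomp Require Import all_classical all_reals all_analysis.
From mathcomp Require Import complex.
Set Implicit Arguments.
Unset Strict Implicit.
Unset Printing Implicit Defensive.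
Import Order.TTheory GRing.Theory Num.Theory.
Import numFieldTopology.Exports numFieldNormedType.Exports.

Local Open Scope classical_set_scope.
Local Open Scope ring_scope.

Section PathSpace.
Variables (R : realType) (X : topologicalType).

Definition unit_interval : Type := set_type (`[0 : R, 1]%classic).

HB.instance Definition _ := Topological.copy unit_interval (set_type (`[0 : R, 1]%classic)).

Lemma unit_interval0_subproof : (0 : R) \in `[0 : R, 1]%classic.
Proof. by rewrite inE /= in_itv /= lexx ler01. Qed.

Lemma unit_interval1_subproof : (1 : R) \in `[0 : R, 1]%classic.
Proof. by rewrite inE /= in_itv /= lexx ler01. Qed.

Definition unit_interval0 : unit_interval := exist _ 0 unit_interval0_subproof.
Definition unit_interval1 : unit_interval := exist _ 1 unit_interval1_subproof.

Definition path_space : Type := continuousType unit_interval X.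

HB.instance Definition _ := Choice.on path_space.

(* The compact-open topology, restricted from all functions to the
   continuous ones. *)
HB.instance Definition _ := Topological.copy path_space
  (initial_topology
     (fun g : path_space => (g : unit_interval -> X)
                              : {compact-open, unit_interval -> X})).

Definition endpoints (g : path_space) : X * X :=
  (g unit_interval0, g unit_interval1).

End PathSpace.

(* Homeomorphism onto the image. *)
Definition embedding (T U : topologicalType) (f : T -> U) : Prop :=
  [/\ injective f, continuous f &
      forall A : set T, open A ->
        exists2 V : set U, open V & f @` A = range f `&` V].

(* r, continuous on U, is a retraction of U onto its subset A. *)
Definition retraction (T : topologicalType) (U A : set T) (r : T -> T) : Prop :=
  [/\ A `<=` U, {within U, continuous r}, r @` U `<=` A &
      forall x, A x -> r x = x].

Definition ENR (R : realType) (T : topologicalType) : Prop :=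
  exists (N : nat) (f : T -> 'rV[R]_N), embedding f /\
    exists (U : set 'rV[R]_N) (r : 'rV[R]_N -> 'rV[R]_N),
      open U /\ retraction U (range f) r.

Section TopologicalComplexity.
Variables (R : realType) (X : topologicalType).

Record motion_planner (m : nat) : Type := MotionPlanner {
  local_domain : 'I_m -> set (X * X);
  local_rule : forall i, set_type (local_domain i) -> path_space R X;
  local_domain_disjoint : trivIset [set: 'I_m] local_domain;
  local_domain_cover : \bigcup_i local_domain i = [set: X * X];
  local_rule_continuous : forall i, continuous (@local_rule i);
  local_rule_section : forall i (p : set_type (local_domain i)),
    endpoints (local_rule p) = set_val p;
  local_domain_ENR : forall i, ENR R (set_type (local_domain i))
}.

Definition optimal (m : nat) (P : motion_planner m) : Prop :=
  forall m' : nat, motion_planner m' -> (m <= m')%N.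

(* The number of local domains of an optimal motion planner; it is unique
   when it exists, and the default value of get (here 0) is returned if X has
   no motion planner at all. *)
Definition TC : nat := get [set m | exists P : motion_planner m, optimal P].

End TopologicalComplexity.

(* Folding R[i] into a numClosedFieldType is what gives access to the topology
   that MathComp-Analysis puts on abstract numeric fields. *)
Definition Cplx (R : realType) : numClosedFieldType := R[i].

Section SpherePower.
Variables (R : realType) (k n : nat).

Definition hermitian_norm (v : 'rV[Cplx R]_k) : Cplx R :=
  sqrtC (\sum_(j < k) `|v 0 j| ^+ 2).

Definition sphere : set 'rV[Cplx R]_k := [set v | hermitian_norm v = 1].

Definition base_point : 'rV[Cplx R]_k := \row_(j < k) (j == 0 :> nat)%:R.

(* The ambient space (C^k)^n with the product topology. Subsets of the n-th
   power of the sphere are taken as subsets of this space; this does not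
   change which of them are closed, as the power of the sphere is closed. *)
Definition ambient : Type := {ptws 'I_n -> 'rV[Cplx R]_k}.

HB.instance Definition _ :=
  Topological.copy ambient {ptws 'I_n -> 'rV[Cplx R]_k}.

Definition sphere_power : set ambient := [set x | forall i, sphere (x i)].

Definition cell (J : {set 'I_n}) : set ambient :=
  [set x | sphere_power x /\
           forall i, (i \notin J -> x i = base_point) /\
                     (i \in J -> x i <> base_point)].

(* A subcomplex is a closed union of cells; nonemptiness is a convention. *)
Definition subcomplex (X : set ambient) : Prop :=
  [/\ X !=set0, closed X &
      exists S : {set {set 'I_n}}, X = \bigcup_(J in [set` S]) cell J].

Definition subtorus (J : {set 'I_n}) : set ambient :=
  [set x | sphere_power x /\ forall i, i \notin J -> x i = base_point].

Definition wedge (J K : {set 'I_n}) : set ambient := subtorus J `|` subtorus K.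

Definition subcomplex_of (Y X : set ambient) : Prop :=
  subcomplex Y /\ Y `<=` X.

Definition z (X : set ambient) : nat :=
  (\max_(JK : {set 'I_n} * {set 'I_n} |
         [disjoint JK.1 & JK.2] && `[< subcomplex_of (wedge JK.1 JK.2) X >])
     (#|JK.1| + #|JK.2|))%N.

End SpherePower.

(* Main.v *)
Require Import Defs.
From mathcomp Require Import all_boot all_order all_algebra all_fingroup.
From mathcomp Require Import all_classical all_reals all_analysis.
From mathcomp Require Import complex zify ring lra.

Set Implicit Arguments.
Unset Strict Implicit.
Unset Printing Implicit Defensive.
Import Order.TTheory GRing.Theory Num.Theory.
Import numFieldTopology.Exports numFieldNormedType.Exports.

Local Open Scope ring_scope.

(** Write S for the odd sphere and e for its base point. Lower bound: let J, K
    attain z(X), put r = |J| + |K|, and suppose a planner has m <= r local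
    domains F_i. Choose m of the r coordinates and map S^m to X * X by placing
    u_i in the first factor if the i-th chosen coordinate lies in J and in the
    second factor if it lies in K, with e elsewhere. Over the preimage of F_i
    the i-th chosen coordinate of the local rule contracts u_i to e. Hence the
    pullback to S^m of the fundamental class of the i-th sphere dies on that
    preimage, and since the preimages cover S^m the cup product of these
    classes vanishes, although it is the top class of S^m. This is carried out
    with mod 2 cochains on a fine Kuhn triangulation of a discrete torus that
    maps to S^m with degree one; labelling points by coordinate signs replaces
    simplicial approximation, so that the local domains may be arbitrary
    subsets.

    Upper bound: F_j consists of the pairs (x, y) with exactly j antipodal
    coordinates. As x_i = - y_i forces x_i or y_i to differ from e, j <= z(X).
    If x_i and y_i are not antipodal, x_i travels to y_i along the shorter
    geodesic, pushed towards e when both are close to e; otherwise it travels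
    along the half circle through the product of x_i with the imaginary unit.
    The speeds are such that a coordinate x_i = e does not move in the first
    half of the time, and a coordinate y_i = e has been reached by then; so the
    path stays first in the subtorus of the support of x and then in that of y.
    A neighbourhood of F_j is retracted onto F_j by replacing y_i with - x_i on
    the j coordinates which are closest to antipodal, and then collapsing to e
    a ball around e whose radius is the distance of the result from X * X. *)

(** * Mod 2 cochains on ordered simplices *)

Lemma addF2 (x : 'F_2) : x + x = 0.
Proof. by rewrite -mulr2n -mulr_natr (_ : 2%:R = 0) ?mulr0 //; apply/val_inj. Qed.

Lemma addF2_eq0 (x y : 'F_2) : (x + y = 0) <-> (x = y).
Proof.
split=> [h|->]; last exact: addF2.
by rewrite -[x]addr0 -(addF2 y) addrA h add0r.
Qed.

(** The involution has no fixed point, because [P] selects one member of each pair; the two equal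
    terms of a pair cancel mod 2. *)
Lemma sum_pairing (T : finType) (f : T -> T) (P : pred T) (F : T -> 'F_2) :
  involutive f -> (forall x, P (f x) = ~~ P x) -> (forall x, F (f x) = F x) ->
  \sum_x F x = 0.
Proof.
move=> fK Pf Ff; rewrite (bigID P) /=.
rewrite [X in X + _](reindex_inj (inv_inj fK)) /=.
under eq_bigl do rewrite Pf.
by under eq_bigr do rewrite Ff; rewrite addF2.
Qed.

Section Cochains.
Variable V : Type.
Implicit Types (s : nat -> V) (a b c : (nat -> V) -> 'F_2).

(* A p-simplex is encoded by a sequence of which only the entries 0, ..., p
   matter; [depends_on p] says that a is a p-cochain. *)
Definition depends_on p a :=
  forall s s', (forall i, (i <= p)%N -> s i = s' i) -> a s = a s'.

Definition face j s : nat -> V := fun i => s (bump j i).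

Definition coboundary p a s := \sum_(j < p.+2) a (face j s).

(** The Alexander-Whitney product. The front face need not be cut out, since a [p]-cochain ignores
    the later entries. *)
Definition cup p a b s := a s * b (fun i => s (p + i)%N).

Lemma coboundary_depends p a :
  depends_on p a -> depends_on p.+1 (coboundary p a).
Proof.
move=> da s s' h; apply: eq_bigr => j _; apply: da => i ip.
by apply: h; rewrite /bump; lia.
Qed.

Lemma cup_depends p q a b :
  depends_on p a -> depends_on q b -> depends_on (p + q) (cup p a b).
Proof.
move=> da db s s' h; congr (_ * _).
  by apply: da => i ip; apply: h; apply: leq_trans ip (leq_addr _ _).
by apply: db => i iq; apply: h; rewrite leq_add2l.
Qed.

(** Leibniz rule. The last face in [coboundary p a] and the face 0 in [coboundary q b] both
    contribute [a] on the vertices 0, ..., p times [b] on the vertices from p + 1 on, and these two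
    terms cancel mod 2. *)
Lemma coboundary_cup p q a b s : depends_on p a -> depends_on q b ->
  coboundary (p + q) (cup p a b) s
  = cup p.+1 (coboundary p a) b s + cup p a (coboundary q b) s.
Proof.
move=> da db; rewrite /cup /coboundary.
have -> : \sum_(j < p.+2) a (face j s)
          = \sum_(0 <= j < p.+1) a (face j s) + a (face p.+1 s).
  by rewrite -(big_mkord xpredT (fun j => a (face j s))) big_nat_recr.
have -> : \sum_(j < q.+2) b (face j (fun i => s (p + i)%N))
          = b (face 0 (fun i => s (p + i)%N)) +
            \sum_(0 <= j < q.+1) b (face j.+1 (fun i => s (p + i)%N)).
  rewrite -(big_mkord xpredT (fun j => b (face j (fun i => s (p + i)%N)))).
  by rewrite big_nat_recl.
rewrite -(big_mkord xpredT (fun j => a (face j s) * b (fun i => face j s (p + i)%N))).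
rewrite (@big_cat_nat _ _ _ p.+1) //=; last by lia.
rewrite mulrDl mulrDr !mulr_suml -[RHS]addrA; congr (_ + _).
  apply: eq_big_nat => j /andP[_ jp]; congr (_ * _); apply: db => i _.
  by rewrite /face; congr (s _); rewrite /bump; lia.
have -> : a (face p.+1 s) = a s.
  by apply: da => i ip; rewrite /face /bump; case: leqP => //; lia.
rewrite addrA.
have -> : b (face 0 (fun i => s (p + i)%N)) = b (fun i => s (p.+1 + i)%N).
  by apply: db => i _; rewrite /face; congr (s _); rewrite /bump; lia.
rewrite addF2 add0r mulr_sumr.
rewrite -{1}[p.+1]add0n [((p + q).+2)](_ : _ = (q.+1 + p.+1)%N) ?big_addn ?addnK; last by lia.
apply: eq_big_nat => j jq; congr (_ * _).
  by apply: da => i ip; rewrite /face /bump; case: leqP => //; lia.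
apply: db => i _; rewrite /face; congr (s _).
by rewrite /bump; lia.
Qed.

(** The terms with i <= j and those with i > j are matched by sending (i, j) to (j + 1, i), as in
    the simplicial identity for iterated faces. *)
Lemma sum_simplicial n (g : nat -> nat -> 'F_2) :
  (forall i j, (i <= j)%N -> (j < n)%N -> g i j = g j.+1 i) ->
  \sum_(0 <= i < n.+1) \sum_(0 <= j < n) g i j = 0.
Proof.
move=> h.
pose lo i j : 'F_2 := if (i <= j)%N then g i j else 0.
pose up i j : 'F_2 := if (i <= j)%N then 0 else g i j.
have -> : \sum_(0 <= i < n.+1) \sum_(0 <= j < n) g i j =
  \sum_(0 <= i < n.+1) \sum_(0 <= j < n) lo i j +
  \sum_(0 <= i < n.+1) \sum_(0 <= j < n) up i j.
  rewrite -big_split; apply: eq_bigr => i _; rewrite -big_split.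
  by apply: eq_bigr => j _; rewrite /= /lo /up; case: ifP; rewrite ?addr0 ?add0r.
have -> : \sum_(0 <= i < n.+1) \sum_(0 <= j < n) lo i j
          = \sum_(0 <= i < n) \sum_(0 <= j < n) lo i j.
  rewrite big_nat_recr //= [X in _ + X]big_nat_cond [X in _ + X]big1 ?addr0 //.
  by move=> j jn; rewrite /lo ifF //; lia.
rewrite [X in _ + X]exchange_big_nat /=.
apply/addF2_eq0; apply: eq_big_nat => i ilt.
rewrite [RHS]big_nat_recl //= [up 0%N i](_ : _ = 0) // add0r.
apply: eq_big_nat => j jlt; rewrite /lo /up.
by case: (leqP i j) => // ij; apply: h => //; lia.
Qed.

Lemma coboundary_coboundary p a s : depends_on p a ->
  coboundary p.+1 (coboundary p a) s = 0.
Proof.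
move=> da; rewrite /coboundary.
rewrite -(big_mkord xpredT (fun i => \sum_(j < p.+2) a (face j (face i s)))).
under eq_bigr do rewrite -(big_mkord xpredT (fun j => a (face j (face _ s)))).
apply: sum_simplicial => i j ij jp; apply: da => k _.
by rewrite /face; congr (s _); rewrite /bump; lia.
Qed.

End Cochains.

Section Prism.
Variable U : Type.
Implicit Types (a b : nat -> U) (w : (nat -> U) -> 'F_2).

(* The j-th simplex of the triangulated prism over the simplices a and b. *)
Definition prism j a b : nat -> U := fun i => if (i <= j)%N then a i else b i.-1.

(** The prism formula for a homotopy. In the sum of the closedness relations of all prism simplices
    every interior wall occurs twice, so that only the two ends and the prisms over the faces of [a]
    and [b] survive. *)
Lemma prism_boundary d w a b : depends_on d w ->
  (forall j, (j <= d)%N -> coboundary d w (prism j a b) = 0) ->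
  \sum_(i < d.+1) \sum_(j < d) w (prism j (face i a) (face i b)) = w a + w b.
Proof.
move=> dw h.
pose H i j := w (prism j (face i a) (face i b)).
(* [Q j] is the value on the wall between the prism simplices j - 1 and j; the extreme indices give
   the two ends. *)
pose Q j := w (fun i => if (i < j)%N then a i else b i).
have Q0 : Q 0%N = w b by apply: dw.
have Qd : Q d.+1 = w a by apply: dw => i id; rewrite ltnS id.
pose lo i j : 'F_2 := if (i <= j)%N then H i j else 0.
pose up i j : 'F_2 := if (i <= j)%N then 0 else H i j.
have step j : (j <= d)%N -> (if j is j'.+1 then \sum_(i < d.+1) lo i j' else 0)
   + \sum_(i < d.+1) up i j = Q j + Q j.+1.
  move=> jd; apply/addF2_eq0; rewrite -[RHS](h j jd) /coboundary.
  pose G i := w (face i (prism j a b)).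
  have ltE i : (i < j)%N -> G i = H i j.-1.
    move=> ij; apply: dw => k kd; rewrite /face /prism.
    rewrite (_ : (bump i k <= j) = (k <= j.-1))%N; last by rewrite /bump; lia.
    by case: leqP => // kj; congr b; rewrite /bump; lia.
  have gtE i : (j < i)%N -> G i.+1 = H i j.
    move=> ij; apply: dw => k kd; rewrite /face /prism.
    rewrite (_ : (bump i.+1 k <= j) = (k <= j))%N; last by rewrite /bump; lia.
    by case: leqP => kj; [congr a|congr b]; rewrite /bump; lia.
  have eqE : G j = Q j.
    apply: dw => k kd; rewrite /face /prism.
    rewrite (_ : (bump j k <= j) = (k < j))%N; last by rewrite /bump; lia.
    by case: leqP => kj; [congr b|congr a]; rewrite /bump; lia.
  have eqSE : G j.+1 = Q j.+1.
    apply: dw => k kd; rewrite /face /prism.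
    rewrite (_ : (bump j.+1 k <= j) = (k < j.+1))%N; last by rewrite /bump; lia.
    by case: leqP => kj; [congr b|congr a]; rewrite /bump; lia.
  have -> : \sum_(i < d.+2) G i = \sum_(0 <= i < j) G i + (G j + (G j.+1 +
      \sum_(j.+2 <= i < d.+2) G i)).
    rewrite -(big_mkord xpredT G) (@big_cat_nat _ _ _ j) //=; last by lia.
    congr (_ + _); rewrite big_ltn; last by lia.
    by congr (_ + _); rewrite big_ltn; last by lia.
  have -> : \sum_(0 <= i < j) G i = if j is j'.+1 then \sum_(i < d.+1) lo i j' else 0.
    case: (j) jd ltE => [|j'] jd ltE; first by rewrite big_nil.
    rewrite -(big_mkord xpredT (lo^~ j')) [RHS](@big_cat_nat _ _ _ j'.+1) /= ; [|by []|by lia].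
    rewrite [X in _ = _ + X]big_nat_cond [X in _ = _ + X]big1 ?addr0.
      by apply: eq_big_nat => i ij; rewrite /lo ifT ?ltE //; lia.
    by move=> i ij; rewrite /lo ifF //; lia.
  have -> : \sum_(j.+2 <= i < d.+2) G i = \sum_(i < d.+1) up i j.
    rewrite -(big_mkord xpredT (up^~ j)) [RHS](@big_cat_nat _ _ _ j.+1) //=.
    rewrite [X in _ = X + _]big_nat_cond [X in _ = X + _]big1 ?add0r.
      rewrite -[j.+2]addn1 -[d.+2]addn1 big_addn addn1 subn1.
      by apply: eq_big_nat => i ij; rewrite addn1 /up ifF ?gtE //; lia.
    by move=> i ij; rewrite /up ifT //; lia.
  by rewrite eqE eqSE -[LHS]addrA; congr (_ + _); rewrite [LHS]addrC -addrA.
have : \sum_(j < d.+1) (Q j + Q j.+1) = w a + w b.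
  rewrite big_split /= big_ord_recl [X in _ + X]big_ord_recr /= Q0 Qd.
  under eq_bigr do rewrite /bump /= add1n.
  by rewrite -addrA [X in _ + X]addrA addF2 add0r addrC.
move=> <-; rewrite -(big_mkord xpredT (fun j => Q j + Q j.+1)).
under eq_big_nat => j jd do rewrite -step //.
rewrite big_split /= big_nat_recl //= add0r.
rewrite [X in _ = _ + X]big_nat_recr //= [X in _ = _ + (_ + X)]big1 ?addr0; last first.
  by move=> i _; rewrite /up ifT //; rewrite -ltnS.
rewrite -big_split /= exchange_big /= big_mkord.
apply: eq_bigr => j _; rewrite -big_split; apply: eq_bigr => i _ /=.
by rewrite /lo /up; case: ifP; rewrite ?addr0 ?add0r.
Qed.

End Prism.

(** * Integration over the Kuhn triangulation of a finite torus *)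

Section Kuhn.
Variables (V : finZmodType) (N : nat) (e : 'I_N -> V).

Definition kuhn (v : V) (sg : 'S_N) (i : nat) : V :=
  v + \sum_(t < N | (t < i)%N) e (sg t).

(** Repetitions and any order of the vertices are allowed, which makes the notion stable under every
    reindexing, in particular under facets and back faces. *)
Definition in_kuhn (s : nat -> V) :=
  exists v sg, forall i, exists j, s i = kuhn v sg j.

Definition cocycle p (a : (nat -> V) -> 'F_2) :=
  forall s, in_kuhn s -> coboundary p a s = 0.

Lemma in_kuhn_comp s f : in_kuhn s -> in_kuhn (s \o f).
Proof. by move=> [v [sg h]]; exists v, sg => i; exact: h. Qed.

Lemma in_kuhn_kuhn v sg : in_kuhn (kuhn v sg).
Proof. by exists v, sg => i; exists i. Qed.

(** Here [p] is the degree of the result; in degree 0 nothing can be a nonzero coboundary, whence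
    the value 0. *)
Definition cobd p (a : (nat -> V) -> 'F_2) s : 'F_2 :=
  if p is p'.+1 then coboundary p' a s else 0.

Fixpoint cupn d (cs : seq ((nat -> V) -> 'F_2)) : (nat -> V) -> 'F_2 :=
  if cs is c :: cs' then cup d c (cupn d cs') else fun=> 1.

Lemma cupn_depends d cs : (forall c, List.In c cs -> depends_on d c) ->
  depends_on (size cs * d) (cupn d cs).
Proof.
elim: cs => [_ s s' //|c cs IH] h /=; rewrite mulSn; apply: cup_depends.
  by apply: h; left.
by apply: IH => c' cin; apply: h; right.
Qed.

Lemma cupn_cocycle d cs :
  (forall c, List.In c cs -> depends_on d c /\ cocycle d c) ->
  cocycle (size cs * d) (cupn d cs).
Proof.
elim: cs => [_ s _ /=|c cs IH h s hs /=].
  by rewrite mul0n /coboundary !big_ord_recl big_ord0 addr0 addF2.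
have [dc zc] := h c (or_introl erefl).
have h' c' : List.In c' cs -> depends_on d c' /\ cocycle d c' by move=> ?; apply: h; right.
rewrite mulSn coboundary_cup //; last by apply: cupn_depends => c' /h' [].
rewrite /cup zc // mul0r add0r.
by rewrite IH ?mulr0 //; apply: in_kuhn_comp hs.
Qed.

(** With A and A' the products of the tails, c A + c' A' = (c + c') A' + c (A + A'), and this is the
    coboundary of b A' + c g, because c and A' are cocycles. *)
Lemma cupn_cohomologous d cs cs' bs :
  (forall c, List.In c cs -> depends_on d.+1 c /\ cocycle d.+1 c) ->
  (forall c, List.In c cs' -> depends_on d.+1 c /\ cocycle d.+1 c) ->
  size cs = size cs' ->
  (forall i, (i < size cs)%N -> depends_on d (nth (fun=> 0) bs i) /\
    forall s, in_kuhn s -> nth (fun=> 0) cs i s + nth (fun=> 0) cs' i s =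
      coboundary d (nth (fun=> 0) bs i) s) ->
  exists g, depends_on (size cs * d.+1).-1 g /\
    forall s, in_kuhn s ->
      cupn d.+1 cs s + cupn d.+1 cs' s = cobd (size cs * d.+1) g s.
Proof.
elim: cs cs' bs => [|c cs IH] [|c' cs'] bs //= hc hc' sz hb.
  by exists (fun=> 0); split => // s _; rewrite addF2.
have [[dc zc] [dc' zc']] := (hc c (or_introl erefl), hc' c' (or_introl erefl)).
case: sz => sz.
have hcs x : List.In x cs -> depends_on d.+1 x /\ cocycle d.+1 x by move=> ?; apply: hc; right.
have hcs' x : List.In x cs' -> depends_on d.+1 x /\ cocycle d.+1 x by move=> ?; apply: hc'; right.
have [g [dg gE]] : exists g, depends_on (size cs * d.+1).-1 g /\
    forall s, in_kuhn s ->
      cupn d.+1 cs s + cupn d.+1 cs' s = cobd (size cs * d.+1) g s.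
  by apply: (IH cs' (behead bs)) => // i ilt; rewrite nth_behead; apply: (hb i.+1).
have [db bE] := hb 0%N isT; set b := nth _ bs 0 in db bE.
have dA : depends_on (size cs * d.+1) (cupn d.+1 cs') .
  by rewrite sz; apply: cupn_depends => x /hcs' [].
have zA : cocycle (size cs * d.+1) (cupn d.+1 cs') by rewrite sz; apply: cupn_cocycle.
set n := (size cs * d.+1)%N in dg gE dA zA *.
(* For empty tails [g] would have degree -1, so the second summand is dropped. *)
pose f := if n is n'.+1 then cup d.+1 c g else (fun=> 0).
exists (fun s => cup d b (cupn d.+1 cs') s + f s).
have df : depends_on (d.+1 + n).-1 f.
  rewrite /f; case: (n) dg => [//|n'] /= dg; rewrite addnS.
  exact: (@cup_depends _ d.+1 n').
have dbA := cup_depends db dA.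
split=> [|s hs]; rewrite -[(d + n)%coq_nat]/(d + n)%N.
  by move=> s s' h; rewrite (dbA s s' h); congr (_ + _); apply: df => i; rewrite addSn; exact: h.
rewrite /coboundary big_split /= -!/(coboundary _ _ _).
rewrite [coboundary _ (cup d b _) s]coboundary_cup // [X in _ + X + _]/cup zA ?mulr0 ?addr0;
    last first.
  exact: in_kuhn_comp hs.
have -> : coboundary (d + n) f s = cup d.+1 c (cobd n g) s.
  rewrite /f; case: (n) dg {gE dA zA dbA df} => [|n'] dg /=.
    by rewrite /coboundary big1 // /cup mulr0.
  rewrite addnS -addSn coboundary_cup // [X in X + _]/cup zc // mul0r add0r.
  by [].
rewrite /cup -gE -?bE //; last exact: in_kuhn_comp hs.
by rewrite mulrDl mulrDr [RHS]addrC -[RHS]addrA [X in _ = _ + X]addrA addF2 add0r.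
Qed.

End Kuhn.

Section Stokes.
Variables (V : finZmodType) (N : nat) (e : 'I_N.+1 -> V).

(* Every codimension one simplex lies on exactly two top simplices. *)
Lemma kuhn_integral_coboundary a : depends_on N a ->
  \sum_v \sum_(sg : 'S_N.+1) coboundary N a (kuhn e v sg) = 0.
Proof.
move=> da; rewrite /coboundary.
under eq_bigr do rewrite exchange_big /=.
rewrite exchange_big /= big_ord_recl big_ord_recr /=.
rewrite [X in _ + (X + _)]big1 ?add0r => [|j _].
  (* The facet opposite to the first vertex of the simplex of [v] and [sg] is the facet opposite to
     the last vertex of the simplex at [v + e (sg 0)] with cyclically shifted order. Translation
     permutes the finite group [V], so no boundary is left. *)
  apply/addF2_eq0.
  pose cyc : 'S_N.+1 := perm (@ordS_inj N.+1).
  rewrite exchange_big [RHS]exchange_big /=.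
  rewrite [RHS](reindex_inj (mulgI cyc)) /=; apply: eq_bigr => sg _.
  rewrite [RHS](reindex_inj (addIr (e (sg ord0)))) /=; apply: eq_bigr => v _.
  apply: da => i iN; rewrite /face /kuhn /bump /= leqNgt ltnS iN /= add0n add1n.
  rewrite -addrA; congr (_ + _).
  rewrite big_mkcond big_ord_recl /=; congr (_ + _).
  rewrite [RHS]big_mkcond [RHS]big_ord_recr /= ltnNge iN addr0.
  apply: eq_bigr => t _; rewrite /bump /= add1n ltnS; case: ifP => // ti.
  rewrite permM permE; congr (e (sg _)); apply/val_inj => /=.
  by rewrite /bump /= add1n modn_small // ltnS.
apply: big1 => v _.
have j1 : (j.+1 < N.+1)%N by rewrite ltnS.
pose x : 'I_N.+1 := widen_ord (leqnSn _) j; pose y : 'I_N.+1 := Ordinal j1.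
(* Omitting the vertex between two consecutive steps forgets their order, so the simplices that
   differ by exchanging these steps share the facet. *)
apply: (@sum_pairing _ (fun sg => (tperm x y * sg)%g) (fun sg => (sg x < sg y)%N)) => sg /=.
- by rewrite mulgA tperm2 mul1g.
- rewrite !permM tpermL tpermR -leqNgt ltn_neqAle andb_idl // => _.
  by apply/negP => /eqP /val_inj /perm_inj /(congr1 val) /=; lia.
apply: da => i iN; rewrite /face /kuhn; congr (_ + _).
rewrite (reindex_inj (@perm_inj _ (tperm x y))) /=.
apply: eq_big => t; last by rewrite permM tpermK.
rewrite /bump /=; case: tpermP => [-> | -> |//] /=; lia.
Qed.

End Stokes.

Lemma In_mkseq (T : Type) (f : nat -> T) n x :
  List.In x (mkseq f n) -> exists2 i, (i < n)%N & x = f i.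
Proof.
rewrite /mkseq -[n in exists2 i, (i < n)%N & _]add0n.
elim: n 0%N => //= n IH k [<-|/IH[i ilt ->]]; first by exists k => //; lia.
by exists i => //; lia.
Qed.

Lemma cupnE (V : finZmodType) d (c : nat -> (nat -> V) -> 'F_2) n s :
  cupn d (mkseq c n) s = \prod_(i < n) c i (fun k => s (i * d + k)%N).
Proof.
elim: n c s => [|n IH] c s; first by rewrite big_ord0.
have -> : mkseq c n.+1 = c 0%N :: mkseq (c \o S) n.
  by rewrite /mkseq /= (iotaDl 1 0) -map_comp.
rewrite /= /cup IH big_ord_recl; congr (_ * _).
apply: eq_bigr => i _ /=; rewrite /bump /= add1n mulSn.
by congr (c _ _); apply: boolp.funext => k; rewrite addnA.
Qed.

(** Replace each [w i] by the cohomologous [w i + coboundary d (b i)]. On every top simplex one of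
    the new factors vanishes; the old product differs from the new one by a coboundary, which sums
    to zero over all top simplices. *)
Lemma kuhn_integral_cup_eq0 (V : finZmodType) m d (e : 'I_(m.+1 * d.+1) -> V)
    (w b : nat -> (nat -> V) -> 'F_2) :
  (forall i, depends_on d.+1 (w i)) -> (forall i, cocycle e d.+1 (w i)) ->
  (forall i, depends_on d (b i)) ->
  (forall v sg, exists2 i, (i < m.+1)%N &
    forall f, w i (kuhn e v sg \o f) = coboundary d (b i) (kuhn e v sg \o f)) ->
  \sum_v \sum_(sg : 'S_(m.+1 * d.+1))
    \prod_(i < m.+1) w i (fun k => kuhn e v sg (i * d.+1 + k)%N) = 0.
Proof.
move=> dw zw db h.
pose w' i s := w i s + coboundary d (b i) s.
have [|||i|g [dg gE]] := @cupn_cohomologous V _ e d (mkseq w m.+1) (mkseq w' m.+1) (mkseq b m.+1).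
- by move=> c cin; have [i _ ->] := In_mkseq cin; split; [exact: (dw i)|exact: (zw i)].
- move=> c cin; have [i _ ->] := In_mkseq cin; split.
    move=> s s' ss'; rewrite /w' (dw i s s' ss'); congr (_ + _).
    exact: (coboundary_depends (db i) ss').
  move=> s hs; rewrite /coboundary big_split /= -!/(coboundary _ _ _) zw //.
  by rewrite coboundary_coboundary // addr0.
- by rewrite !size_mkseq.
- rewrite size_mkseq => im; rewrite !nth_mkseq //; split => // s _.
  by rewrite /w' addrA addF2 add0r.
rewrite size_mkseq in dg gE.
under eq_bigr do under eq_bigr do rewrite -cupnE.
transitivity (\sum_v \sum_(sg : 'S_(m.+1 * d.+1)) cobd (m.+1 * d.+1) g (kuhn e v sg)).
  apply: eq_bigr => v _; apply: eq_bigr => sg _; rewrite -gE; last exact: in_kuhn_kuhn.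
  rewrite [X in _ + X]cupnE; have [i im wi] := h v sg.
  rewrite [X in _ + X](bigD1 (Ordinal im)) //= [X in _ + X * _](_ : _ = 0) ?mul0r ?addr0 //.
  rewrite /w'; set f := fun _ => _.
  by rewrite -[f]/(kuhn e v sg \o (fun k => (i * d.+1 + k)%N)) wi addF2.
exact: (@kuhn_integral_coboundary V (d + m * d.+1) e).
Qed.

(* With 0, ..., d.+1 as the vertices of a simplex, whose boundary is a d-sphere,
   [fullc d] is the fundamental cocycle of that boundary supported on the face
   opposite to d.+1. *)
Definition full d (a : nat -> nat) : bool :=
  [forall l : 'I_d.+1, exists k : 'I_d.+1, a k == l :> nat].

Definition fullc d (a : nat -> nat) : 'F_2 := (full d a)%:R.

Lemma fullP d a :
  reflect (forall l, (l <= d)%N -> exists2 k, (k <= d)%N & a k = l) (full d a).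
Proof.
apply: (iffP forallP) => h l.
  move=> ld; have /existsP[k /eqP kl] := h (Ordinal (ld : (l < d.+1)%N)).
  by exists k; rewrite // -ltnS.
have [k kd kl] := h l (ltn_ord l).
by apply/existsP; exists (Ordinal (kd : (k < d.+1)%N)); apply/eqP.
Qed.

Lemma fullc_depends d : depends_on d (fullc d).
Proof.
move=> s s' h; congr (_ %:R); congr nat_of_bool.
apply: eq_forallb => l; apply: eq_existsb => k; rewrite h //.
by rewrite -ltnS.
Qed.

(** Sperner's parity argument. If one of the labels 0, ..., d is missing, no facet is full.
    Otherwise exactly one label is repeated, and the full facets are the two opposite to its
    occurrences. *)
Lemma fullc_coboundary d (a : nat -> nat) :
  (forall k, (k <= d.+1)%N -> (a k <= d.+1)%N) -> ~~ full d.+1 a ->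
  coboundary d (fullc d) a = 0.
Proof.
move=> ha na.
have [h|[l ld hl]] : (forall l, (l <= d)%N -> exists2 k, (k <= d.+1)%N & a k = l) \/
    (exists2 l, (l <= d)%N & forall k, (k <= d.+1)%N -> a k <> l).
- have [/forallP h|] := boolP [forall l : 'I_d.+1, exists k : 'I_d.+2, a k == l :> nat].
    left=> l ld; have /existsP[k /eqP kl] := h (Ordinal (ld : (l < d.+1)%N)).
    by exists k; rewrite // -ltnS.
  rewrite negb_forall => /existsP[l]; rewrite negb_exists => /forallP h.
  right; exists l; first by rewrite -ltnS.
  by move=> k kd; apply/eqP; exact: (h (Ordinal (kd : (k < d.+2)%N))).
- have ad k : (k <= d.+1)%N -> (a k < d.+1)%N.
    move=> kd; have := ha k kd; rewrite leq_eqVlt => /orP[/eqP ak|//].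
    case/negP: na; apply/fullP => l; rewrite leq_eqVlt => /orP[/eqP ->|]; first by exists k.
    by rewrite ltnS => /h.
  pose f (k : 'I_d.+2) : 'I_d.+1 := inord (a k).
  have fE k : f k = a k :> nat by rewrite inordK // ad // -ltnS.
  have /injectivePn[x [y xy fxy]] : ~~ injectiveb f.
    by apply/negP => /injectiveP /leq_card; rewrite !card_ord ltnn.
  (* Without [x], the remaining d + 1 vertices still carry all d + 1 labels, hence carry them
     injectively. *)
  have inj u v : u != x -> v != x -> f u = f v -> u = v.
    have sub : [set: 'I_d.+1] \subset f @: [set~ x].
      apply/fintype.subsetP => l _; have [k kd kl] := h l (ltn_ord l).
      have kk : f (Ordinal (kd : (k < d.+2)%N)) = l by apply/val_inj; rewrite /= fE.
      have [e|ne] := eqVneq (Ordinal (kd : (k < d.+2)%N)) x.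
        by apply/imsetP; exists y; rewrite ?inE 1?eq_sym // -fxy -e.
      by apply/imsetP; exists (Ordinal (kd : (k < d.+2)%N)); rewrite ?inE.
    have /imset_injP fi : #|f @: [set~ x]| == #|[set~ x]|.
      rewrite eqn_leq leq_imset_card cardsC1 card_ord.
      by have := subset_leq_card sub; rewrite cardsT card_ord.
    by move=> ux vx; apply: fi; rewrite !inE.
  have fullE (j : 'I_d.+2) : full d (face j a) = [exists k, (k != j) && (f k == f j)].
    apply/fullP/existsP => [hf|[k /andP[kj /eqP fkj]] l ld].
      have fjd : (f j <= d)%N by rewrite -ltnS.
      have [k kd] := hf (f j) fjd; rewrite /face => kE.
      exists (inord (bump j k)); have bd : (bump j k < d.+2)%N by rewrite /bump; lia.
      rewrite -!val_eqE /= fE inordK // kE eqxx andbT.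
      by rewrite eq_sym neq_bump.
    have [k' kd' kl'] := h l ld.
    have lift_ (u : nat) : (u <= d.+1)%N -> u != j :> nat ->
        exists2 k0, (k0 <= d)%N & face j a k0 = a u.
      move=> ud uj; exists (unbump j u); last by rewrite /face unbumpK // inE.
      by have := ltn_ord j; move: uj ud; rewrite /unbump; lia.
    have [kj'|kj'] := eqVneq k' (j : nat); last by have := lift_ k' kd' kj'; rewrite kl'.
    have kd : (k <= d.+1)%N by rewrite -ltnS.
    have := lift_ k kd kj.
    by rewrite -fE fkj fE -kj' kl'.
  rewrite /coboundary (bigD1 x) //= (bigD1 y) /= 1?eq_sym // big1 => [|j /andP[jx jy]].
    rewrite /fullc !fullE.
    have -> : [exists k, (k != x) && (f k == f x)].
      by apply/existsP; exists y; rewrite eq_sym xy fxy eqxx.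
    have -> : [exists k, (k != y) && (f k == f y)].
      by apply/existsP; exists x; rewrite xy fxy eqxx.
    by rewrite addr0 addF2.
  rewrite /fullc fullE; case: existsP => // -[k /andP[kj /eqP fkj]].
  have [kx|kx] := eqVneq k x; last by rewrite (inj _ _ kx jx fkj) eqxx in kj.
  move: fkj; rewrite kx fxy => /inj; rewrite eq_sym xy => /(_ isT jx) yj.
  by rewrite yj eqxx in jy.
apply: big1 => j _; rewrite /fullc; case: fullP => // /(_ l ld)[k kd].
by rewrite /face => /hl; case; rewrite /bump; lia.
Qed.

(** * Labels on the discrete torus *)

Section Lattice.
Variables (M m d : nat).
Hypothesis M2 : (2 < M)%N.
Let N := (m.+1 * d.+1)%N.
Notation Z := 'Z_(M.*2).
Notation V := 'rV[Z]_N.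

Definition unit_step (t : 'I_N) : V := delta_mx 0 t.

(** [(sg^-1)%g t] is the time at which the coordinate [t] is raised. *)
Lemma kuhn_coord v (sg : 'S_N) s t :
  kuhn unit_step v sg s 0 t = v ord0 t + ((sg^-1)%g t < s)%N%:R.
Proof.
rewrite /kuhn mxE summxE; congr (_ + _).
rewrite (eq_bigr (fun t' => (t' == (sg^-1)%g t)%:R)); last first.
  move=> t' _; rewrite mxE eqxx /=; congr (_ %:R); congr nat_of_bool.
  by rewrite -(inj_eq (@perm_inj _ sg)) permKV eq_sym.
rewrite big_mkcond (bigD1 ((sg^-1)%g t)) //= eqxx big1 ?addr0; first by case: ifP.
by move=> t' /negPf ->; case: ifP.
Qed.

Definition block (i j : nat) : 'I_N := @inord (d + m * d.+1) (i * d.+1 + j).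

Lemma blockE i j : (i <= m)%N -> (j <= d)%N -> block i j = (i * d.+1 + j)%N :> nat.
Proof.
move=> im jd; apply: inordK; rewrite -[X in (_ < X)%N]/(d + m * d.+1).+1.
by have := leq_mul im (leqnn d.+1); lia.
Qed.

(** In the cube coordinate c / M - 1 this is the open interval of radius 1/2 about 0. *)
Definition middle (c : Z) : bool := (M < c.*2)%N && (c.*2 < 3 * M)%N.

(* The [sign_label] of the image of the i-th block of v under the degree-one map
   [gridu], computed on the lattice. *)
Definition lattice_label (i : nat) (v : V) : nat :=
  if [forall j : 'I_d.+1, middle (v ord0 (block i j))]
  then find (fun j => (v ord0 (block i j) < M)%N) (iota 0 d.+1) else d.+2.

Lemma lattice_labelP i v l : lattice_label i v = l -> (l <= d.+1)%N ->
  [/\ forall j, (j <= d)%N -> middle (v ord0 (block i j)),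
      forall j, (j < l)%N -> (M <= v ord0 (block i j))%N &
      (l <= d)%N -> (v ord0 (block i l) < M)%N].
Proof.
rewrite /lattice_label; case: forallP => [h|_ <-]; last by rewrite ltnn.
move=> <- ld; split.
- by move=> j jd; apply: (h (Ordinal (jd : (j < d.+1)%N))).
- move=> j jf; rewrite leqNgt; have := before_find 0%N jf.
  by rewrite nth_iota ?add0n => [->//|]; apply: leq_trans jf _;
      rewrite -[leqRHS](size_iota 0) find_size.
- rewrite -ltnS => lt; have := lt.
  rewrite -[X in (_ < X)%N](size_iota 0) -has_find => /(nth_find 0%N).
  by rewrite nth_iota ?add0n.
Qed.

(** Every coordinate lies one step below the centre M, so that its cube coordinate is negative and
    ceases to be so once it is raised. *)
Definition center : V := const_mx (inZp M.-1).

Lemma valZ1 (c : Z) : middle c -> val (c + 1) = c.+1.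
Proof.
case/andP=> _ c3; rewrite /= [X in (_ %% X)%N]Zp_cast; last by lia.
by rewrite (@modn_small 1) ?Zp_cast ?modn_small ?addn1 //; lia.
Qed.

Lemma lattice_label_center i s : (i <= m)%N -> (s <= d.+1)%N ->
  lattice_label i (kuhn unit_step center 1%g (i * d.+1 + s)) = s.
Proof.
move=> im sd.
have vE j : (j <= d)%N -> kuhn unit_step center 1%g (i * d.+1 + s) ord0 (block i j)
    = (M.-1 + (j < s))%N :> nat.
  move=> jd; rewrite kuhn_coord invg1 perm1 mxE blockE // ltn_add2l.
  have cE : (inZp M.-1 : Z) = M.-1 :> nat by rewrite /= Zp_cast ?modn_small; lia.
  have cm : middle (inZp M.-1) by rewrite /middle cE; lia.
  by case: ltnP => _; rewrite ?mulr1n ?mulr0n ?addr0 ?addn0 ?valZ1 // cE addn1.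
rewrite /lattice_label ifT; last first.
  by apply/forallP => j; rewrite /middle vE -1?ltnS //; lia.
have -> : iota 0 d.+1 = iota 0 s ++ iota s (d.+1 - s).
  by rewrite -[X in iota X (_ - _)]add0n -iotaD subnKC.
rewrite find_cat ifF; last first.
  apply/negbTE/hasPn => j; rewrite mem_iota /= add0n => js.
  by rewrite vE ?js -?leqNgt; lia.
rewrite size_iota; case: (ltnP s d.+1) => [sd'|ds].
  by rewrite subSn //= vE // ltnn addn0 prednK ?leqnn ?addn0 //; lia.
by rewrite (eqP (_ : d.+1 - s == 0)%N) /= ?addn0 // subn_eq0.
Qed.

(** Within a block, the labels [j] and [d.+1] show the coordinate [j] before and after it reaches M,
    so it starts at M - 1. The positions at which the labels occur then bound from below the time at
    which each coordinate is raised. *)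
Lemma full_lattice_label v (sg : 'S_N) :
  (forall i, (i <= m)%N ->
    full d.+1 (fun k => lattice_label i (kuhn unit_step v sg (i * d.+1 + k)))) ->
  v = center /\ sg = 1%g.
Proof.
move=> h.
pose tau := (sg^-1)%g; pose lab i k := lattice_label i (kuhn unit_step v sg (i * d.+1 + k)).
have key i j : (i <= m)%N -> (j <= d)%N ->
    v ord0 (block i j) = inZp M.-1 /\ (block i j <= tau (block i j))%N.
  move=> im jd; have /fullP hi := h i im; rewrite -/(lab i) in hi.
  have coordE k j' : kuhn unit_step v sg (i * d.+1 + k) ord0 (block i j')
     = v ord0 (block i j') + (tau (block i j') < i * d.+1 + k)%N%:R by exact: kuhn_coord.
  have vE j' : (j' <= d)%N -> v ord0 (block i j') = M.-1 :> nat.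
    move=> jd'; have [|a _ aE] := hi j'; first exact: leqW.
    have [b _ bE] := hi d.+1 (leqnn _).
    have [mida _] := lattice_labelP aE (leqW jd').
    move/(_ jd'); have := mida j' jd'; rewrite coordE.
    have [midb /(_ j' jd')] := lattice_labelP bE (leqnn _).
    have := midb j' jd'; rewrite coordE => + + _.
    set x := v ord0 (block i j').
    case: ltnP => _; case: ltnP => _; rewrite ?addr0; try by lia.
      move=> m1 le m0 lt; move: le; rewrite valZ1 //; lia.
    move=> m0 le m1; rewrite valZ1 //; lia.
  have lt_ a j' : (a <= d.+1)%N -> (j' <= d)%N -> lab i a = j' ->
      (i * d.+1 + a <= tau (block i j'))%N.
    move=> ad jd' aE; have [mida _ /(_ jd')] := lattice_labelP aE (leqW jd').
    rewrite coordE; case: (leqP (i * d.+1 + a) (tau (block i j'))) => // lt.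
    rewrite valZ1 ?vE //; first by lia.
    by rewrite /middle vE //; lia.
  have gt_ a j' l : (l <= d.+1)%N -> (j' < l)%N -> lab i a = l ->
      (tau (block i j') < i * d.+1 + a)%N.
    move=> ld jl aE; have [_ /(_ j' jl) + _] := lattice_labelP aE ld.
    by rewrite coordE; case: ltnP => // _; rewrite addr0 vE; lia.
  (* The label l + 1 requires the coordinate l to have been raised, which has not yet happened at
     the label l; so the labels occur in increasing order. *)
  have pos : forall l a, (l <= d.+1)%N -> (a <= d.+1)%N -> lab i a = l -> (l <= a)%N.
    elim => // l IH a ld ad aE.
    have [b bd bE] := hi l (ltnW ld).
    have := IH b (ltnW ld) bd bE; have := lt_ b l bd ld bE.
    by have := gt_ a l _ ld (leqnn _) aE; lia.
  split; first by apply/val_inj; rewrite /= vE // Zp_cast ?modn_small; lia.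
  have [a ad aE] := hi j (leqW jd).
  have := lt_ a j ad jd aE; have := pos j a (leqW jd) ad aE.
  by rewrite [X in (_ -> _ -> X <= _)%N]blockE //; lia.
have blk (t : 'I_N) : exists i j, [/\ (i <= m)%N, (j <= d)%N & t = block i j].
  exists (t %/ d.+1)%N, (t %% d.+1)%N.
  have im : (t %/ d.+1 <= m)%N by rewrite -ltnS ltn_divLR.
  have jd : (t %% d.+1 <= d)%N by rewrite -ltnS ltn_mod.
  by split => //; apply/val_inj; rewrite /= blockE // -divn_eq.
split.
  apply/rowP => t; have [i [j [im jd ->]]] := blk t.
  by rewrite mxE; have [] := key i j im jd.
have tle (t : 'I_N) : (t <= tau t)%N by have [i [j [im jd ->]]] := blk t; have [] := key i j im jd.
(* A permutation with [t <= tau t] everywhere is the identity, because the differences sum to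
   zero. *)
apply: invg_inj; rewrite -/tau invg1; apply/permP => t; rewrite perm1.
have : (\sum_(t < N) (tau t - t))%N == 0%N.
  by rewrite sumnB // [X in (_ - X)%N](reindex_inj (@perm_inj _ tau)) subnn.
rewrite sum_nat_eq0 => /forallP/(_ t) /=; rewrite subn_eq0 => tt.
by apply/val_inj/eqP; rewrite /= eqn_leq tt tle.
Qed.

(** Only the simplex at [center] with the identity order is full in all blocks at once. This is
    where degree one enters: the product of the label cocycles evaluates to 1 on the torus. *)
Lemma lattice_count :
  \sum_v \sum_(sg : 'S_N) \prod_(i < m.+1)
    fullc d.+1 (fun k => lattice_label i (kuhn unit_step v sg (i * d.+1 + k))) = 1 :> 'F_2.
Proof.
have prodE v (sg : 'S_N) : \prod_(i < m.+1)
    fullc d.+1 (fun k => lattice_label i (kuhn unit_step v sg (i * d.+1 + k)))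
    = ((v == center) && (sg == 1%g))%:R.
  case: (boolP [forall i : 'I_m.+1, full d.+1 (fun k =>
      lattice_label i (kuhn unit_step v sg (i * d.+1 + k)))]).
    move=> /forallP h; have [|-> ->] := @full_lattice_label v sg.
      by move=> i im; exact: (h (Ordinal (im : (i < m.+1)%N))).
    rewrite !eqxx big1 // => i _; rewrite /fullc (_ : full _ _) //.
    apply/fullP => l ld; exists l => //.
    by rewrite lattice_label_center // -ltnS.
  rewrite negb_forall => /existsP[i ni]; rewrite (bigD1 i) //= /fullc (negPf ni) mul0r.
  case: eqP => [ve|//]; case: eqP => [se|//]; case/negP: ni.
  apply/fullP => l ld; exists l => //; rewrite ve se.
  by rewrite lattice_label_center // -ltnS.
under eq_bigr do under eq_bigr do rewrite prodE.
rewrite (bigD1 center) //= (bigD1 1%g) //= !eqxx /= big1 ?addr0 => [|sg /negPf -> //].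
by rewrite big1 ?addr0 // => v /negPf vc; rewrite big1 // vc.
Qed.

End Lattice.

Local Open Scope classical_set_scope.

(** * Convergence in initial, product and matrix topologies *)

Lemma continuous_ptws_coord (I : eqType) (T : topologicalType) (i : I) :
  continuous (fun f : {ptws I -> T} => f i).
Proof. exact: (@proj_continuous I (fun=> T) i). Qed.

(** The filter is arbitrary because the proof that [chart] is an embedding needs a filter generated
    by preimages. *)
Lemma cvg_initial (S : choiceType) (T : topologicalType) (f : S -> T) (U : Type)
    (F : set_system U) (FF : Filter F) (g : U -> initial_topology f) (s : initial_topology f) :
  f \o g @ F --> f s -> g @ F --> s.
Proof.
move=> h A; rewrite nbhsE => -[B [[C oC <-] Cs] BA].
have : F ((f \o g) @^-1` C) by apply: h; apply: open_nbhs_nbhs.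
by rewrite /nbhs /=; apply: (@filterS _ F FF) => u /= Cu; apply: BA.
Qed.

Lemma cvg_ptws (I : eqType) (T : topologicalType) (U : Type) (F : set_system U)
    (FF : Filter F) (g : U -> {ptws I -> T}) (f : {ptws I -> T}) :
  (forall i, g u i @[u --> F] --> f i) -> g @ F --> f.
Proof.
move=> h; apply/cvg_sup => i.
exact: (@cvg_initial (forall _ : I, T) T (fun x => x i) U F FF g f (h i)).
Qed.

Lemma continuous_to_initial (S : choiceType) (T : topologicalType) (f : S -> T)
    (U : topologicalType) (g : U -> initial_topology f) :
  continuous (f \o g) -> continuous g.
Proof. by move=> h u; apply: (@cvg_initial S T f U (nbhs u) (nbhs_filter u)); exact: h. Qed.

Lemma continuous_to_ptws (I : eqType) (T U : topologicalType) (g : U -> {ptws I -> T}) :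
  (forall i, continuous (fun u => g u i)) -> continuous g.
Proof. by move=> h u; apply: (@cvg_ptws I T U (nbhs u) (nbhs_filter u)) => i; exact: h. Qed.

Lemma cvg_mx (T : topologicalType) p q (U : Type) (F : set_system U) (FF : Filter F)
    (f : U -> 'M[T]_(p, q)) (a : 'M[T]_(p, q)) :
  (forall i j, f u i j @[u --> F] --> a i j) -> f @ F --> a.
Proof.
move=> h A [B nB BA]; rewrite /= in nB BA.
have : F [set u | forall ij : 'I_p * 'I_q, B ij.1 ij.2 (f u ij.1 ij.2)].
  apply: (@filter_forall _ _ (fun ij => [set u | B ij.1 ij.2 (f u ij.1 ij.2)]) F) => ij.
  exact: h (nB ij.1 ij.2).
by rewrite /nbhs /=; apply: (@filterS _ F FF) => u /= Bu; apply: BA => i j; exact: (Bu (i, j)).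
Qed.

Lemma continuous_to_mx (T U : topologicalType) p q (g : U -> 'M[T]_(p, q)) :
  (forall i j, continuous (fun u => g u i j)) -> continuous g.
Proof. by move=> h u; apply: (@cvg_mx T p q U (nbhs u) (nbhs_filter u)) => i j; exact: h. Qed.

Lemma cvg_sum_ord (R : realType) (T : Type) (F : set_system T) {FF : Filter F} (I : finType)
    (f : I -> T -> R) (a : I -> R) :
  (forall i, f i x @[x --> F] --> a i) ->
  \sum_i f i x @[x --> F] --> \sum_i a i.
Proof. by move=> h; apply: cvg_big => // x; exact: add_continuous. Qed.

(** * Spheres and the nonexistence of simultaneous nullhomotopies *)

Section Labels.
Variable R : realType.

Lemma rv_norm_le D (x : 'rV[R]_D) (r : R) :
  0 <= r -> (forall j, `|x 0 j| <= r) -> `|x| <= r.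
Proof.
move=> r0 h; rewrite [`|x|]mx_normrE; apply/bigmax_leP; split=> // -[i j] _ /=.
by rewrite ord1.
Qed.

Lemma rv_coord_le D (x : 'rV[R]_D) j : `|x 0 j| <= `|x|.
Proof.
by rewrite [`|x|]mx_normrE; apply: (le_bigmax _ (fun ij => `|x ij.1 ij.2|) (0, j)).
Qed.

Definition usphere D (u : 'rV[R]_D) : Prop := \sum_j u 0 j ^+ 2 = 1.

Definition upole D : 'rV[R]_D := \row_j (j == 0 :> nat)%:R.

Variable d : nat.

(** The labels are the vertices of a simplex with d + 3 vertices, whose boundary models the sphere:
    [d.+2] on the hemisphere of the pole, and elsewhere the first negative coordinate among the
    others. If there is none, [find] returns the length [d.+1], which is the remaining label. *)
Definition sign_label (u : 'rV[R]_d.+2) : nat :=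
  if 0 <= u 0 0 then d.+2 else find (fun j => u 0 (inord j.+1) < 0) (iota 0 d.+1).

Lemma sign_label_le u : (sign_label u <= d.+2)%N.
Proof.
by rewrite /sign_label; case: ifP => // _; rewrite ltnW // ltnS -[leqRHS](size_iota 0) find_size.
Qed.

Lemma inord_lift (j : 'I_d.+1) : inord j.+1 = lift 0 j :> 'I_d.+2.
Proof. by apply/val_inj; rewrite /= inordK // ltnS. Qed.

Lemma sign_labelP u :
  [/\ sign_label u = d.+2 -> 0 <= u 0 0,
      (sign_label u <= d.+1)%N -> u 0 0 < 0,
      sign_label u = d.+1 -> forall j : 'I_d.+1, 0 <= u 0 (lift 0 j) &
      forall j : 'I_d.+1, sign_label u = j -> u 0 (lift 0 j) < 0].
Proof.
pose p j := u 0 (inord j.+1) < 0.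
have fd : (find p (iota 0 d.+1) <= d.+1)%N by rewrite -[leqRHS](size_iota 0) find_size.
rewrite /sign_label -/p; case: (leP 0 (u 0 0)) => u0.
  split=> //; first by rewrite ltnn.
    by move=> e; move: (ltnn d.+1); rewrite -{2}e ltnSn.
  by move=> j jE; have := ltn_ord j; rewrite -jE; lia.
split=> // [fE|fE j|j fE]; first by move: fd; rewrite fE ltnn.
  have := has_find p (iota 0 d.+1); rewrite fE size_iota ltnn => /negbT/hasPn/(_ j).
  by rewrite mem_iota leq0n add0n ltn_ord /p inord_lift -leNgt => ->.
have hj : has p (iota 0 d.+1) by rewrite has_find fE size_iota.
by have := nth_find 0%N hj; rewrite fE nth_iota // add0n /p inord_lift.
Qed.

(** The vertex labelled [d.+1] is negative in the coordinate 0 only, and each other label supplies a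
    vertex on the other side in one coordinate. So all coordinates of that vertex are at most [eps]
    in absolute value, too small for a unit vector. *)
Lemma sign_label_small (a : nat -> 'rV[R]_d.+2) (eps : R) :
  eps ^+ 2 *+ d.+2 < 1 -> (forall k, usphere (a k)) ->
  (forall k k', (k <= d.+2)%N -> (k' <= d.+2)%N -> `|a k - a k'| <= eps) ->
  ~~ full d.+2 (sign_label \o a).
Proof.
move=> eps1 sa da; apply/negP => /fullP h.
have [k kd kE] := h d.+2 (leqnn _).
have [c cd cE] := h d.+1 (leqnSn _).
have kpos : 0 <= a k 0 0 by have [+ _ _ _] := sign_labelP (a k); apply.
have cneg : a c 0 0 < 0.
  by have [_ + _ _] := sign_labelP (a c); apply; rewrite -[sign_label _]/((sign_label \o a) c) cE.
have cpos (j : 'I_d.+1) : 0 <= a c 0 (lift 0 j).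
  by have [_ _ + _] := sign_labelP (a c); apply.
have coordle l j : (l <= d.+2)%N -> `|a c 0 j - a l 0 j| <= eps.
  move=> ld; have := rv_coord_le (a c - a l) j; rewrite !mxE => /le_trans; apply.
  exact: da.
have bound j : `|a c 0 j| <= eps.
  case: (unliftP 0 j) => [j' ->|->].
    have jd : (j' <= d.+2)%N by rewrite ltnW // ltnW // ltnS ltn_ord.
    have [l ld lE] := h j' jd; have lneg : a l 0 (lift 0 j') < 0.
      by have [_ _ _] := sign_labelP (a l); apply.
    have := coordle l (lift 0 j') ld; have := cpos j'.
    rewrite !ler_norml => c0 /andP[_ le]; apply/andP; split; lra.
  have := coordle k 0 kd; rewrite !ler_norml => /andP[le _]; apply/andP; split; lra.
have := sa c; rewrite /usphere => s1.
have : \sum_j a c 0 j ^+ 2 <= \sum_(j < d.+2) eps ^+ 2.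
  apply: ler_sum => j _; rewrite -real_normK ?num_real //.
  by rewrite lerXn2r ?nnegrE // (le_trans _ (bound j)).
by rewrite s1 sumr_const card_ord => /le_lt_trans/(_ eps1); rewrite ltxx.
Qed.

Lemma sign_label_coboundary (a : nat -> 'rV[R]_d.+2) (eps : R) :
  eps ^+ 2 *+ d.+2 < 1 -> (forall k, usphere (a k)) ->
  (forall k k', `|a k - a k'| <= eps) ->
  coboundary d.+1 (fullc d.+1) (sign_label \o a) = 0.
Proof.
move=> eps1 sa da; apply: fullc_coboundary => [k _|]; first exact: sign_label_le.
exact: sign_label_small eps1 sa _.
Qed.

End Labels.

(** * Euclidean norm and normalization *)

Section Normalization.
Variables (R : realType) (D : nat).
Implicit Types w : 'rV[R]_D.

Definition enorm w : R := Num.sqrt (\sum_j w 0 j ^+ 2).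
Definition normalize w : 'rV[R]_D := (enorm w)^-1 *: w.

Lemma sqsum_ge0 w : 0 <= \sum_j w 0 j ^+ 2.
Proof. by apply: sumr_ge0 => j _; exact: sqr_ge0. Qed.

Lemma enorm_ge0 w : 0 <= enorm w.
Proof. exact: sqrtr_ge0. Qed.

Lemma enorm_sqr w : enorm w ^+ 2 = \sum_j w 0 j ^+ 2.
Proof. by rewrite sqr_sqrtr // sqsum_ge0. Qed.

Lemma coord_le_enorm w j : `|w 0 j| <= enorm w.
Proof.
rewrite -sqrtr_sqr ler_sqrt ?sqsum_ge0 // (bigD1 j) //= lerDl.
by apply: sumr_ge0 => i _; exact: sqr_ge0.
Qed.

Lemma enorm_gt0 w : (0 < enorm w) = (w != 0).
Proof.
rewrite lt_neqAle enorm_ge0 andbT eq_sym; congr negb; apply/eqP/eqP => [w0|->].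
  apply/rowP => j; rewrite mxE; apply/eqP; rewrite -normr_le0.
  by rewrite -w0 coord_le_enorm.
by rewrite /enorm big1 ?sqrtr0 // => j _; rewrite mxE expr0n.
Qed.

Lemma normalize_sphere w : w != 0 -> usphere (normalize w).
Proof.
rewrite -enorm_gt0 => n0; rewrite /usphere.
under eq_bigr do rewrite mxE exprMn.
by rewrite -mulr_sumr -enorm_sqr exprVn mulVf // expf_neq0 // gt_eqF.
Qed.

Lemma usphere_enorm w : usphere w -> enorm w = 1.
Proof. by rewrite /enorm => ->; rewrite sqrtr1. Qed.

Lemma usphere_neq0 w : usphere w -> w != 0.
Proof. by rewrite -enorm_gt0 => /usphere_enorm ->. Qed.

Lemma normalize_id w : usphere w -> normalize w = w.
Proof. by move=> /usphere_enorm; rewrite /normalize => ->; rewrite invr1 scale1r. Qed.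

(** Multiply by the sum of the two norms: a difference of squares appears, and each coordinate of w
    + w' is bounded by that sum. *)
Lemma enorm_lip w w' eta : (forall j, `|w 0 j - w' 0 j| <= eta) ->
  `|enorm w - enorm w'| <= eta *+ D.
Proof.
move=> h; have [n0|] := eqVneq (enorm w + enorm w') 0.
  have /andP[/eqP -> /eqP ->] : (enorm w == 0) && (enorm w' == 0).
    by rewrite -paddr_eq0 ?enorm_ge0 // n0.
  rewrite subrr normr0; case: D w w' h {n0} => [|D'] w w' h; first by rewrite mulr0n.
  by rewrite mulrn_wge0 // (le_trans _ (h ord0)).
move=> n0; have np : 0 < enorm w + enorm w' by rewrite lt_neqAle eq_sym n0 addr_ge0 ?enorm_ge0.
rewrite -(ler_pM2r np) -[X in _ * X <= _](ger0_norm (ltW np)) -normrM -subr_sqr !enorm_sqr.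
rewrite -sumrB. rewrite (le_trans (ler_norm_sum _ _ _)) // -[X in eta *+ X]card_ord -sumr_const
    mulr_suml.
apply: ler_sum => j _; rewrite subr_sqr normrM ler_pM ?normr_ge0 //.
by rewrite (le_trans (ler_normD _ _)) // lerD // coord_le_enorm.
Qed.

(** In the factor [D.+1], one unit accounts for the vectors and [D] for their norms. *)
Lemma normalize_lip w w' eta c : 0 < c -> c <= enorm w -> c <= enorm w' -> 0 <= eta ->
  (forall j, `|w 0 j - w' 0 j| <= eta) ->
  `|normalize w - normalize w'| <= c^-1 * (eta *+ D.+1).
Proof.
move=> c0 cw cw' e0 h.
have [n0 n0'] := (lt_le_trans c0 cw, lt_le_trans c0 cw').
apply: rv_norm_le => [|j]; first by rewrite mulr_ge0 ?mulrn_wge0 // invr_ge0 ltW.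
rewrite !mxE.
have -> : (enorm w)^-1 * w 0 j - (enorm w')^-1 * w' 0 j =
  (enorm w)^-1 * ((w 0 j - w' 0 j) + (enorm w')^-1 * w' 0 j * (enorm w' - enorm w)).
  by field; rewrite !gt_eqF.
rewrite normrM ler_pM ?normr_ge0 //.
  by rewrite ger0_norm ?invr_ge0 ?(ltW n0) // lef_pV2 ?posrE.
rewrite (le_trans (ler_normD _ _)) // mulrSr addrC lerD //.
rewrite normrM distrC -[leRHS]mul1r ler_pM ?normr_ge0 ?enorm_lip //.
rewrite normrM normfV (ger0_norm (enorm_ge0 _)) mulrC ler_pdivrMr // mul1r.
exact: coord_le_enorm.
Qed.

End Normalization.

(** * A degree-one map from the discrete torus to the sphere *)

Section Grid.
Variables (R : realType) (M d : nat).
Hypothesis M2 : (2 < M)%N.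
Notation Z := 'Z_(M.*2).
Implicit Type v : 'I_d.+1 -> Z.

Definition gridx (c : Z) : R := (c : nat)%:R / M%:R - 1.
Definition gridy v : 'rV[R]_d.+1 := \row_j `|gridx (v j)|.
Definition gridt v : R := `|gridy v|.
(* A degree-one map from the torus to the sphere: it sends the origin of the
   cube to minus the pole and collapses the boundary of the cube to the pole. *)
Definition gridw v : 'rV[R]_d.+2 :=
  \row_j (if unlift 0 j is Some j' then (1 - gridt v) * gridx (v j')
          else 2 * gridt v - 1).
Definition gridu v := normalize (gridw v).

Let M0 : 0 < M%:R :> R.
Proof. by rewrite ltr0n; lia. Qed.

Lemma gridw0 v : gridw v 0 0 = 2 * gridt v - 1.
Proof. by rewrite mxE unlift_none. Qed.

Lemma gridwS v j : gridw v 0 (lift 0 j) = (1 - gridt v) * gridx (v j).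
Proof. by rewrite mxE liftK. Qed.

Lemma gridx_le1 c : `|gridx c| <= 1.
Proof.
rewrite ler_norml /gridx; apply/andP; split.
  by rewrite lerDr // divr_ge0 // ltW.
rewrite lerBlDr ler_pdivrMr // -[1 + 1](natrD _ 1 1) -natrM ler_nat.
by have := ltn_ord c; rewrite [X in (_ < X)%N]Zp_cast; lia.
Qed.

Lemma gridt_ge0 v : 0 <= gridt v. Proof. exact: normr_ge0. Qed.

Lemma gridt_le1 v : gridt v <= 1.
Proof. by apply: rv_norm_le => // j; rewrite mxE normr_id gridx_le1. Qed.

Lemma gridx_le_gridt v j : `|gridx (v j)| <= gridt v.
Proof. by have := rv_coord_le (gridy v) j; rewrite mxE normr_id. Qed.

Lemma gridt_attained v : exists j, `|gridx (v j)| = gridt v.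
Proof.
have [t0|t0] := eqVneq (gridt v) 0.
  exists ord0; apply/eqP; rewrite eq_le gridx_le_gridt t0 normr_ge0 //.
have [[i j] tE] := mx_norm_neq0 t0.
by exists j; rewrite /gridt [RHS]tE /= mxE normr_id.
Qed.

(** For the coordinate that attains t = [gridt v], the entries 2 t - 1 and t (1 - t) cannot both be
    smaller than 1/8 in absolute value. *)
Lemma gridw_enorm v : 8^-1 <= enorm (gridw v).
Proof.
have [j jE] := gridt_attained v.
have := coord_le_enorm (gridw v) 0; have := coord_le_enorm (gridw v) (lift 0 j).
rewrite gridw0 gridwS normrM jE ger0_norm ?subr_ge0 ?gridt_le1 //.
set t := gridt v; set n := enorm _ => h1; rewrite ler_norml => /andP[h2 h3].
by rewrite leNgt; apply/negP => n8; nra.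
Qed.

Lemma gridw_neq0 v : gridw v != 0.
Proof. by rewrite -enorm_gt0 (lt_le_trans _ (gridw_enorm v)) // invr_gt0. Qed.

Lemma gridu_sphere v : usphere (gridu v).
Proof. exact/normalize_sphere/gridw_neq0. Qed.

Definition gnear c c' := (c' == c) || (c' == c + 1 :> Z).

(** The second case is the step from the last residue to 0, where the circle is cut open. *)
Lemma gridx_near c c' : gnear c c' ->
  `|gridx c - gridx c'| <= M%:R^-1 \/ gridx c = 1 - M%:R^-1 /\ gridx c' = -1.
Proof.
case/orP => /eqP ->; first by left; rewrite subrr normr0 invr_ge0 ltW.
have cM := ltn_ord c; rewrite [X in (_ < X)%N]Zp_cast in cM; last by lia.
have E : (c + 1 : Z) = (c.+1 %% M.*2)%N :> nat.
  have Zc : (Zp_trunc M.*2).+2 = M.*2 by rewrite Zp_cast //; lia.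
  by rewrite -[LHS]/((c + 1 %% (Zp_trunc M.*2).+2) %% (Zp_trunc M.*2).+2)%N;
      move: (nat_of_ord c) => a; rewrite Zc modnDmr addn1.
rewrite /gridx E; have [cl|cl] := ltnP c.+1 M.*2.
  left; rewrite modn_small // -natr1 mulrDl mul1r.
  by rewrite (_ : _ - 1 - _ = - M%:R^-1) ?normrN ?ger0_norm ?invr_ge0 ?(ltW M0) //; ring.
have -> : c.+1 = M.*2 by lia.
right; rewrite modnn mul0r sub0r; split => //.
have -> : (c : nat) = (M + M - 1)%N by lia.
rewrite natrB ?natrD; last by lia.
by field; rewrite gt_eqF.
Qed.

(** The cut is harmless here, since [gridx] enters only through its absolute value. *)
Lemma gridt_near v v' : (forall j, gnear (v j) (v' j)) ->
  `|gridt v - gridt v'| <= M%:R^-1.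
Proof.
move=> h; rewrite (le_trans (ler_dist_dist _ _)) //.
apply: rv_norm_le => [|j]; first by rewrite invr_ge0 ltW.
rewrite !mxE; have [|[-> ->]] := gridx_near (h j).
  by apply: le_trans; exact: ler_dist_dist.
have M1 : M%:R^-1 <= 1 :> R by rewrite invf_le1 // ler1n; lia.
by rewrite normrN1 (ger0_norm (_ : 0 <= 1 - M%:R^-1)) ?subr_ge0 // (_ : 1 - _ - 1 = - M%:R^-1)
    ?normrN ?ger0_norm ?invr_ge0 ?(ltW M0) //; ring.
Qed.

(** [gridx] jumps at the cut, but there its factor [1 - gridt] is at most 1 / M on one side and zero
    on the other. *)
Lemma gridw_near v v' j : (forall j, gnear (v j) (v' j)) ->
  `|gridw v 0 j - gridw v' 0 j| <= 2 / M%:R.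
Proof.
move=> h; have ht := gridt_near h.
case: (unliftP 0 j) => [i ->|->]; last first.
  rewrite !gridw0 (_ : _ - _ = 2 * (gridt v - gridt v')); last by ring.
  by rewrite normrM ger0_norm // ler_pM2l.
rewrite !gridwS.
have := gridt_le1 v; have := gridt_ge0 v; have := gridt_le1 v'; have := gridt_ge0 v'.
have := gridx_le1 (v i); have := gridx_le1 (v' i).
have := gridx_le_gridt v i; have := gridx_le_gridt v' i.
have Mi : 0 < M%:R^-1 :> R by rewrite invr_gt0.
have M1 : M%:R^-1 <= 1 :> R by rewrite invf_le1 // ler1n; lia.
have [hx|[-> ->]] := gridx_near (h i).
  move=> _ _ x1' x1 t0' t1' t0 t1.
  rewrite (_ : _ - _ = (1 - gridt v) * (gridx (v i) - gridx (v' i)) +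
    (gridt v' - gridt v) * gridx (v' i)); last by ring.
  rewrite (le_trans (ler_normD _ _)) // mulr_natl mulr2n lerD // normrM.
    rewrite -[leRHS]mul1r ler_pM ?normr_ge0 // ger0_norm ?subr_ge0 //.
    by rewrite gerBl.
  by rewrite -[leRHS]mulr1 ler_pM ?normr_ge0 // distrC.
rewrite normrN1 (ger0_norm (_ : 0 <= 1 - M%:R^-1)) ?subr_ge0 // => t1 tM _ _ t0' t1' t0 t1''.
have -> : gridt v' = 1 by apply/eqP; rewrite eq_le t1' t1.
set x := M%:R^-1 in tM Mi M1 *; rewrite subrr mul0r subr0.
rewrite ger0_norm; [nra|by rewrite mulr_ge0 // subr_ge0].
Qed.

Lemma gridu_near v v' : (forall j, gnear (v j) (v' j)) ->
  `|gridu v - gridu v'| <= 8 * ((2 / M%:R) *+ d.+3).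
Proof.
move=> h; rewrite -[X in X * _]invrK; apply: normalize_lip; rewrite ?gridw_enorm ?invr_gt0 //.
by move=> j; apply: gridw_near.
Qed.

Lemma middleP c : middle (M:=M) c = (`|gridx c| < 2^-1).
Proof.
rewrite /middle /gridx; set x := (c : nat).
have -> : (M < x.*2)%N = (M%:R < 2 * x%:R :> R) by rewrite -natrM ltr_nat mul2n.
have -> : (x.*2 < 3 * M)%N = (2 * x%:R < 3 * M%:R :> R) by rewrite -!natrM ltr_nat mul2n.
rewrite ltr_norml ltrBrDr ltrBlDr ltr_pdivlMr // ltr_pdivrMr //.
congr (_ && _); apply/idP/idP => h; lra.
Qed.

(** This ties the lattice labels to the geometric map: all coordinates are in the middle exactly
    when [gridt v] is below 1/2, that is, when the entry 0 of [gridw v] is negative; the other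
    entries then have the signs of the [gridx]. *)
Lemma sign_label_gridu v : sign_label (gridu v) =
  if [forall j, middle (v j)]
  then find (fun j => (v (inord j) < M)%N) (iota 0 d.+1) else d.+2.
Proof.
have n0 : 0 < (enorm (gridw v))^-1 by rewrite invr_gt0 enorm_gt0 gridw_neq0.
have midE : [forall j, middle (v j)] = (gridt v < 2^-1).
  apply/forallP/idP => [h|t2 j].
    by have [j <-] := gridt_attained v; rewrite -middleP.
  by rewrite middleP (le_lt_trans (gridx_le_gridt v j)).
rewrite midE /sign_label.
have -> : (0 <= gridu v 0 0) = ~~ (gridt v < 2^-1).
  rewrite mxE pmulr_rge0 // gridw0 -leNgt subr_ge0; apply/idP/idP => ?; lra.
case: ltP => //= t2; apply: (@eq_in_find _ _ _ (iota 0 d.+1)) => j.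
rewrite mem_iota /= add0n => jd.
have -> : inord j.+1 = lift 0 (inord j) :> 'I_d.+2.
  by apply/val_inj; rewrite /= !inordK.
rewrite mxE pmulr_rlt0 // gridwS pmulr_rlt0; last by rewrite subr_gt0; lra.
by rewrite /gridx subr_lt0 ltr_pdivrMr // mul1r ltr_nat.
Qed.

End Grid.

(** * Finite covers of a product of spheres *)

Section Torus.
Variables (R : realType).

Lemma usphere_compact D : compact [set u : 'rV[R]_D | usphere u].
Proof.
apply: bounded_closed_compact.
  exists 1; split => // r r1 u /= us; apply: le_trans (ltW r1).
  by apply: rv_norm_le => // j; rewrite -(usphere_enorm us) coord_le_enorm.
have -> : [set u : 'rV[R]_D | usphere u] = (fun u => \sum_j u 0 j ^+ 2) @^-1` [set 1] by [].
apply: closed_comp; last exact: closed_eq.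
move=> u _; apply: (@cvg_sum_ord R _ (nbhs u) _) => j; apply: cvgM; exact: coord_continuous.
Qed.

Variables (m D : nat).
Notation P := (prod_topology (fun _ : 'I_m => 'rV[R]_D)).

Definition torus (y : 'I_m -> 'rV[R]_D) := forall i, usphere (y i).

Lemma torus_finite_cover (r : P -> R) : (forall y, torus y -> 0 < r y) ->
  exists s : seq P, forall y, torus y ->
    exists c, [/\ c \in s, torus c & forall i, `|y i - c i| < r c].
Proof.
move=> r0.
have : @compact P [set y | torus y].
  have := @tychonoff 'I_m (fun=> 'rV[R]_D) (fun=> [set u : 'rV[R]_D | usphere u]).
  by apply=> _; exact: usphere_compact.
(* The filter of all sufficiently large finite lists: compactness in terms of near coverings then
   yields a single list of centres for all points. *)
pose F : set_system (seq P) :=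
  filter_from setT (fun s0 : seq P => [set s : seq P | {subset s0 <= s}]).
have FF : Filter F.
  apply: filter_from_filter; first by exists [::].
  move=> s1 s2 _ _; exists (s1 ++ s2) => // s ss.
  by split=> c cs; apply: ss; rewrite mem_cat cs ?orbT.
move/compact_near_coveringP => /(_ _ F (fun s y => exists c, [/\ c \in s, torus c &
  forall i, `|y i - c i| < r c]) FF); case.
  move=> y ty; exists ([set z : P | forall i, `|z i - y i| < r y], [set s : seq P | y \in s]).
    split=> /=; last by exists [:: y] => // s; apply; rewrite inE.
    apply: (@filter_forall P 'I_m (fun i => [set z : P | `|z i - y i| < r y]) (nbhs (y : P))) => i.
    have := @continuous_ptws_coord 'I_m 'rV[R]_D i y.
    by move/cvgr_distC_lt => /(_ (r y) (r0 y ty)).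
  by move=> [z s] /= [zy ys]; exists y.
move=> s0 _ /(_ s0 (fun _ => id)) h; exists s0 => y ty.
exact: h.
Qed.

End Torus.

Lemma bounded_below_seq (R : realType) (T : eqType) (s : seq T) (f : T -> R) :
  (forall c, 0 < f c) -> exists2 e, 0 < e & forall c, c \in s -> e <= f c.
Proof.
move=> f0; elim: s => [|c s [e e0 he]]; first by exists 1.
exists (Num.min e (f c)); first by rewrite lt_min e0 f0.
move=> c'; rewrite inE => /orP[/eqP ->|/he h]; first by rewrite ge_min lexx orbT.
by rewrite ge_min h.
Qed.

(** The [n] prisms between consecutive times are stacked. The bounds keep each of them so small that
    its labels are closed, and the intermediate ends telescope. *)
Lemma fullc_homotopy (R : realType) (d : nat) (V : Type) (eps : R) (n : nat)
    (G : nat -> V -> 'rV[R]_d.+2) (s : nat -> V) :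
  eps ^+ 2 *+ d.+2 < 1 ->
  (forall q k, usphere (G q (s k))) ->
  (forall q k k', (q < n)%N -> [/\ `|G q (s k) - G q (s k')| <= eps,
    `|G q (s k) - G q.+1 (s k')| <= eps & `|G q.+1 (s k) - G q.+1 (s k')| <= eps]) ->
  \sum_(i < d.+2) \sum_(q < n) \sum_(j < d.+1)
     fullc d.+1 (prism j (@sign_label R d \o G q \o face i s) (@sign_label R d \o G q.+1 \o face
         i s))
  = fullc d.+1 (@sign_label R d \o G 0%N \o s) + fullc d.+1 (@sign_label R d \o G n \o s).
Proof.
move=> eps1 sG dG.
rewrite exchange_big /=.
have step q : (q < n)%N -> \sum_(i < d.+2) \sum_(j < d.+1)
     fullc d.+1 (prism j (@sign_label R d \o G q \o face i s) (@sign_label R d \o G q.+1 \o face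
         i s))
  = fullc d.+1 (@sign_label R d \o G q \o s) + fullc d.+1 (@sign_label R d \o G q.+1 \o s).
  move=> qn; apply: (@prism_boundary _ d.+1 (@fullc d.+1)
    (@sign_label R d \o G q \o s) (@sign_label R d \o G q.+1 \o s) (@fullc_depends d.+1)).
  move=> j _.
  have -> : prism j (@sign_label R d \o G q \o s) (@sign_label R d \o G q.+1 \o s)
     = @sign_label R d \o prism j (G q \o s) (G q.+1 \o s).
    by apply: boolp.funext => k; rewrite /prism /=; case: ifP.
  apply: (sign_label_coboundary eps1) => [k|k k']; rewrite /prism /=.
    by case: ifP.
  by case: ifP => _; case: ifP => _; have [h1 h2 h3] := dG q k k' qn => //;
     have [? ? ?] := dG q k'.-1 k qn; have [? ? ?] := dG q k.-1 k'.-1 qn;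
     have [? ? ?] := dG q k' k.-1 qn; have [? ? ?] := dG q k k'.-1 qn => //; rewrite distrC.
transitivity (\sum_(q < n) (fullc d.+1 (@sign_label R d \o G q \o s) + fullc d.+1 (@sign_label R
    d \o G q.+1 \o s))).
  by apply: eq_bigr => q _; apply: step.
elim: n {dG step} => [|n IH]; first by rewrite big_ord0 addF2.
by rewrite big_ord_recr /= IH -addrA [X in _ + X]addrA addF2 add0r.
Qed.

Lemma usphere_pole (R : realType) D : usphere (upole R D.+1).
Proof.
rewrite /usphere (bigD1 ord0) //= big1 => [|j j0]; rewrite mxE ?eqxx ?expr1n ?addr0 //.
by rewrite (_ : (j == 0 :> nat) = false) ?expr0n //; apply: negbTE j0.
Qed.

(** * The factors of a product of spheres cannot all be contracted over a cover *)

Section NoNullhomotopies.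
Variables (R : realType) (m d : nat).
Notation P := (prod_topology (fun _ : 'I_m.+1 => 'rV[R]_d.+2)).
Variables (F : 'I_m.+1 -> P -> Prop) (h : 'I_m.+1 -> P -> R -> 'rV[R]_d.+2).
Hypothesis covF : forall y, torus y -> exists i, F i y.
Hypothesis hS : forall i y t, torus y -> F i y -> 0 <= t <= 1 -> usphere (h i y t).
Hypothesis h0 : forall i y, torus y -> F i y -> h i y 0 = y i.
Hypothesis h1 : forall i y, torus y -> F i y -> h i y 1 = upole R d.+2.
Hypothesis hF : forall i y e, torus y -> F i y -> 0 < e -> exists2 r, 0 < r &
  forall y', torus y' -> F i y' -> (forall l, `|y' l - y l| < r) ->
    forall t, 0 <= t <= 1 -> `|h i y' t - h i y t| < e.
Hypothesis ht : forall i y e, torus y -> F i y -> 0 < e -> exists2 r, 0 < r &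
  forall t t', 0 <= t <= 1 -> 0 <= t' <= 1 -> `|t - t'| <= r -> `|h i y t - h i y t'| < e.

Let eps : R := d.+2%:R^-1.

Let eps0 : 0 < eps. Proof. by rewrite invr_gt0 ltr0n. Qed.

Let eps1 : eps ^+ 2 *+ d.+2 < 1.
Proof.
rewrite expr2 -mulr_natr -mulrA mulVf ?pnatr_eq0 // mulr1.
by rewrite invf_lt1 ?ltr0n // ltr1n.
Qed.

(** An index, a space radius and a time step at each point. Accuracy [eps / 4] leaves room for
    adding a few errors; off the torus the values are dummies. *)
Let data (y : P) : exists p : 'I_m.+1 * R * R, [/\ 0 < p.1.2, p.1.2 <= eps / 4, 0 < p.2 &
  torus y -> [/\ F p.1.1 y,
    forall y', torus y' -> F p.1.1 y' -> (forall l, `|y' l - y l| < p.1.2) ->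
      forall t, 0 <= t <= 1 -> `|h p.1.1 y' t - h p.1.1 y t| < eps / 4 &
    forall t t', 0 <= t <= 1 -> 0 <= t' <= 1 -> `|t - t'| <= p.2 ->
      `|h p.1.1 y t - h p.1.1 y t'| < eps / 4]].
Proof.
have e4 : 0 < eps / 4 by rewrite divr_gt0.
have [ty|nty] := pselect (torus y); last by exists (ord0, eps / 4, 1); split.
have [i Fi] := covF ty.
have [r r0 hr] := hF ty Fi e4; have [q q0 hq] := ht ty Fi e4.
exists (i, Num.min r (eps / 4), q); split => //=.
- by rewrite lt_min r0.
- by rewrite ge_min lexx orbT.
move=> _; split => // y' ty' Fy' yy'; apply: hr => // l.
by have := yy' l; rewrite lt_min => /andP[].
Qed.

(** By [lattice_count] the label cocycles of the factors have product 1, but on each lattice simplex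
    one of them is the coboundary of a prism cochain built from a contraction, so the product is
    also 0. As the sets [F i] are arbitrary, a contraction is evaluated only at finitely many
    centres that lie in [F i]. *)
Lemma no_nullhomotopies : False.
Proof.
have [D dataD] := boolp.choice data.
pose idx y := (D y).1.1; pose rad y := (D y).1.2; pose tm y := (D y).2.
have rad0 y : 0 < rad y by have [] := dataD y.
have tm0 y : 0 < tm y by have [] := dataD y.
have rad_le y : rad y <= eps / 4 by have [] := dataD y.
have [s cov] := @torus_finite_cover R m.+1 d.+2 (fun c => rad c / 6) (fun y _ =>
    divr_gt0 (rad0 y) (ltr0Sn _ 5)).
have [th th0 th_le] := bounded_below_seq s rad0.
have [tau tau0 tau_le] := bounded_below_seq s tm0.
pose T := (Num.bound tau^-1).
have Tgt : tau^-1 < T%:R by apply: archi_boundP; rewrite invr_ge0 ltW.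
have T0 : 0 < T%:R :> R by apply: lt_trans Tgt; rewrite invr_gt0.
pose e' := Num.min (th / 6) (eps / 4).
have e'0 : 0 < e' by rewrite lt_min !divr_gt0.
(* For M > K the bound of [gridu_near] is at most e' / 2. *)
pose K : R := 2 * (8 * (2 *+ d.+3)) / e'.
have K0 : 0 <= K by rewrite divr_ge0 ?(ltW e'0).
have [M M2 MK] : exists2 M, (2 < M)%N & K < M%:R.
  exists (Num.bound K).+3 => //; apply: lt_trans (archi_boundP K0) _.
  by rewrite ltr_nat !ltnS leqW.
have M0 : 0 < M%:R :> R by rewrite ltr0n; apply: leq_trans M2.
pose V := 'rV['Z_(M.*2)]_(m.+1 * d.+1).
pose e := @unit_step M m d.
have [Phi [PhiS PhiL mesh0]] : exists Phi : nat -> V -> 'rV[R]_d.+2,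
    [/\ forall i v, usphere (Phi i v),
        forall i v, sign_label (Phi i v) = lattice_label i v &
        forall v sg k i, `|Phi i v - Phi i (kuhn e v sg k)| <= e' / 2].
  exists (fun i v => gridu R (fun j : 'I_d.+1 => v ord0 (block m d i j))); split.
  - by move=> i v; exact: gridu_sphere.
  - move=> i v; rewrite sign_label_gridu // /lattice_label; case: ifP => // _.
    by apply: eq_in_find => j; rewrite mem_iota /= add0n => jd; rewrite inordK.
  move=> v sg k i; have := @gridu_near R M d M2 (fun j : 'I_d.+1 => v ord0 (block m d i j))
    (fun j : 'I_d.+1 => kuhn e v sg k ord0 (block m d i j)).
  move=> /(_ _)/le_trans; apply.
    by move=> j; rewrite /gnear kuhn_coord; case: (_ < _)%N; rewrite ?addr0 eqxx ?orbT.
  have -> : 8 * (2 / M%:R *+ d.+3) = 8 * (2 *+ d.+3) / M%:R :> R by rewrite -mulrnAl mulrA.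
  move: MK; rewrite /K ltr_pdivrMr // => MK.
  by rewrite ler_pdivrMr //; lra.
pose PhiP (v : V) : P := fun i => Phi i v.
have mesh u i k k' : in_kuhn e u -> `|Phi i (u k) - Phi i (u k')| <= e'.
  move=> [v [sg hu]]; have [j ->] := hu k; have [j' ->] := hu k'.
  apply: le_trans (ler_distD (Phi i v) _ _) _; rewrite [e'](splitr).
  by apply: lerD; [rewrite distrC|]; exact: mesh0.
(* The radius exceeds the covering radius [rad c / 6] by enough for a whole lattice simplex to
   remain near the same centre. *)
pose near_centre i v c := [/\ c \in s, torus c, idx c = inord i &
  forall l, `|PhiP v l - c l| < rad c / 3].
pose U i v := exists c, near_centre i v c.
have [ctr ctrP] : exists ctr : nat -> V -> P, forall i v, U i v -> near_centre i v (ctr i v).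
  have /boolp.choice[f fP] : forall iv : nat * V, exists c, U iv.1 iv.2 -> near_centre iv.1 iv.2 c.
    by move=> [i v]; have [[c cP]|nU] := pselect (U i v); [exists c|exists (PhiP v) => /nU].
  by exists (fun i v => f (i, v)) => i v; exact: (fP (i, v)).
have e'th : e' <= th / 6 by rewrite ge_min lexx.
have e'eps : e' <= eps / 4 by rewrite ge_min lexx orbT.
pose Tt (q : nat) : R := q%:R / T%:R.
have Tt01 q : (q <= T)%N -> 0 <= Tt q <= 1.
  by move=> qT; rewrite divr_ge0 ?ler0n //= ler_pdivrMr // mul1r ler_nat.
(* Both centres lie in the same [F i]. Their distance is less than a third of each radius plus a
   sixth of [th], hence less than the larger radius, and the estimate at the centre with that radius
   applies. *)
have centre_close i u k k' t : in_kuhn e u -> (i <= m)%N -> U i (u k) -> U i (u k') -> 0 <= t <=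
    1 ->
    `|h (inord i) (ctr i (u k)) t - h (inord i) (ctr i (u k')) t| < eps / 4.
  move=> hu im Uk Uk' t01.
  have [cs tc ic cc] := ctrP _ _ Uk; have [cs' tc' ic' cc'] := ctrP _ _ Uk'.
  have {cc cc'} cc l : `|ctr i (u k) l - ctr i (u k') l| < rad (ctr i (u k)) / 3 + rad (ctr i (u
      k')) / 3 + th / 6.
    have a1 := cc l; have a2 := cc' l; have a3 := mesh u l k k' hu.
    have a4 := ler_distD (Phi l (u k)) (ctr i (u k) l) (ctr i (u k') l).
    have a5 := ler_distD (Phi l (u k')) (Phi l (u k)) (ctr i (u k') l).
    rewrite /PhiP distrC in a1; rewrite /PhiP in a2; lra.
  have th1 := th_le _ cs; have th2 := th_le _ cs'; rewrite -/(rad _) in th1 th2.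
  move: cs tc ic cc cs' tc' ic' th1 th2;
      move: (ctr i (u k)) (ctr i (u k')) => c c' cs tc ic cc cs' tc' ic' th1 th2.
  have [_ _ _ /(_ tc)[Fc hc _]] := dataD c; have [_ _ _ /(_ tc')[Fc' hc' _]] := dataD c'.
  rewrite -/(idx _) ic in Fc hc; rewrite -/(idx _) ic' in Fc' hc'.
  have [le|le] := leP (rad c') (rad c).
    rewrite distrC; apply: hc => // l; rewrite distrC (lt_le_trans (cc l)) // -/(rad c).
    lra.
  by apply: hc' => // l; rewrite (lt_le_trans (cc l)) // -/(rad c'); lra.
(* Time 0 is the grid map, and time q + 1 is the contraction at the chosen centre at time q / T. The
   pole is only a default value. *)
pose G i (q : nat) (v : V) : 'rV[R]_d.+2 := if q is q'.+1 then
  (if (q' <= T)%N && `[< U i v /\ (i <= m)%N >]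
      then h (inord i) (ctr i v) (Tt q') else upole R d.+2)
  else Phi i v.
have GS i q v : usphere (G i q v).
  rewrite /G; case: q => [|q] //; case: ifP => [/andP[qT /asboolP[Ui im]]|_].
    have [cs tc ic _] := ctrP _ _ Ui; have [_ _ _ /(_ tc)[Fc _ _]] := dataD (ctr i v).
    by apply: hS => //; [rewrite -ic|exact: Tt01].
  exact: usphere_pole.
have GE i q v : U i v -> (i <= m)%N -> (q <= T)%N -> G i q.+1 v = h (inord i) (ctr i v) (Tt q).
  by move=> Ui im qT; rewrite /G qT /=; case: asboolP => // -[].
have Glast i v : sign_label (G i T.+1 v) = d.+2.
  suff -> : G i T.+1 v = upole R d.+2 by rewrite /sign_label mxE ler01.
  rewrite /G; case: ifP => // /andP[_ /asboolP[Ui im]].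
  have [cs tc ic _] := ctrP _ _ Ui; have [_ _ _ /(_ tc)[Fc _ _]] := dataD (ctr i v).
  by rewrite /Tt divff ?gt_eqF // h1 // -ic.
have Gclose i u q k k' : in_kuhn e u -> (i <= m)%N -> (forall k, U i (u k)) -> (q < T.+1)%N ->
    [/\ `|G i q (u k) - G i q (u k')| <= eps, `|G i q (u k) - G i q.+1 (u k')| <= eps &
      `|G i q.+1 (u k) - G i q.+1 (u k')| <= eps].
  move=> hu im Uu; rewrite ltnS => qT.
  have e4 : eps / 4 <= eps by rewrite ler_pdivrMr // ler_peMr ?(ltW eps0) // (ler_nat _ 1).
  have close q' : (q' <= T)%N -> `|G i q'.+1 (u k) - G i q'.+1 (u k')| <= eps / 4.
    by move=> qT'; rewrite !GE // ltW // centre_close // Tt01.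
  split; last by apply: le_trans (close q qT) e4.
    case: q qT => [|q] qT; last by apply: le_trans (close q (ltnW qT)) e4.
    by apply: le_trans (mesh u i k k' hu) _; apply: le_trans e'eps e4.
  have [cs tc ic cc] := ctrP _ _ (Uu k'); have [_ r4 _ /(_ tc)[Fc _ hct]] := dataD (ctr i (u k')).
  case: q qT => [|q] qT.
    rewrite GE // /Tt mul0r h0 // -?ic //=.
    have := cc (inord i); rewrite /PhiP inordK // => cci.
    have := ler_distD (Phi i (u k')) (Phi i (u k)) (ctr i (u k') (inord i)).
    have := mesh u i k k' hu; have := rad_le (ctr i (u k')); rewrite ic; have := eps0; lra.
  have qT' := ltnW qT; have := centre_close i u k k' (Tt q) hu im (Uu k) (Uu k') (Tt01 q qT').
  rewrite !GE //.
  have := hct (Tt q) (Tt q.+1) (Tt01 q qT') (Tt01 _ qT); rewrite -/(idx _) ic.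
  have -> : `|Tt q - Tt q.+1| <= (D (ctr i (u k'))).2.
    rewrite /Tt -mulrBl -natr1 opprD addrA subrr sub0r mulN1r normrN ger0_norm ?invr_ge0 ?(ltW
        T0) //.
    apply: le_trans (tau_le _ cs); rewrite -[tau]invrK lef_pV2 ?posrE ?invr_gt0 //.
    exact: ltW.
  move=> /(_ isT) c1 c2.
  have := ler_distD (h (inord i) (ctr i (u k')) (Tt q)) (h (inord i) (ctr i (u k)) (Tt q))
    (h (inord i) (ctr i (u k')) (Tt q.+1)).
  have := eps0; lra.
pose lab i q := @sign_label R d \o G i q.
(* The prism cochain of the discretized contraction, set to 0 on simplices that leave [U i]. *)
pose b i (u : nat -> V) : 'F_2 := if `[< forall k, (k <= d)%N -> U i (u k) >] then
  \sum_(q < T.+1) \sum_(j < d.+1) fullc d.+1 (prism j (lab i q \o u) (lab i q.+1 \o u)) else 0.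
pose w i (u : nat -> V) := fullc d.+1 (@lattice_label M m d i \o u).
have : \sum_v \sum_(sg : 'S_(m.+1 * d.+1))
    \prod_(i < m.+1) w i (fun k => kuhn e v sg (i * d.+1 + k)%N) = 0.
  apply: (@kuhn_integral_cup_eq0 _ m d e w b).
  - by move=> i u u' uu'; apply: fullc_depends => k kd; rewrite /= uu'.
  - move=> i u hu; rewrite /w.
    have -> : coboundary d.+1 (fun u => fullc d.+1 (lattice_label i \o u)) u =
      coboundary d.+1 (fullc d.+1) (@sign_label R d \o (fun k => Phi i (u k))).
      apply: eq_bigr => j _; apply: fullc_depends => k _.
      by rewrite /face /= PhiL.
    apply: (sign_label_coboundary eps1) => [k|k k']; first exact: PhiS.
    apply: le_trans (mesh u i k k' hu) _; apply: le_trans e'eps _.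
    by rewrite ler_pdivrMr // ler_peMr ?(ltW eps0) // (ler_nat _ 1).
  - move=> i u u' uu'; rewrite /b.
    have -> : `[< forall k, (k <= d)%N -> U i (u k) >] = `[< forall k, (k <= d)%N -> U i (u' k) >].
      by apply/asboolP/asboolP => Uu k kd; [rewrite -uu'|rewrite uu'] => //; apply: Uu.
    case: ifP => // _; apply: eq_bigr => q _; apply: eq_bigr => j _.
    apply: fullc_depends => k kd; rewrite /prism /=.
    case: leqP => kj; first by rewrite uu' // (leq_trans kj) // -ltnS.
    by rewrite uu' // -subn1 leq_subLR add1n.
  move=> v sg.
  have [c [cs tc cc]] := cov (PhiP v) (fun i => PhiS i v).
  exists (idx c : nat) => // f.
  have Uall k : U (idx c : nat) (kuhn e v sg k).
    exists c; split => // [|l]; first by rewrite inord_val.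
    have := ler_distD (Phi l v) (Phi l (kuhn e v sg k)) (c l).
    have := mesh0 v sg k l; have := cc l; have := th_le _ cs; rewrite -/(rad c) /PhiP.
    rewrite (distrC (Phi l v) (Phi l (kuhn e v sg k))); have := e'th; have := e'0; lra.
  rewrite /w; set u := kuhn e v sg \o f; set i : nat := idx c.
  have hu : in_kuhn e u by apply: in_kuhn_comp; exact: in_kuhn_kuhn.
  have im : (i <= m)%N by rewrite -ltnS ltn_ord.
  have Uu k : U i (u k) by exact: Uall.
  have := @fullc_homotopy R d V eps T.+1 (G i) u eps1 (fun q k => GS i q (u k))
    (fun q k k' => Gclose i u q k k' hu im Uu).
  (* At the end all labels are [d.+2], so no simplex is full. *)
  have -> : fullc d.+1 (@sign_label R d \o G i T.+1 \o u) = 0.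
    rewrite /fullc; case: fullP => // /(_ 0%N isT)[k _] /=.
    by rewrite Glast.
  rewrite addr0 => hom.
  transitivity (fullc d.+1 (@sign_label R d \o G i 0%N \o u)).
    by apply: fullc_depends => k _ /=; rewrite PhiL.
  rewrite -hom; apply: eq_bigr => j _; rewrite /b ifT //.
  by apply/asboolP => k _; exact: Uu.
have := @lattice_count M m d M2; rewrite /w => -> /eqP.
by rewrite oner_eq0.
Qed.

End NoNullhomotopies.

Lemma no_nullhomotopies_gen (R : realType) (m D : nat)
    (F : 'I_m.+1 -> ('I_m.+1 -> 'rV[R]_D) -> Prop)
    (h : 'I_m.+1 -> ('I_m.+1 -> 'rV[R]_D) -> R -> 'rV[R]_D) :
  (1 < D)%N ->
  (forall y, torus y -> exists i, F i y) ->
  (forall i y t, torus y -> F i y -> 0 <= t <= 1 -> usphere (h i y t)) ->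
  (forall i y, torus y -> F i y -> h i y 0 = y i) ->
  (forall i y, torus y -> F i y -> h i y 1 = upole R D) ->
  (forall i y e, torus y -> F i y -> 0 < e -> exists2 r, 0 < r &
    forall y', torus y' -> F i y' -> (forall l, `|y' l - y l| < r) ->
      forall t, 0 <= t <= 1 -> `|h i y' t - h i y t| < e) ->
  (forall i y e, torus y -> F i y -> 0 < e -> exists2 r, 0 < r &
    forall t t', 0 <= t <= 1 -> 0 <= t' <= 1 -> `|t - t'| <= r -> `|h i y t - h i y t'| < e) ->
  False.
Proof.
by case: D F h => [|[|d]] F h // _ *; apply: (@no_nullhomotopies R m d F h).
Qed.

(** * Subcomplexes in real coordinates *)

Section ComplexReal.
Variable R : realType.
Notation K := (Cplx R).

Lemma continuous_Re : continuous (fun z : K => complex.Re z : R).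
Proof.
move=> z; apply/(@cvgrPdist_lt _ _ _ (nbhs z) (nbhs_filter z)) => e e0.
have e0' : 0 < e%:C%C :> K by rewrite ltcR.
have near_z : \forall z' \near z, `|z - z'| < e%:C%C :> K.
  exact: (@cvgr_dist_lt K K K (nbhs z) (nbhs_filter z) id z cvg_id _ e0').
near=> z'; have h : `|z - z'| < e%:C%C :> K by near: z'.
rewrite -ltcR; apply: le_lt_trans h.
have -> : complex.Re z - complex.Re z' = complex.Re (z - z' : R[i]).
  by case: (z) (z') => [a b] [a' b'].
exact: normc_ge_Re.
Unshelve. all: by end_near. Qed.

Lemma normc_ge_Im (x : R[i]) : `|complex.Im x|%:C%C <= `|x|.
Proof.
case: x => a b; rewrite normc_def /= lecR -sqrtr_sqr ler_sqrt ?lerDr ?sqr_ge0 //.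
by rewrite addr_ge0 ?sqr_ge0.
Qed.

Lemma continuous_Im : continuous (fun z : K => complex.Im z : R).
Proof.
move=> z; apply/(@cvgrPdist_lt _ _ _ (nbhs z) (nbhs_filter z)) => e e0.
have e0' : 0 < e%:C%C :> K by rewrite ltcR.
have near_z : \forall z' \near z, `|z - z'| < e%:C%C :> K.
  exact: (@cvgr_dist_lt K K K (nbhs z) (nbhs_filter z) id z cvg_id _ e0').
near=> z'; have h : `|z - z'| < e%:C%C :> K by near: z'.
rewrite -ltcR; apply: le_lt_trans h.
have -> : complex.Im z - complex.Im z' = complex.Im (z - z' : R[i]).
  by case: (z) (z') => [a b] [a' b'].
exact: normc_ge_Im.
Unshelve. all: by end_near. Qed.

Lemma cvg_Complex (U : Type) (F : set_system U) (FF : Filter F) (f g : U -> R) a b :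
  f @ F --> a -> g @ F --> b ->
  (fun u => (f u +i* g u)%C : K) @ F --> ((a +i* b)%C : K).
Proof.
move=> fa gb; apply/cvgrPdist_lt => e e0.
have [e1 e10 ->] : exists2 e1 : R, 0 < e1 & e = e1%:C%C.
  by case: e e0 => x y; rewrite ltcE /= => /andP[/eqP -> x0]; exists x.
have e2 : 0 < e1 / 2 by rewrite divr_gt0.
near=> u.
have -> : ((a +i* b)%C - (f u +i* g u)%C : R[i]) = (a - f u)%:C%C + 'i%C * (b - g u)%:C%C.
  by rewrite [LHS]complexE.
apply: le_lt_trans (ler_normD _ _) _; rewrite normrM.
have -> : `|(a - f u)%:C%C| = `|a - f u|%:C%C :> R[i]
    by rewrite normc_def /= expr0n addr0 sqrtr_sqr.
have -> : `|(b - g u)%:C%C| = `|b - g u|%:C%C :> R[i]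
    by rewrite normc_def /= expr0n addr0 sqrtr_sqr.
have -> : `|'i%C| = 1 :> R[i] by rewrite normc_def /= expr0n expr1n add0r sqrtr1.
rewrite mul1r -rmorphD /= ltcR [e1](splitr) ltrD //.
  by near: u; apply: cvgr_dist_lt.
by near: u; apply: cvgr_dist_lt.
Unshelve. all: by end_near. Qed.

Variable k : nat.

(** Real parts come first, so that the base point becomes the pole. *)
Definition toR (v : 'rV[K]_k) : 'rV[R]_(k + k) :=
  row_mx (\row_j complex.Re (v 0 j)) (\row_j complex.Im (v 0 j)).

Definition toC (u : 'rV[R]_(k + k)) : 'rV[K]_k :=
  \row_j (u 0 (lshift k j) +i* u 0 (rshift k j))%C.

Lemma toR_l v j : toR v 0 (lshift k j) = complex.Re (v 0 j).
Proof. by rewrite row_mxEl mxE. Qed.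

Lemma toR_r v j : toR v 0 (rshift k j) = complex.Im (v 0 j).
Proof. by rewrite row_mxEr mxE. Qed.

Lemma toRK : cancel toR toC.
Proof. by move=> v; apply/rowP => j; rewrite mxE toR_l toR_r; case: (v 0 j). Qed.

Lemma toCK : cancel toC toR.
Proof.
move=> u; apply/rowP => j; rewrite -[j]splitK.
by case: (fintype.split j) => i /=; rewrite ?toR_l ?toR_r mxE.
Qed.

Lemma toR_continuous : continuous toR.
Proof.
move=> v; apply: (@cvg_mx R _ _ _ (nbhs v)) => i j; rewrite ord1.
rewrite -[j]splitK; case: (fintype.split j) => j' /=.
  under eq_cvg do rewrite toR_l.
  rewrite toR_l; apply: (cvg_comp (fun v : 'rV[K]_k => v 0 j')).
    exact: (@coord_continuous K 1 k 0 j' v).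
  exact: continuous_Re.
under eq_cvg do rewrite toR_r.
rewrite toR_r; apply: (cvg_comp (fun v : 'rV[K]_k => v 0 j')).
  exact: (@coord_continuous K 1 k 0 j' v).
exact: continuous_Im.
Qed.

Lemma toC_continuous : continuous toC.
Proof.
move=> u; apply: (@cvg_mx K _ _ _ (nbhs u)) => i j; rewrite ord1.
under eq_cvg do rewrite mxE.
by rewrite mxE; apply: cvg_Complex; exact: coord_continuous.
Qed.

Lemma sphere_toR (v : 'rV[K]_k) : sphere v <-> usphere (toR v).
Proof.
have E : \sum_(j < k) `|v 0 j| ^+ 2 = (\sum_j toR v 0 j ^+ 2)%:C%C.
  rewrite big_split_ord /= -big_split /= rmorph_sum /=.
  by apply: eq_bigr => j _; rewrite toR_l toR_r add_Re2_Im2.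
have s0 : 0 <= \sum_j toR v 0 j ^+ 2 by apply: sumr_ge0 => j _; exact: sqr_ge0.
rewrite /sphere /usphere /hermitian_norm /= E; split=> [h|->]; last first.
  by rewrite sqrtC1.
apply: (@complexI R); rewrite -[LHS]sqrtCK h expr1n //.
Qed.

End ComplexReal.

Lemma toR_base (R : realType) k : toR (@base_point R k.+1) = upole R (k.+1 + k.+1).
Proof.
apply/rowP => j; rewrite -[j]splitK; case: (fintype.split j) => i /=.
  by rewrite toR_l !mxE /=; case: eqP.
by rewrite toR_r !mxE /=; case: eqP.
Qed.

Lemma cvg_normalize (R : realType) D (U : Type) (F : set_system U) (FF : Filter F)
    (f : U -> 'rV[R]_D) (w : 'rV[R]_D) :
  w != 0 -> f @ F --> w -> (fun u => normalize (f u)) @ F --> normalize w.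
Proof.
move=> w0 fw; rewrite /normalize; apply: cvgZ => //.
apply: cvgV; first by rewrite gt_eqF // enorm_gt0.
apply: (@continuous_cvg _ _ _ F FF (fun u =>
    \sum_j f u 0 j ^+ 2) Num.sqrt _ (@sqrt_continuous R _)).
have cf j : f u 0 j @[u --> F] --> w 0 j.
  exact: (@continuous_cvg _ _ _ F FF f (fun v : 'rV[R]_D =>
      v 0 j) w (@coord_continuous _ _ _ _ _ w) fw).
by apply: cvg_sum_ord => j; apply: cvgM.
Qed.

Lemma closed_eq_fun (R : realType) (T : topologicalType) (f : T -> R) (c : R) :
  continuous f -> closed [set x | f x = c].
Proof.
by move=> cf; apply: (@closed_comp _ _ f [set x | x = c]) (@closed_eq R c) => x _; exact: cf.
Qed.

(** * Cells, subtori and the number z *)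

Section Subcomplexes.
Variables (R : realType) (k' n : nat).
Notation k := k'.+1.
Notation D := (k + k)%N.
Notation A := (ambient R k n).
Implicit Types (x y : A) (J : {set 'I_n}) (X : set A).

Definition coordR x i : 'rV[R]_D := toR (x i).

Lemma continuous_coordR i : continuous (coordR ^~ i).
Proof.
move=> x; apply: (@continuous_comp A 'rV[Cplx R]_k 'rV[R]_D (fun x => x i) (@toR R k)).
  exact: continuous_ptws_coord.
exact: toR_continuous.
Qed.

Lemma coordR_base x i : coordR x i = upole R D <-> x i = base_point R k.
Proof.
rewrite /coordR -toR_base; split=> [|-> //].
exact: (can_inj (@toRK R k)).
Qed.

Lemma subtorusP J x : subtorus J x <->
  forall i, usphere (coordR x i) /\ (i \notin J -> coordR x i = upole R D).
Proof.
split=> [[sx xJ] i|h].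
  split; first by apply/sphere_toR; exact: sx.
  by move=> iJ; apply/coordR_base; exact: xJ.
split=> i; first by apply/sphere_toR; exact: (h i).1.
by move=> iJ; apply/coordR_base; apply: (h i).2.
Qed.

Lemma closed_subtorus J : closed (@subtorus R k n J).
Proof.
have cc i (j : 'I_D) : continuous (fun x => coordR x i 0 j).
  move=> x; apply: (@continuous_comp A 'rV[R]_D R (coordR ^~ i) (fun u => u 0 j)).
    exact: continuous_coordR.
  exact: coord_continuous.
have -> : @subtorus R k n J = \bigcap_(i in [set: 'I_n]) ([set x | \sum_j coordR x i 0 j ^+ 2 =
    1] `&`
    \bigcap_(j in [set j | i \notin J]) [set x | coordR x i 0 j = upole R D 0 j]).
  apply/seteqP; split=> x.
    move/subtorusP => h i _; split; first exact: (h i).1.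
    by move=> j /= /(h i).2 /= ->.
  move=> h; apply/subtorusP => i; have [s e] := h i I; split => // iJ.
  by apply/rowP => j; exact: e.
apply: closed_bigI => i _; apply: closedI.
  apply: closed_eq_fun => x; apply: (@cvg_sum_ord R A (nbhs x) _) => j; apply: cvgM; exact: cc.
by apply: closed_bigI => j _; apply: closed_eq_fun; exact: cc.
Qed.

Definition supp x : {set 'I_n} := finset (fun i => x i != base_point R k).

Lemma cellP J x : cell J x <-> sphere_power x /\ supp x = J.
Proof.
split=> [[sx h]|[sx <-]].
  split=> //; apply/setP => i; rewrite finset.in_set; apply/idP/idP => [/eqP ne|iJ].
    by apply/negPn/negP => iJ; apply: ne; exact: (h i).1.
  by apply/eqP; exact: (h i).2.
split=> // i; rewrite finset.in_set; split=> [/negPn/eqP //|/eqP //].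
Qed.

Lemma subtorus_suppP J x : subtorus J x <-> sphere_power x /\ supp x \subset J.
Proof.
split=> -[sx h]; split=> //.
  apply/fintype.subsetP => i; rewrite finset.in_set => /eqP ne.
  by apply/negPn/negP => /h.
move=> i iJ; apply/eqP/negPn/negP => ne.
by move/fintype.subsetP/(_ i): h; rewrite finset.in_set ne (negPf iJ) => /(_ isT).
Qed.

(** A curve in the sphere that differs from the pole for t > 0 and tends to it as t decreases to
    0. *)
Definition near_pole (t : R) : 'rV[R]_D :=
  normalize (\row_j (if j == 0 :> nat then 1 else if j == 1 :> nat then t else 0)).

Lemma near_pole_pre_neq0 (t : R) :
  (\row_(j < D) (if j == 0 :> nat then 1 else if j == 1 :> nat then t else 0)) != 0.
Proof. by apply/eqP => /rowP/(_ ord0)/eqP; rewrite !mxE /= oner_eq0. Qed.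

Lemma near_pole_sphere t : usphere (near_pole t).
Proof. exact/normalize_sphere/near_pole_pre_neq0. Qed.

Lemma near_pole_neq t : 0 < t -> near_pole t <> upole R D.
Proof.
move=> t0 e; have D1 : (1 < D)%N by rewrite addnS.
have /rowP/(_ (Ordinal D1)) := e; rewrite !mxE /= => /eqP.
rewrite mulf_eq0 invr_eq0 !gt_eqF //.
by rewrite enorm_gt0 near_pole_pre_neq0.
Qed.

Lemma near_pole_cvg : near_pole t @[t --> 0^'+] --> upole R D.
Proof.
have e : upole R D = normalize (\row_j (if j == 0 :> nat then 1 else if j == 1 :> nat then 0 else
    0)).
  rewrite [X in normalize X](_ : _ = upole R D).
    by rewrite normalize_id //; exact: usphere_pole.
  by apply/rowP => j; rewrite !mxE; case: (j == 0 :> nat) => //; case: ifP.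
rewrite [X in _ --> X]e; apply: cvg_normalize; first exact: near_pole_pre_neq0.
apply: cvg_mx => i j; under eq_cvg do rewrite mxE.
rewrite mxE; case: eqP => _; first exact: cvg_cst.
case: eqP => _; last exact: cvg_cst.
exact: cvg_at_right_filter.
Qed.

(** The coordinates in [J] that equal the base point are pushed off it along [near_pole]. *)
Lemma subtorus_closure_cell J : @subtorus R k n J `<=` closure (@cell R k n J).
Proof.
move=> y ty.
pose f (t : R) : A := fun i => if (i \in J) &&
    (y i == base_point R k) then toC (near_pole t) else y i.
apply: (@closed_cvg R A (0^'+) _ f (closure (cell J))); first exact: closed_closure.
  near=> t; apply: subset_closure; apply/cellP; split.
    move=> i; rewrite /f; case: ifP => _; last exact: ty.1.
    by apply/sphere_toR; rewrite toCK; exact: near_pole_sphere.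
  have t0 : 0 < t by near: t; exact: nbhs_right_gt.
  apply/setP => i; rewrite finset.in_set /f; case: (boolP (i \in J)) => /= iJ; last first.
    by rewrite ty.2 // eqxx.
  case: (eqVneq (y i) (base_point R k)) => [_|-> //].
  apply/eqP => /(congr1 (@toR R k)); rewrite toCK toR_base; exact: near_pole_neq.
apply: cvg_ptws => i; rewrite /f;
    case: (boolP ((i \in J) && (y i == base_point R k))) => [/andP[_ /eqP ->]|_];
    last exact: cvg_cst.
rewrite -[base_point R k]toRK toR_base.
apply: (cvg_comp near_pole _ near_pole_cvg); exact: toC_continuous.
Unshelve. all: by end_near. Qed.

Section Subcomplex.
Variable X : set A.
Hypothesis hX : subcomplex X.

Lemma subcomplex_sphere x : X x -> sphere_power x.
Proof. by case: hX => _ _ [S ->] [J _ /cellP[]]. Qed.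

(** A closed union of cells contains the closure of the cell of [x], and that closure contains the
    subtorus of its support. *)
Lemma subcomplex_subtorus x : X x -> @subtorus R k n (supp x) `<=` X.
Proof.
case: hX => _ cX [S XE] Xx; apply: subset_trans (@subtorus_closure_cell _) _.
rewrite -[X in _ `<=` X](_ : closure X = X); last by rewrite closure_id in cX.
apply: closure_subset; move: Xx; rewrite XE => -[J JS /cellP[_ ->]] y Jy.
by exists J.
Qed.

Lemma subcomplex_base : X (fun=> base_point R k).
Proof.
case: hX => -[x Xx] _ _; apply: (subcomplex_subtorus Xx); split => // i.
by apply/sphere_toR; rewrite toR_base; exact: usphere_pole.
Qed.

Lemma wedge_subcomplex (J K : {set 'I_n}) : @subtorus R k n J `<=` X -> @subtorus R k n K `<=` X ->
  subcomplex_of (@wedge R k n J K) X.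
Proof.
move=> JX KX; split; last by rewrite subUset.
split.
- exists (fun=> base_point R k); left; split => // i.
  by apply/sphere_toR; rewrite toR_base; exact: usphere_pole.
- by apply: closedU; exact: closed_subtorus.
exists (finset (fun I : {set 'I_n} => (I \subset J) || (I \subset K))).
apply/seteqP; split=> x.
  have aux L : subtorus L x -> (L == J) || (L == K) -> exists2 I : {set 'I_n},
      ((I \subset J) || (I \subset K)) & cell I x.
    move=> /subtorus_suppP[sx sL] LE; exists (supp x); last exact/cellP.
    by case/orP: LE => /eqP LE; rewrite -LE sL ?orbT.
  case=> h; [have [|I IJ cI] := aux J h|have [|I IJ cI] := aux K h]; rewrite ?eqxx ?orbT //.
    by exists I => //=; rewrite finset.in_set.
  by exists I => //=; rewrite finset.in_set.
move=> [I /=]; rewrite finset.in_set => /orP[IJ|IK] /cellP[sx sI].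
  by left; apply/subtorus_suppP; rewrite sI.
by right; apply/subtorus_suppP; rewrite sI.
Qed.

Lemma card_le_z (J K : {set 'I_n}) : [disjoint J & K]%B -> @subtorus R k n J `<=` X ->
  @subtorus R k n K `<=` X -> (#|J| + #|K| <= z X)%N.
Proof.
move=> dJK JX KX; rewrite /z.
apply: (@leq_bigmax_cond _ _ (fun JK : {set 'I_n} * {set 'I_n} => #|JK.1| + #|JK.2|)%N (J, K)).
by rewrite /= dJK; apply/asboolP; exact: wedge_subcomplex.
Qed.

(** The empty pair is admissible, since [X] contains the base point; so the maximum is taken over a
    nonempty family. *)
Lemma z_attained : exists J K : {set 'I_n}, [/\ [disjoint J & K]%B, @subtorus R k n J `<=` X,
  @subtorus R k n K `<=` X & (#|J| + #|K|)%N = z X].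
Proof.
pose P : pred ({set 'I_n} * {set 'I_n}) := fun JK =>
  [disjoint JK.1 & JK.2]%B && `[< subcomplex_of (wedge JK.1 JK.2) X >].
have h0 : P (finset.set0, finset.set0).
  rewrite /P /= finset.disjoints_subset finset.sub0set; apply/asboolP.
  have s0 : @subtorus R k n finset.set0 `<=` X.
    move=> x /subtorus_suppP[sx]; rewrite finset.subset0 => /eqP sx0.
    by apply: (subcomplex_subtorus subcomplex_base); apply/subtorus_suppP;
        rewrite sx0 finset.sub0set.
  exact: wedge_subcomplex.
have card0 : (0 < #|P|)%N by apply/card_gt0P; exists (finset.set0, finset.set0); rewrite unfold_in.
have [[J K] PJK zE] := eq_bigmax_cond (fun JK : {set 'I_n} * {set 'I_n} =>
    #|JK.1| + #|JK.2|)%N card0.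
move: PJK; rewrite unfold_in => /andP[dJK /asboolP[_ JKX]].
exists J, K; split; first exact: dJK.
- by move=> x Jx; apply: JKX; left.
- by move=> x Kx; apply: JKX; right.
by symmetry; exact: zE.
Qed.

End Subcomplex.
End Subcomplexes.

(** * Paths *)

Section UnitInterval.
Variable R : realType.
Notation I01 := (unit_interval R).

Lemma continuous_uival : continuous (fun t : I01 => \val t : R).
Proof. exact: initial_continuous. Qed.

Lemma uival_bounds (t : I01) : 0 <= (\val t : R) <= 1.
Proof. by case: t => t h /=; have := set_mem h; rewrite /= in_itv. Qed.

Definition to_ui (t : R) : I01 :=
  if pselect (t \in (`[0, 1]%classic : set R)) is left h then exist _ t h else unit_interval0 R.

Lemma to_uiK (t : R) : 0 <= t <= 1 -> \val (to_ui t) = t.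
Proof.
move=> t01; rewrite /to_ui; case: pselect => // -[].
by apply/mem_set; rewrite /= in_itv.
Qed.

Lemma to_ui0 : to_ui 0 = unit_interval0 R.
Proof. by apply/val_inj; rewrite to_uiK ?lexx ?ler01. Qed.

Lemma to_ui1 : to_ui 1 = unit_interval1 R.
Proof. by apply/val_inj; rewrite to_uiK ?lexx ?ler01. Qed.

Lemma nbhs_ui (t : I01) (P : set I01) : nbhs t P ->
  exists2 r : R, 0 < r & forall t' : I01, `|(\val t : R) - \val t'| < r -> P t'.
Proof.
rewrite nbhsE => -[B [[C oC <-] Ct] BP].
have /nbhs_ballP[r r0 rC] : nbhs (\val t : R) C by apply: open_nbhs_nbhs.
by exists r => // t' tt'; apply: BP; apply: rC.
Qed.

Lemma ui_compact : compact [set: I01].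
Proof.
apply/compact_near_coveringP => J F P FF cov.
have := @segment_compact R 0 1 => /compact_near_coveringP.
move=> /(_ J F (fun j x => forall h : x \in (`[0, 1]%classic : set R), P j (exist _ x h)) FF) cov'.
have : \near F, `[0, 1]%classic `<=` (fun j (x : R) =>
   forall h : x \in (`[0, 1]%classic : set R), P j (exist _ x h)) F.
  apply: cov'.
  move=> x x01; have h : x \in (`[0, 1]%classic : set R) by exact: mem_set.
  have [[B C] /= [nB FC] BC] := cov (exist _ x h) I.
  have [r r0 rB] := nbhs_ui nB.
  exists (ball x r, C); first by split => //=; exact: nbhsx_ballx.
  move=> [x' j] /= [xx' Cj] h'; apply: (BC (exist _ x' h', j)); split => //=.
  exact: rB.
apply: filterS => j h [t ht] _; apply: h.
by have := set_mem ht.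
Qed.

Lemma ui_hausdorff : hausdorff_space I01.
Proof.
rewrite open_hausdorff => s t st.
have : (\val s : R) != \val t by apply: contra st => /eqP/val_inj ->.
have := @Rhausdorff R; rewrite open_hausdorff => h /h[[A B] /= [As Bt] [oA oB AB]].
exists ((\val : I01 -> R) @^-1` A, (\val : I01 -> R) @^-1` B) => /=.
  by split; apply/mem_set; [exact: (set_mem As)|exact: (set_mem Bt)].
split; [by exists A|by exists B|].
rewrite -preimage_setI; move/eqP: AB => AB; rewrite AB; exact/eqP/preimage_set0.
Qed.

Lemma ui_locally_compact : locally_compact [set: I01].
Proof.
move=> t _; exists [set: I01]; first by rewrite withinET; exact: filterT.
by split; [exact: ui_compact|exact: closedT].
Qed.

Section PathSpaces.
Variables (T X : topologicalType).

(** Half of the exponential law; it holds because the unit interval is locally compact and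
    Hausdorff. *)
Lemma path_eval_continuous (s : T -> path_space R X) : continuous s ->
  continuous (fun pt : T * I01 => s pt.1 pt.2).
Proof.
move=> cs.
have h : continuous (uncurry (fun p => (s p : I01 -> X))).
  apply: continuous_uncurry.
  - exact: ui_locally_compact.
  - exact: ui_hausdorff.
  - move=> p; apply: (@continuous_comp T (path_space R X) {compact-open, I01 -> X} s
      (fun g : path_space R X => (g : I01 -> X) : {compact-open, I01 -> X}) p (cs p)).
    exact: initial_continuous.
  - by move=> p; exact: cts_fun.
by rewrite (_ : (fun pt => _) = uncurry (fun p => (s p : I01 -> X))) //; apply: funext => -[].
Qed.

Lemma path_curry (H : T * I01 -> X) : continuous H ->
  exists2 s : T -> path_space R X, continuous s & forall p t, s p t = H (p, t).
Proof.
move=> cH; have [cc cp] := continuous_curry cH.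
exists (fun p => (mkcts (cp p) : path_space R X)) => //.
move=> p; apply: (@cvg_initial (path_space R X) {compact-open, I01 -> X} _ T (nbhs p) _).
exact: cc.
Qed.

End PathSpaces.

(** Compactness of the interval: near each t, both values are within e / 2 of g (y, t). *)
Lemma tube (T : topologicalType) D (g : T * I01 -> 'rV[R]_D) (y : T) (e : R) :
  continuous g -> 0 < e -> \forall y' \near y, forall t, `|g (y', t) - g (y, t)| < e.
Proof.
move=> cg e0; have e2 : 0 < e / 2 by rewrite divr_gt0.
have := ui_compact => /compact_near_coveringP.
move=> /(_ T (nbhs y) (fun y' t => `|g (y', t) - g (y, t)| < e) _) h.
have {h} : \forall y' \near y, [set: I01] `<=` (fun t => `|g (y', t) - g (y, t)| < e).
  apply: h => t _.
  have := @cvgr_distC_lt _ _ _ (nbhs (y, t)) _ g (g (y, t)) (cg (y, t)) _ e2.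
  move=> [[B C] /= [nB nC] BC].
  exists (C, B) => //= -[t' y'] /= [Ct By].
  have h1 := BC (y', t') (conj By Ct).
  have h2 := BC (y, t') (conj (nbhs_singleton nB) Ct).
  rewrite /= in h1 h2; rewrite [e]splitr (le_lt_trans (ler_distD (g (y, t)) _ _)) // ltrD //.
  by rewrite distrC.
by apply: filterS => y' h t; apply: h.
Qed.

(** Heine's theorem; the near covering is taken along positive radii tending to 0. *)
Lemma path_unif (D : nat) (c : I01 -> 'rV[R]_D) (e : R) : continuous c -> 0 < e ->
  exists2 r : R, 0 < r & forall t t' : I01, `|(\val t : R) - \val t'| <= r -> `|c t - c t'| < e.
Proof.
move=> cc e0; have e2 : 0 < e / 2 by rewrite divr_gt0.
have := ui_compact => /compact_near_coveringP.
move=> /(_ R (0^'+) (fun r t => forall t' : I01,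
    `|(\val t : R) - \val t'| <= r -> `|c t - c t'| < e) _) h.
have {h} : \forall r \near (0^'+ : set_system R), [set: I01] `<=` (fun t => forall t' : I01,
   `|(\val t : R) - \val t'| <= r -> `|c t - c t'| < e).
  apply: h => t _.
  have [r r0 hr] := nbhs_ui (@cvgr_distC_lt _ _ _ (nbhs t) _ c (c t) (cc t) _ e2).
  exists ([set t' : I01 | `|(\val t : R) - \val t'| < r / 2], [set r' : R | r' < r / 2]).
    split => /=; last by apply: nbhs_right_lt; rewrite divr_gt0.
    have := @cvgr_dist_lt _ _ _ (nbhs t) _ (fun t : I01 =>
        \val t : R) (\val t) (@continuous_uival t) (r / 2).
    by apply; rewrite divr_gt0.
  move=> [t' r'] /= [tt' rr'] t'' t't''.
  have h1 : `|c t' - c t| < e / 2 by apply: hr; lra.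
  have h2 : `|c t'' - c t| < e / 2.
    by apply: hr; have := ler_distD (\val t' : R) (\val t) (\val t''); lra.
  by have := ler_distD (c t) (c t') (c t''); rewrite (distrC (c t) (c t'')); lra.
move=> h; have [r [/= hr r0]] := @filter_ex R (0^'+) _ _ (filterI h (nbhs_right_gt (0 : R))).
by exists r => // t t'; apply: hr.
Qed.

End UnitInterval.

(** * The lower bound *)

(** The finite product is identified with a space of matrices, whose sup norm provides the uniform
    radius. *)
Lemma nbhs_ptws_rV (R : realType) m D (y : {ptws 'I_m -> 'rV[R]_D}) (C : set {ptws 'I_m ->
    'rV[R]_D}) :
  nbhs y C -> exists2 r : R, 0 < r &
    forall y' : 'I_m -> 'rV[R]_D, (forall l, `|y' l - y l| < r) -> C y'.
Proof.
move=> nC; pose Q (M : 'M[R]_(m, D)) : {ptws 'I_m -> 'rV[R]_D} := fun l => row l M.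
pose mx (y : 'I_m -> 'rV[R]_D) : 'M[R]_(m, D) := \matrix_(i, j) y i 0 j.
have mxK y' : Q (mx y') = y'.
  by apply: funext => l; apply/rowP => j; rewrite !mxE.
have cQ : continuous Q.
  apply: continuous_to_ptws => l; apply: continuous_to_mx => i j.
  under eq_fun do rewrite mxE.
  exact: coord_continuous.
have : nbhs (mx y) (Q @^-1` C) by apply: cQ; rewrite mxK.
move=> /nbhs_ballP[r r0 rC]; exists r => // y' yy'; rewrite -(mxK y'); apply: rC.
split=> // i j; rewrite !mxE.
rewrite /ball /=; apply: le_lt_trans (yy' i); rewrite distrC.
by have := rv_coord_le (y' i - y i) j; rewrite !mxE.
Qed.

Section LowerBound.
Variables (R : realType) (k' n : nat).
Notation k := k'.+1.
Notation D := (k + k)%N.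
Notation A := (ambient R k n).
Variable X : set A.
Hypothesis hX : subcomplex X.
Variables (J K : {set 'I_n}).
Hypothesis dJK : [disjoint J & K]%B.
Hypotheses (JX : @subtorus R k n J `<=` X) (KX : @subtorus R k n K `<=` X).
Variables (m : nat) (a : 'I_m.+1 -> 'I_n).
Hypotheses (a_inj : injective a) (aJK : forall l, (a l \in J) || (a l \in K)).
Notation P := {ptws 'I_m.+1 -> 'rV[R]_D}.

Definition embed (L : {set 'I_n}) (u : P) : A := fun i =>
  if [pick l | a l == i] is Some l then if i \in L then toC (u l) else base_point R k
  else base_point R k.

Lemma embed_coord L u l : coordR (embed L u) (a l) = if a l \in L then u l else upole R D.
Proof.
rewrite /coordR /embed; case: pickP => [l' /eqP/a_inj ->|/(_ l)]; last by rewrite eqxx.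
by case: ifP => _; rewrite ?toCK // toR_base.
Qed.

Lemma embed_subtorus L u : torus u -> subtorus L (embed L u).
Proof.
move=> tu; split=> i; rewrite /embed.
  case: pickP => [l _|_]; last by apply/sphere_toR; rewrite toR_base; exact: usphere_pole.
  case: ifP => _; apply/sphere_toR; first by rewrite toCK; exact: tu.
  by rewrite toR_base; exact: usphere_pole.
by move=> iL; case: pickP => // l _; rewrite (negPf iL).
Qed.

Lemma embed_continuous L : continuous (embed L).
Proof.
apply: continuous_to_ptws => i; rewrite /embed.
case: pickP => [l _|_]; last exact: cst_continuous.
case: (i \in L); last exact: cst_continuous.
move=> u; apply: (@continuous_comp P 'rV[R]_D 'rV[Cplx R]_k (fun u => u l) (@toC R k)).
  exact: continuous_ptws_coord.
exact: toC_continuous.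
Qed.

Lemma X_base : X (fun=> base_point R k). Proof. exact: subcomplex_base hX. Qed.

(** The base point is the default value outside [X]. *)
Definition inX (x : A) : set_type X :=
  if pselect (X x) is left h then exist (fun x => x \in X) x (mem_set h)
  else exist (fun x => x \in X) (fun=> base_point R k) (mem_set X_base).

Lemma inXK x : X x -> \val (inX x) = x.
Proof. by rewrite /inX; case: pselect. Qed.

Definition pt (u : P) : set_type X * set_type X := (inX (embed J u), inX (embed K u)).

(** Along the local rule over [F i], the coordinate [a i] joins u_i to the pole, which gives the
    contractions excluded by [no_nullhomotopies_gen]. *)
Lemma lower_bound_aux : motion_planner R (set_type X) m.+1 -> False.
Proof.
case=> F s _ covF cs sE _.
pose T i := set_type [set u : P | torus u /\ F i (pt u)].
have q_proof i (y : T i) : pt (\val y) \in F i by have /set_mem[_] := valP y; exact: mem_set.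
pose q i (y : T i) : set_type (F i) := exist _ (pt (\val y)) (q_proof i y).
have cq i : continuous (@q i).
  have aux L : @subtorus R k n L `<=` X -> continuous (fun y : T i => inX (embed L (\val y))).
    move=> LX; apply: continuous_to_initial.
    have -> : set_val \o (fun y : T i => inX (embed L (\val y))) = (fun y' : T i =>
        embed L (\val y')).
      apply: funext => y; rewrite /= set_valE inXK //; apply: LX; apply: embed_subtorus.
      by have /set_mem[] := valP y.
    move=> y; apply: (@continuous_comp _ _ _ (\val : T i -> P) (embed L));
        last exact: embed_continuous.
    exact: initial_continuous.
  apply: continuous_to_initial => y.
  have := cvg_pair (aux J JX y) (aux K KX y).
  exact.
(* If [a i] lies in [K], the path runs from the pole to u_i and has to be reversed. *)
pose rev i (t : R) := if a i \in J then t else 1 - t.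
have rev01 i t : 0 <= t <= 1 -> 0 <= rev i t <= 1.
  by rewrite /rev; case: ifP => // _ /andP[t0 t1]; rewrite subr_ge0 t1 gerBl.
pose g i (yt : T i * unit_interval R) : 'rV[R]_D :=
  coordR (\val (s i (q i yt.1) yt.2)) (a i).
have cg i : continuous (g i).
  have c1 : continuous (fun yt : T i * unit_interval R => s i (q i yt.1) yt.2).
    apply: (@path_eval_continuous R (T i) (set_type X) (s i \o q i)).
    by move=> y; apply: continuous_comp; [exact: cq|exact: cs].
  have c2 : continuous (fun x : set_type X => coordR (\val x) (a i)).
    move=> x; apply: (@continuous_comp (set_type X) A 'rV[R]_D (\val : set_type X -> A) (fun x :
        A => coordR x (a i)) x).
      exact: initial_continuous.
    exact: continuous_coordR.
  move=> yt; exact: (@continuous_comp _ _ _ _ _ yt (c1 yt) (c2 _)).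
pose h i (y : P) (t : R) : 'rV[R]_D :=
  if pselect (torus y /\ F i (pt y)) is left H then g i (exist _ y (mem_set H), to_ui (rev i t))
  else upole R D.
have hE i (y : T i) t : h i (\val y) t = g i (y, to_ui (rev i t)).
  rewrite /h; case: pselect => [H|[]]; last exact: set_mem (valP y).
  by congr (g i (_, _)); apply/val_inj.
have hE' i y t (H : torus y /\ F i (pt y)) : h i y t = g i (exist _ y (mem_set H), to_ui (rev i t)).
  by rewrite -hE.
have g0 i (y : T i) : g i (y, unit_interval0 R) = coordR (embed J (\val y)) (a i).
  rewrite /g /=; have /(congr1 fst) /= -> := sE i (q i y).
  by rewrite inXK //; apply: JX; apply: embed_subtorus; have /set_mem[] := valP y.
have g1 i (y : T i) : g i (y, unit_interval1 R) = coordR (embed K (\val y)) (a i).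
  rewrite /g /=; have /(congr1 snd) /= -> := sE i (q i y).
  by rewrite inXK //; apply: KX; apply: embed_subtorus; have /set_mem[] := valP y.
have JnK i : a i \in J -> (a i \in K) = false.
  by move=> iJ; apply/negbTE; move/pred0P/(_ (a i)): dJK => /=; rewrite iJ /= => ->.
have nJK i : (a i \in J) = false -> a i \in K.
  by move=> iJ; have := aJK i; rewrite iJ.
apply: (@no_nullhomotopies_gen R m D (fun i y => F i (pt y)) h); first by rewrite addnS.
- move=> y _; have : [set: set_type X * set_type X] (pt y) by [].
  by rewrite -covF => -[i _ Fi]; exists i.
- move=> i y t ty Fy t01; rewrite (hE' i y t (conj ty Fy)) /g /=.
  apply/sphere_toR; apply: (subcomplex_sphere hX).
  exact: set_mem (valP (s i (q i (exist _ y (mem_set (conj ty Fy)))) (to_ui (rev i t)))).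
- move=> i y ty Fy; rewrite (hE' i y 0 (conj ty Fy)) /rev; case: ifP => [iJ|/[dup] iJ /nJK iK].
    by rewrite to_ui0 g0 embed_coord iJ.
  by rewrite subr0 to_ui1 g1 embed_coord iK.
- move=> i y ty Fy; rewrite (hE' i y 1 (conj ty Fy)) /rev; case: ifP => [/[dup] iJ /JnK iK|iJ].
    by rewrite to_ui1 g1 embed_coord iK.
  by rewrite subrr to_ui0 g0 embed_coord iJ.
- move=> i y e ty Fy e0; pose H := conj ty Fy; pose y0 : T i := exist _ y (mem_set H).
  have : nbhs y0 [set y' | forall t, `|g i (y', t) - g i (y0, t)| < e]
      by exact: (@tube R (T i) D (g i) y0 e (cg i) e0).
  rewrite nbhsE => -[_ [[C oC <-] Cy] BC].
  have [r r0 rC] := @nbhs_ptws_rV R m.+1 D y C (open_nbhs_nbhs (conj oC Cy)).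
  exists r => // y' ty' Fy' yy' t t01.
  rewrite (hE' i y t H) (hE' i y' t (conj ty' Fy')).
  by apply: BC => /=; apply: rC.
move=> i y e ty Fy e0; pose H := conj ty Fy; pose y0 : T i := exist _ y (mem_set H).
have cy : continuous (fun t => g i (y0, t)).
  move=> t; apply: (@continuous_comp _ _ _ (fun t => (y0, t)) (g i)); last exact: cg.
  have h1 : (fun _ : unit_interval R =>
      y0) @ t --> y0 by exact: (@cst_continuous (unit_interval R) (T i) y0 t).
  have h2 : (fun t : unit_interval R => t) @ t --> t by exact: cvg_id.
  have := cvg_pair h1 h2; exact.
have [r r0 hr] := path_unif cy e0.
exists r => // t t' t01 t01' tt'.
rewrite (hE' i y t H) (hE' i y t' H); apply: hr.
rewrite !to_uiK ?rev01 // /rev; case: ifP => // _.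
by rewrite (_ : 1 - t - (1 - t') = - (t - t')) ?normrN //; ring.
Qed.

End LowerBound.

Lemma planner_lower_bound (R : realType) (k' n : nat) (X : set (ambient R k'.+1 n))
    (hX : subcomplex X) m :
  motion_planner R (set_type X) m -> (z X < m)%N.
Proof.
move=> P; rewrite ltnNge; apply/negP => mz.
case: m P mz => [|m] P mz.
  have := local_domain_cover P.
  pose b := inX hX (fun=> base_point R k'.+1).
  move/seteqP => [_ /(_ (b, b) I)] [[]//].
have [J [K [dJK JX KX zE]]] := z_attained hX.
have le : (m.+1 <= #|J :|: K|)%N.
  by rewrite cardsU (eqP (_ : #|J :&: K| == 0)%N) ?subn0 ?zE // cards_eq0 setI_eq0.
pose a (l : 'I_m.+1) : 'I_n := enum_val (widen_ord le l).
apply: (@lower_bound_aux R k' n X hX J K dJK JX KX m a _ _ P).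
  by move=> l l' /enum_val_inj /(congr1 val) /= /val_inj.
by move=> l; have := enum_valP (widen_ord le l); rewrite finset.in_setU.
Qed.

(** * Local rules *)

Lemma normalize_scale (R : realType) D (c : R) (u : 'rV[R]_D) :
  0 < c -> usphere u -> normalize (c *: u) = u.
Proof.
move=> c0 su; have cE : enorm (c *: u) = c.
  rewrite /enorm; under eq_bigr do rewrite mxE exprMn.
  by rewrite -mulr_sumr su mulr1 sqrtr_sqr gtr0_norm.
by rewrite /normalize cE scalerA mulVf ?scale1r // gt_eqF.
Qed.

(** * The motion of a single sphere coordinate *)

Section Motion.
Variables (R : realType) (k' : nat).
Notation k := k'.+1.
Notation D := (k + k)%N.
Implicit Types (x y : 'rV[R]_D) (t : R).
Let e := upole R D.

(* Multiplication by the imaginary unit. *)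
Definition rot x : 'rV[R]_D := row_mx (- rsubmx x) (lsubmx x).

Lemma rot_l x j : rot x 0 (lshift k j) = - x 0 (rshift k j).
Proof. by rewrite row_mxEl !mxE. Qed.

Lemma rot_r x j : rot x 0 (rshift k j) = x 0 (lshift k j).
Proof. by rewrite row_mxEr mxE. Qed.

(** The functions min(1, 2 t) and, next, min(1, 2 - 2 t), written with absolute values. *)
Definition ramp_up t := (1 + 2 * t - `|1 - 2 * t|) / 2.
Definition ramp_down t := (3 - 2 * t - `|1 - 2 * t|) / 2.

(* If x is the pole then [weight_dst] vanishes for t <= 1/2, and if y is the pole
   then [weight_src] vanishes for t >= 1/2. *)
Definition weight_src x y t := 1 - ramp_up t + ramp_up t * ramp_down t * `|y - e|.
Definition weight_dst x y t := 1 - ramp_down t + ramp_up t * ramp_down t * `|x - e|.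
(** The last factor is twice the positive part of 1 - |x - e| - |y - e|, so the pole gets weight
    only when both ends are close to it. *)
Definition weight_pole x y t := ramp_up t * ramp_down t *
  (1 - `|x - e| - `|y - e| + `|1 - `|x - e| - `|y - e| |).

Definition motion_vec (anti : bool) x y t : 'rV[R]_D :=
  if anti then
    (weight_src x y t - weight_dst x y t) *: x + (weight_src x y t * weight_dst x y t) *: rot x
  else weight_src x y t *: x + weight_dst x y t *: y + weight_pole x y t *: e.

Definition motion anti x y t := normalize (motion_vec anti x y t).

Lemma ramp_first t : 0 <= t <= 2^-1 -> ramp_up t = 2 * t /\ ramp_down t = 1.
Proof. by move=> /andP[t0 t1]; rewrite /ramp_up /ramp_down ger0_norm; lra. Qed.

Lemma ramp_second t : 2^-1 <= t <= 1 -> ramp_up t = 1 /\ ramp_down t = 2 - 2 * t.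
Proof. by move=> /andP[t0 t1]; rewrite /ramp_up /ramp_down ler0_norm; lra. Qed.

Lemma ramp_cases t : 0 <= t <= 1 -> 0 <= t <= 2^-1 \/ 2^-1 <= t <= 1.
Proof. by move=> /andP[t0 t1]; have [h|h] := leP t 2^-1; [left|right]; lra. Qed.

Lemma ramp_bounds t : 0 <= t <= 1 ->
  [/\ 0 <= ramp_up t <= 1, 0 <= ramp_down t <= 1 & ramp_up t = 1 \/ ramp_down t = 1].
Proof.
move=> /ramp_cases[] h; [have [-> ->] := ramp_first h|have [-> ->] := ramp_second h];
 move: h => /andP[? ?]; split; by [lra|left|right].
Qed.

Let eS : usphere e. Proof. exact: usphere_pole. Qed.

Lemma weights_ge0 x y t : 0 <= t <= 1 ->
  [/\ 0 <= weight_src x y t, 0 <= weight_dst x y t & 0 <= weight_pole x y t].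
Proof.
move=> /ramp_bounds[/andP[u0 u1] /andP[w0 w1] _].
have uw : 0 <= ramp_up t * ramp_down t by rewrite mulr_ge0.
split.
- by rewrite addr_ge0 ?subr_ge0 // mulr_ge0.
- by rewrite addr_ge0 ?subr_ge0 // mulr_ge0.
apply: mulr_ge0 => //.
by have := ler_norm (- (1 - `|x - e| - `|y - e|)); rewrite normrN; lra.
Qed.

Lemma dist_pole_gt0 x : x <> e -> 0 < `|x - e|.
Proof. by move=> xe; rewrite normr_gt0 subr_eq0; apply/eqP. Qed.

(* The first two weights both vanish only if x and y are the pole, where the third
   one is positive. *)
Lemma weights_sum_gt0 x y t : 0 <= t <= 1 -> x <> e \/ y <> e ->
  0 < weight_src x y t + weight_dst x y t.
Proof.
move=> /ramp_bounds[/andP[u0 u1] /andP[w0 w1] uw] xy.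
have d0 : 0 < `|x - e| + `|y - e|.
  by case: xy => /dist_pole_gt0 h; [rewrite ltr_pwDl|rewrite ltr_wpDl].
rewrite /weight_src /weight_dst; set dx := `|x - e| in d0 *; set dy := `|y - e| in d0 *.
have pos (c : R) : 0 <= c -> c <= 1 -> 0 < 1 - c + c * (dx + dy).
  rewrite le_eqVlt => /orP[/eqP <- _|c0 c1]; first by rewrite mul0r addr0 subr0.
  by rewrite ltr_wpDl ?subr_ge0 // mulr_gt0.
case: uw => ->.
  by rewrite (_ : _ + _ = 1 - ramp_down t + ramp_down t * (dx + dy)) ?pos //; ring.
by rewrite (_ : _ + _ = 1 - ramp_up t + ramp_up t * (dx + dy)) ?pos //; ring.
Qed.

Lemma weight_pole_gt0 x y t : 0 < weight_pole x y t ->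
  `|x - e| + `|y - e| < 1.
Proof.
apply: contraTT; rewrite -!leNgt => d1; rewrite /weight_pole.
by rewrite (ler0_norm (_ : 1 - `|x - e| - `|y - e| <= 0)) ?subrr ?mulr0 ?lexx //; lra.
Qed.

Lemma coord0_gt0 x : `|x - e| < 1 -> 0 < x 0 0.
Proof.
move=> h; have := le_lt_trans (rv_coord_le (x - e) 0) h.
by rewrite !mxE eqxx /= ltr_norml => /andP[]; lra.
Qed.

(** In complex terms (a + i b) x = 0; multiply by the conjugate scalar. *)
Lemma rot_comb_eq0 a b x : a *: x + b *: rot x = 0 -> x != 0 -> a = 0 /\ b = 0.
Proof.
move=> h x0.
have hl j : a * x 0 (lshift k j) - b * x 0 (rshift k j) = 0.
  have /rowP/(_ (lshift k j)) := h; rewrite mxE [X in X + _]mxE [X in _ + X]mxE rot_l.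
  by rewrite [RHS]mxE mulrN.
have hr j : a * x 0 (rshift k j) + b * x 0 (lshift k j) = 0.
  have /rowP/(_ (rshift k j)) := h; rewrite mxE [X in X + _]mxE [X in _ + X]mxE rot_r.
  by rewrite [RHS]mxE.
have [s0|s0] := eqVneq (a ^+ 2 + b ^+ 2) 0.
  by move/eqP: s0; rewrite paddr_eq0 ?sqr_ge0 // !sqrf_eq0 => /andP[/eqP-> /eqP->].
case/eqP: x0; apply/rowP => j; rewrite -[j]splitK [RHS]mxE; case: (fintype.split j) => i /=.
  have : (a ^+ 2 + b ^+ 2) * x 0 (lshift k i) = 0.
    transitivity (a * (a * x 0 (lshift k i) - b * x 0 (rshift k i))
      + b * (a * x 0 (rshift k i) + b * x 0 (lshift k i))); first by ring.
    by rewrite hl hr !mulr0 addr0.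
  by move/eqP; rewrite mulf_eq0 (negPf s0) /= => /eqP.
have : (a ^+ 2 + b ^+ 2) * x 0 (rshift k i) = 0.
  transitivity (a * (a * x 0 (rshift k i) + b * x 0 (lshift k i))
    - b * (a * x 0 (lshift k i) - b * x 0 (rshift k i))); first by ring.
  by rewrite hl hr !mulr0 subr0.
by move/eqP; rewrite mulf_eq0 (negPf s0) /= => /eqP.
Qed.

(** Let p, q be the weights of x and y. In the antipodal case, p = q and p q = 0 would make both
    vanish, although x and y are not both the pole. Otherwise, if the pole has positive weight, all
    coordinates 0 are positive; if it has none, p x = - q y on the sphere gives p = q and x = -
    y. *)
Lemma motion_vec_neq0 (anti : bool) x y t : usphere x -> usphere y -> 0 <= t <= 1 ->
  (anti <-> x = - y) -> motion_vec anti x y t != 0.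
Proof.
move=> sx sy t01 antiE; have [p0 q0 r0] := weights_ge0 x y t01.
rewrite /motion_vec; set p := weight_src x y t in p0 *; set q := weight_dst x y t in q0 *.
case: anti antiE => -[].
  move=> /(_ isT) xy _; apply/eqP => /rot_comb_eq0/(_ (usphere_neq0 sx))[pq pq0].
  have xe : x <> e \/ y <> e.
    have [xe|xe] := pselect (x = e); [right => ye|by left].
    move/rowP/(_ 0): xy; rewrite xe ye !mxE eqxx /=; lra.
  have := weights_sum_gt0 t01 xe; rewrite -/p -/q.
  move/eqP: pq0; rewrite mulf_eq0 => /orP[] /eqP; lra.
move=> _ nxy; apply/eqP => h.
have [r1|r1] := ltP 0 (weight_pole x y t).
  have d1 := weight_pole_gt0 r1.
  have [x0 y0] : 0 < x 0 0 /\ 0 < y 0 0.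
    split; apply: coord0_gt0; apply: le_lt_trans d1; [rewrite lerDl|rewrite lerDr] => //.
  move/rowP/(_ 0): h; rewrite !mxE eqxx /= mulr1 => h.
  have := mulr_ge0 p0 (ltW x0); have := mulr_ge0 q0 (ltW y0); lra.
have rE : weight_pole x y t = 0 by apply/eqP; rewrite eq_le r1 r0.
have xe : x <> e \/ y <> e.
  have [xe|xe] := pselect (x = e); [right => ye|by left].
  move: h; rewrite rE scale0r addr0 {1}xe {1}ye -scalerDl => /eqP.
  rewrite scaler_eq0 (negPf (usphere_neq0 eS)) orbF => /eqP pq.
  have [/andP[u0 u1] /andP[w0 w1] uw] := ramp_bounds t01.
  move: rE; rewrite /weight_pole xe ye subrr normr0 !subr0 normr1 => rE.
  move: pq; rewrite /p /q /weight_src /weight_dst xe ye subrr normr0 !mulr0 !addr0.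
  nra.
have := weights_sum_gt0 t01 xe; rewrite -/p -/q => pq.
move: h; rewrite rE scale0r addr0 => h.
have hE : p *: x = (- q) *: y by apply/eqP; rewrite scaleNr -addr_eq0 h.
have pqE : p ^+ 2 = q ^+ 2.
  have : \sum_j (p *: x) 0 j ^+ 2 = \sum_j ((- q) *: y) 0 j ^+ 2 by rewrite hE.
  under eq_bigr do rewrite mxE exprMn. under [RHS]eq_bigr do rewrite mxE exprMn.
  by rewrite -!mulr_sumr sx sy !mulr1 sqrrN.
have pq' : p = q by move/eqP: pqE; rewrite eqrXn2 // => /eqP.
have p1 : p != 0 by apply/eqP => pz; move: pq; rewrite -pq' pz addr0 ltxx.
suff : x = - y by move/nxy.
by apply: (scalerI p1); rewrite hE scaleNr scalerN pq'.
Qed.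

Lemma motion_sphere (anti : bool) x y t : usphere x -> usphere y -> 0 <= t <= 1 ->
  (anti <-> x = - y) -> usphere (motion anti x y t).
Proof. by move=> *; apply: normalize_sphere; exact: motion_vec_neq0. Qed.

Lemma motion0 anti x y : usphere x -> motion anti x y 0 = x.
Proof.
move=> sx; have [u0 w0] : ramp_up (0 : R) = 2 * 0 /\ ramp_down (0 : R) = 1.
  by apply: ramp_first; rewrite lexx /= invr_ge0.
rewrite /motion /motion_vec /weight_src /weight_dst /weight_pole u0 w0 mulr0 !mul0r !addr0 !subr0
    subrr.
by case: anti; rewrite ?subr0 ?mulr0 !scale0r !scale1r ?addr0 normalize_id.
Qed.

Lemma motion1 (anti : bool) x y : usphere y -> (anti <-> x = - y) -> motion anti x y 1 = y.
Proof.
move=> sy antiE; have [u0 w0] : ramp_up (1 : R) = 1 /\ ramp_down (1 : R) = 2 - 2 * 1.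
  by apply: ramp_second; rewrite lexx andbT invf_le1 // ler1n.
rewrite /motion /motion_vec /weight_src /weight_dst /weight_pole u0 w0 mulr1 !subrr !mulr0 !mul0r
    !addr0 !subr0.
case: anti antiE => antiE; last by rewrite !scale0r scale1r add0r addr0 normalize_id.
by rewrite (antiE.1 isT) mul0r scale0r addr0 sub0r scaleN1r opprK normalize_id.
Qed.

(** In the first half the weight of y vanishes, so the vector is a positive multiple of the pole. *)
Lemma motion_src_pole (anti : bool) y t : usphere y -> 0 <= t <= 2^-1 -> (anti <-> e = - y) ->
  motion anti e y t = e.
Proof.
move=> sy t2 antiE; have t01 : 0 <= t <= 1 by move: t2 => /andP[? ?]; lra.
have [u0 w0] := ramp_first t2.
have q0 : weight_dst e y t = 0 by rewrite /weight_dst w0 !subrr normr0 mulr0 addr0.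
have [p0 _ r0] := weights_ge0 e y t01.
have := motion_vec_neq0 eS sy t01 antiE; rewrite /motion /motion_vec q0 mulr0 !scale0r !addr0 subr0.
case: anti antiE => antiE; last rewrite -scalerDl; rewrite scaler_eq0 negb_or => /andP[c0 _];
  apply: normalize_scale => //; rewrite lt_neqAle eq_sym c0 //.
exact: addr_ge0.
Qed.

Lemma motion_dst_pole (anti : bool) x t : usphere x -> 2^-1 <= t <= 1 -> (anti <-> x = - e) ->
  motion anti x e t = e.
Proof.
move=> sx t2 antiE; have t01 : 0 <= t <= 1.
  by move: t2 => /andP[t2 ->]; rewrite andbT (le_trans _ t2) // invr_ge0.
have [u0 w0] := ramp_second t2.
have p0 : weight_src x e t = 0 by rewrite /weight_src u0 !subrr normr0 mulr0 addr0.
have [_ q0 r0] := weights_ge0 x e t01.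
have := motion_vec_neq0 sx eS t01 antiE; rewrite /motion /motion_vec.
set q := weight_dst x e t in q0 *; rewrite p0 mul0r !scale0r ?addr0 ?add0r ?sub0r.
case: anti antiE => antiE.
  rewrite (antiE.1 isT) scalerN scaleNr opprK scaler_eq0 negb_or => /andP[c0 _].
  by apply: normalize_scale => //; rewrite lt_neqAle eq_sym c0.
rewrite -scalerDl scaler_eq0 negb_or => /andP[c0 _].
by apply: normalize_scale => //; rewrite lt_neqAle eq_sym c0 addr_ge0.
Qed.

Section Limits.
Variables (U : Type) (F : set_system U) (FF : Filter F).
Variables (f g : U -> 'rV[R]_D) (tau : U -> R) (x y : 'rV[R]_D) (t : R).
Hypotheses (fx : f @ F --> x) (gy : g @ F --> y) (taut : tau @ F --> t).

Lemma cvg_rot : (fun u => rot (f u)) @ F --> rot x.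
Proof.
have cf j : f u 0 j @[u --> F] --> x 0 j.
  exact: (@continuous_cvg _ _ _ F FF f (fun v : 'rV[R]_D =>
      v 0 j) x (@coord_continuous _ _ _ _ _ x) fx).
apply: cvg_mx => i j; rewrite ord1 -[j]splitK; case: (fintype.split j) => j' /=.
  by under eq_cvg do rewrite rot_l; rewrite rot_l; apply: cvgN; exact: cf.
by under eq_cvg do rewrite rot_r; rewrite rot_r; exact: cf.
Qed.

Lemma cvg_motion_vec anti :
  (fun u => motion_vec anti (f u) (g u) (tau u)) @ F --> motion_vec anti x y t.
Proof.
have c2 : (fun u => 2 * tau u) @ F --> 2 * t by apply: cvgM => //; exact: cvg_cst.
have cn : (fun u => `|1 - 2 * tau u|) @ F --> `|1 - 2 * t|.
  by apply: cvg_norm; apply: cvgB => //; exact: cvg_cst.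
have cu : (fun u => ramp_up (tau u)) @ F --> ramp_up t.
  apply: cvgM; last exact: cvg_cst.
  by apply: cvgB => //; apply: cvgD => //; exact: cvg_cst.
have cw : (fun u => ramp_down (tau u)) @ F --> ramp_down t.
  apply: cvgM; last exact: cvg_cst.
  by apply: cvgB => //; apply: cvgB => //; exact: cvg_cst.
have cuw : (fun u => ramp_up (tau u) * ramp_down (tau u)) @ F --> ramp_up t * ramp_down t.
  exact: cvgM.
have cdx : (fun u => `|f u - e|) @ F --> `|x - e|.
  by apply: cvg_norm; apply: cvgB => //; exact: cvg_cst.
have cdy : (fun u => `|g u - e|) @ F --> `|y - e|.
  by apply: cvg_norm; apply: cvgB => //; exact: cvg_cst.
have cp : (fun u => weight_src (f u) (g u) (tau u)) @ F --> weight_src x y t.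
  apply: cvgD; last exact: cvgM.
  by apply: cvgB => //; exact: cvg_cst.
have cq : (fun u => weight_dst (f u) (g u) (tau u)) @ F --> weight_dst x y t.
  apply: cvgD; last exact: cvgM.
  by apply: cvgB => //; exact: cvg_cst.
have cs : (fun u => 1 - `|f u - e| - `|g u - e|) @ F --> 1 - `|x - e| - `|y - e|.
  by apply: cvgB => //; apply: cvgB => //; exact: cvg_cst.
have cr : (fun u => weight_pole (f u) (g u) (tau u)) @ F --> weight_pole x y t.
  by apply: cvgM => //; apply: cvgD => //; exact: cvg_norm.
rewrite /motion_vec; case: anti.
  apply: cvgD; apply: cvgZ => //; [exact: cvgB|exact: cvgM|exact: cvg_rot].
apply: cvgD; first by apply: cvgD; exact: cvgZ.
by apply: cvgZ => //; exact: cvg_cst.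
Qed.

Lemma cvg_motion anti : motion_vec anti x y t != 0 ->
  (fun u => motion anti (f u) (g u) (tau u)) @ F --> motion anti x y t.
Proof. by move=> v0; apply: cvg_normalize => //; exact: cvg_motion_vec. Qed.

End Limits.

End Motion.

(** * Local rules on the strata of antipodal pairs *)

Section LocalRules.
Variables (R : realType) (k' n : nat).
Notation k := k'.+1.
Notation D := (k + k)%N.
Notation A := (ambient R k n).
Variable X : set A.
Hypothesis hX : subcomplex X.
Notation XX := (set_type X * set_type X)%type.

Definition src (p : XX) i : 'rV[R]_D := coordR (\val p.1 : A) i.
Definition dst (p : XX) i : 'rV[R]_D := coordR (\val p.2 : A) i.

Definition antiset (p : XX) : {set 'I_n} := finset (fun i => src p i == - dst p i).

Definition antidomain (j : nat) : set XX := [set p | #|antiset p| = j].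

Lemma src_sphere p i : usphere (src p i).
Proof. by apply/sphere_toR; apply: (subcomplex_sphere hX); exact: set_mem (valP p.1). Qed.

Lemma dst_sphere p i : usphere (dst p i).
Proof. by apply/sphere_toR; apply: (subcomplex_sphere hX); exact: set_mem (valP p.2). Qed.

Lemma antisetP p i : (i \in antiset p) <-> src p i = - dst p i.
Proof. by rewrite finset.in_set; split=> /eqP. Qed.

Lemma continuous_coordR_val i : continuous (fun x : set_type X => coordR (\val x : A) i).
Proof.
move=> x; apply: (@continuous_comp (set_type X) A 'rV[R]_D (\val : set_type X -> A) (fun x : A =>
    coordR x i) x).
  exact: initial_continuous.
exact: continuous_coordR.
Qed.

Lemma continuous_src i : continuous (fun p : XX => src p i).
Proof.
move=> p; apply: (@continuous_comp XX (set_type X) 'rV[R]_D fst (fun x => coordR (\val x : A) i) p).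
  exact: cvg_fst.
exact: continuous_coordR_val.
Qed.

Lemma continuous_dst i : continuous (fun p : XX => dst p i).
Proof.
move=> p; apply: (@continuous_comp XX (set_type X) 'rV[R]_D snd (fun x => coordR (\val x : A) i) p).
  exact: cvg_snd.
exact: continuous_coordR_val.
Qed.

(** The antipodal coordinates in the support of x, and those in the support of y only, form two
    disjoint sets whose subtori lie in [X]. *)
Lemma card_antiset p : (#|antiset p| <= z X)%N.
Proof.
pose Jx := supp (\val p.1 : A); pose Jy := supp (\val p.2 : A).
have Xx : X (\val p.1) by exact: set_mem (valP p.1).
have Xy : X (\val p.2) by exact: set_mem (valP p.2).
have sub : antiset p \subset Jx :|: Jy.
  apply/fintype.subsetP => i /antisetP h; rewrite finset.in_setU !finset.in_set -negb_and.
  apply/negP => /andP[/eqP /coordR_base hx /eqP /coordR_base hy].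
  move: h; rewrite /src /dst hx hy => /rowP/(_ 0); rewrite !mxE /= mulr1n.
  by move/eqP; rewrite -addr_eq0 -mulr2n pnatr_eq0.
have -> : antiset p = (antiset p :&: Jx) :|: (antiset p :&: (Jy :\: Jx)).
  apply/setP => i; rewrite !finset.in_setU !finset.in_setI finset.in_setD.
  move/fintype.subsetP/(_ i): sub; rewrite finset.in_setU.
  by case: (i \in antiset p) => //= /(_ isT); case: (i \in Jx) => //= ->.
rewrite cardsU [X in (_ - #|pred_of_set X|)%N](_ : _ = finset.set0) ?cards0 ?subn0; last first.
  apply/setP => i; rewrite finset.in_set0 !finset.in_setI finset.in_setD.
  by case: (i \in Jx); rewrite ?andbF.
apply: card_le_z => //.
- rewrite -setI_eq0; apply/eqP/setP => i; rewrite finset.in_set0 !finset.in_setI finset.in_setD.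
  by case: (i \in Jx); rewrite ?andbF.
- move=> x /subtorus_suppP[sx h]; apply: (subcomplex_subtorus hX Xx); apply/subtorus_suppP.
  by split => //; apply: fintype.subset_trans h _; exact: finset.subsetIr.
move=> x /subtorus_suppP[sx h]; apply: (subcomplex_subtorus hX Xy); apply/subtorus_suppP.
split => //; apply: fintype.subset_trans h _; apply: fintype.subset_trans (finset.subsetIr _ _) _.
exact: finset.subsetDl.
Qed.

(** Being antipodal is a closed condition, so nearby the set can only shrink; its cardinality is
    fixed at [j] on the stratum. *)
Lemma near_antiset (j : nat) (p : set_type (antidomain j)) :
  \forall q \near p, antiset (\val q) = antiset (\val p).
Proof.
have h : \forall q \near p, forall i, src (\val p) i != - dst (\val p) i ->
    src (\val q) i != - dst (\val q) i.
  apply: (@filter_forall _ 'I_n (fun i => [set q : set_type (antidomain j) |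
    src (\val p) i != - dst (\val p) i -> src (\val q) i != - dst (\val q) i]) (nbhs p)
        (nbhs_filter p)) => i.
  have [_|ne] := eqVneq (src (\val p) i) (- dst (\val p) i); first exact: nearW.
  have cv : continuous (\val : set_type (antidomain j) -> XX) by exact: initial_continuous.
  have c1 : (fun q : set_type (antidomain j) => src (\val q) i) @ p --> src (\val p) i.
    exact: (@continuous_comp _ XX _ (\val : set_type (antidomain j) -> XX) (fun p =>
        src p i) p (cv p) (@continuous_src i _)).
  have c2 : (fun q : set_type (antidomain j) => dst (\val q) i) @ p --> dst (\val p) i.
    exact: (@continuous_comp _ XX _ (\val : set_type (antidomain j) -> XX) (fun p =>
        dst p i) p (cv p) (@continuous_dst i _)).
  have c := @cvg_norm _ _ _ (nbhs p) _ _ _ (@cvgD _ _ _ (nbhs p) _ _ _ _ _ c1 c2).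
  move: c => /(_ (nbhs_filter p) (nbhs_filter p)) c.
  have n0 : 0 < `|src (\val p) i + dst (\val p) i| by rewrite normr_gt0 addr_eq0.
  have gt := @cvgr_gt R _ (nbhs p) _ _ _ c 0 n0.
  by apply: (@filterS _ (nbhs p) (nbhs_filter p) _ _ _ (gt (nbhs_filter p))) => q /=;
      rewrite normr_gt0 addr_eq0.
apply: (@filterS _ (nbhs p) (nbhs_filter p) _ _ _ h) => {}q {}h; apply/eqP; rewrite eqEcard.
have -> : #|antiset (\val p)| = j by exact: set_mem (valP p).
have -> : #|antiset (\val q)| = j by exact: set_mem (valP q).
rewrite leqnn andbT; apply/fintype.subsetP => i; rewrite !finset.in_set.
by apply: contraTT; exact: h.
Qed.

Definition rule_point (p : XX) (t : R) : A := fun i =>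
  toC (motion (i \in antiset p) (src p i) (dst p i) t).

Lemma rule_point_coord p t i :
  coordR (rule_point p t) i = motion (i \in antiset p) (src p i) (dst p i) t.
Proof. by rewrite /coordR toCK. Qed.

Lemma rule_point_in p t : 0 <= t <= 1 -> X (rule_point p t).
Proof.
move=> t01; have sp i : usphere (coordR (rule_point p t) i).
  rewrite rule_point_coord; apply: motion_sphere => //;
      [exact: src_sphere|exact: dst_sphere|exact: antisetP].
case: (ramp_cases t01) => t2.
  apply: (subcomplex_subtorus hX (set_mem (valP p.1))); apply/subtorusP => i; split=> //.
  rewrite finset.in_set => /negPn/eqP/coordR_base xi.
  rewrite rule_point_coord /src xi; apply: motion_src_pole => //; first exact: dst_sphere.
  by rewrite antisetP /src xi.
apply: (subcomplex_subtorus hX (set_mem (valP p.2))); apply/subtorusP => i; split=> //.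
rewrite finset.in_set => /negPn/eqP/coordR_base yi.
rewrite rule_point_coord /dst yi; apply: motion_dst_pole => //; first exact: src_sphere.
by rewrite antisetP /dst yi.
Qed.

Lemma rule_point0 p : rule_point p 0 = \val p.1.
Proof.
apply: funext => i; apply: (can_inj (@toRK R k)); rewrite -/(coordR _ i) rule_point_coord.
by rewrite motion0 //; exact: src_sphere.
Qed.

Lemma rule_point1 p : rule_point p 1 = \val p.2.
Proof.
apply: funext => i; apply: (can_inj (@toRK R k)); rewrite -/(coordR _ i) rule_point_coord.
by rewrite motion1 //; [exact: dst_sphere|exact: antisetP].
Qed.

Lemma local_rule_exists (j : nat) : exists2 s : set_type (antidomain j) -> path_space R (set_type
    X),
  continuous s & forall p, endpoints (s p) = \val p.
Proof.
pose Fj := set_type (antidomain j).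
pose H (pt : Fj * unit_interval R) : set_type X := inX hX (rule_point (\val pt.1) (\val pt.2 : R)).
have cH : continuous H.
  apply: continuous_to_initial.
  have -> : set_val \o H = (fun pt => rule_point (\val pt.1) (\val pt.2 : R)).
    apply: funext => pt; rewrite /= set_valE inXK //; apply: rule_point_in; exact: uival_bounds.
  apply: continuous_to_ptws => i pt.
  apply: (@continuous_comp (Fj * unit_interval R)%type 'rV[R]_D 'rV[Cplx R]_k
    (fun pt => motion (i \in antiset (\val pt.1)) (src (\val pt.1) i) (dst (\val pt.1) i) (\val
        pt.2)) (@toC R k) pt); last exact: toC_continuous.
  have cv : continuous (\val : Fj -> XX) by exact: initial_continuous.
  have c1 : (fun pt : Fj * unit_interval R => \val pt.1 : XX) @ pt --> (\val pt.1 : XX).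
    by apply: (@continuous_comp (Fj * unit_interval R)%type Fj XX fst \val pt);
        [exact: cvg_fst|exact: cv].
  have cx : (fun pt : Fj * unit_interval R => src (\val pt.1) i) @ pt --> src (\val pt.1) i.
    exact: (@continuous_comp _ XX _ (fun pt : Fj * unit_interval R => \val pt.1 : XX) (fun p =>
        src p i) pt c1 (@continuous_src i _)).
  have cy : (fun pt : Fj * unit_interval R => dst (\val pt.1) i) @ pt --> dst (\val pt.1) i.
    exact: (@continuous_comp _ XX _ (fun pt : Fj * unit_interval R => \val pt.1 : XX) (fun p =>
        dst p i) pt c1 (@continuous_dst i _)).
  have ct : (fun pt : Fj * unit_interval R => \val pt.2 : R) @ pt --> (\val pt.2 : R).
    by apply: (@continuous_comp (Fj * unit_interval R)%type (unit_interval R) R snd \val pt);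
        [exact: cvg_snd|exact: continuous_uival].
  have v0 : motion_vec (i \in antiset (\val pt.1)) (src (\val pt.1) i) (dst (\val pt.1) i) (\val
      pt.2) != 0.
    by apply: motion_vec_neq0; [exact: src_sphere|exact: dst_sphere|exact: uival_bounds|exact:
        antisetP].
  have cm := @cvg_motion R k' _ (nbhs pt) (nbhs_filter pt) _ _ _ _ _ _ cx cy ct _ v0.
  (* The case distinction in [motion] is locally constant on the stratum, so it does not break
     continuity. *)
  have na : \forall pt' \near pt, antiset (\val pt'.1) = antiset (\val pt.1).
    exact: (@cvg_fst _ _ (nbhs pt.1) (nbhs pt.2) _ _ (near_antiset pt.1)).
  move=> B nB; have h1 := cm B nB.
  apply: (@filterS _ (nbhs pt) (nbhs_filter pt) _ _ _ (@filterI _ _ (nbhs_filter pt) _ _ h1 na)).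
  by move=> pt' [/= Bp aE]; rewrite /= aE.
have [s cs sE] := path_curry cH.
exists s => // p; rewrite /endpoints !sE /H /=.
have x0 : X (rule_point (\val p) 0) by apply: rule_point_in; rewrite lexx ler01.
have x1 : X (rule_point (\val p) 1) by apply: rule_point_in; rewrite lexx ler01.
have e0 : inX hX (rule_point (\val p) 0) = (\val p).1 by apply/val_inj;
    rewrite /= inXK // rule_point0.
have e1 : inX hX (rule_point (\val p) 1) = (\val p).2 by apply/val_inj;
    rewrite /= inXK // rule_point1.
by rewrite e0 e1 -surjective_pairing.
Qed.

End LocalRules.

(** * The local domains are Euclidean neighbourhood retracts *)

Section Collapse.
Variables (R : realType) (D' : nat).
Notation D := D'.+1.
Implicit Types (d a : R) (v : 'rV[R]_D).

(** For d >= 0 this moves [a] towards 0 by [d], stopping at 0. *)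
Definition soft_threshold d a := a + (`|a - d| - `|a + d|) / 2.

Lemma soft_threshold0 a : soft_threshold 0 a = a.
Proof. by rewrite /soft_threshold subr0 addr0 subrr mul0r addr0. Qed.

Lemma soft_thresholdN d a : soft_threshold d (- a) = - soft_threshold d a.
Proof.
rewrite /soft_threshold -opprD normrN (_ : - a + d = - (a - d)) ?normrN; last by ring.
by rewrite opprD -mulNr opprB.
Qed.

Lemma soft_threshold_eq0 d a : `|a| <= d -> soft_threshold d a = 0.
Proof.
rewrite ler_norml /soft_threshold => /andP[h1 h2].
by rewrite (ler0_norm (_ : a - d <= 0)) ?(ger0_norm (_ : 0 <= a + d)); lra.
Qed.

(** Keeping the coordinate 0 and shrinking the others by an odd function gives an odd map, so
    antipodal pairs stay antipodal; for d < 1 the sup-norm ball of radius [d] about the pole lands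
    on the ray of the pole. *)
Definition collapse d v : 'rV[R]_D :=
  \row_j (if j == 0 :> nat then v 0 j else soft_threshold d (v 0 j)).

Lemma collapse0 v : collapse 0 v = v.
Proof. by apply/rowP => j; rewrite mxE soft_threshold0; case: ifP. Qed.

Lemma collapseN d v : collapse d (- v) = - collapse d v.
Proof. by apply/rowP => j; rewrite !mxE soft_thresholdN; case: ifP. Qed.

Lemma normalizeN v : normalize (- v) = - normalize v.
Proof.
rewrite /normalize (_ : enorm (- v) = enorm v) ?scalerN // /enorm.
by congr Num.sqrt; apply: eq_bigr => j _; rewrite mxE sqrrN.
Qed.

Lemma normalize_collapse_pole d v : d < 1 -> `|v - upole R D| <= d ->
  normalize (collapse d v) = upole R D.
Proof.
move=> d1 vd; have c j := le_trans (rv_coord_le (v - upole R D) j) vd.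
have v0 : 0 < v 0 0 by have := c 0; rewrite !mxE eqxx /= ler_norml => /andP[]; lra.
rewrite -[RHS](normalize_scale v0 (usphere_pole R D')); congr normalize.
apply/rowP => j; rewrite !mxE; case: ifP => j0 /=.
  by rewrite mulr1; congr (v 0 _); apply/val_inj/eqP.
by rewrite mulr0 soft_threshold_eq0 //; have := c j; rewrite !mxE j0 subr0.
Qed.

Lemma cvg_collapse (U : Type) (F : set_system U) (FF : Filter F)
    (f : U -> R) (g : U -> 'rV[R]_D) d v :
  f @ F --> d -> g @ F --> v -> (fun u => collapse (f u) (g u)) @ F --> collapse d v.
Proof.
move=> fd gv.
have cg j : g u 0 j @[u --> F] --> v 0 j.
  exact: (@continuous_cvg _ _ _ F FF g (fun w : 'rV[R]_D =>
      w 0 j) v (@coord_continuous _ _ _ _ _ v) gv).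
apply: cvg_mx => i j; under eq_cvg do rewrite mxE.
rewrite mxE; case: (j == 0 :> nat); first exact: cg.
apply: cvgD; first exact: cg.
apply: cvgM; last exact: cvg_cst.
by apply: cvgB; apply: cvg_norm; [apply: cvgB|apply: cvgD].
Qed.

End Collapse.

Section Pack.
Variables (R : realType) (I : finType) (D : nat).
Definition packdim := #|{: I * 'I_D}|.

Definition pack (u : I -> 'rV[R]_D) : 'rV[R]_packdim :=
  \row_t u (enum_val t).1 0 (enum_val t).2.

Definition unpack (w : 'rV[R]_packdim) (c : I) : 'rV[R]_D :=
  \row_j w 0 (enum_rank (c, j)).

Lemma packK u : unpack (pack u) = u.
Proof. by apply: funext => c; apply/rowP => j; rewrite !mxE enum_rankK. Qed.

Lemma unpackK w : pack (unpack w) = w.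
Proof. by apply/rowP => t; rewrite !mxE -surjective_pairing enum_valK. Qed.

Lemma continuous_unpack c : continuous (unpack^~ c).
Proof.
apply: continuous_to_mx => i j; under eq_fun do rewrite mxE.
exact: coord_continuous.
Qed.

Lemma cvg_pack (U : Type) (F : set_system U) (FF : Filter F) (f : U -> I -> 'rV[R]_D) u :
  (forall c, f x c @[x --> F] --> u c) -> (fun x => pack (f x)) @ F --> pack u.
Proof.
move=> h; apply: cvg_mx => i j; under eq_cvg do rewrite mxE.
rewrite mxE; set c := (enum_val j).1.
exact: (@continuous_cvg _ _ _ F FF (fun x => f x c) (fun w : 'rV[R]_D =>
    w 0 _) (u c) (@coord_continuous _ _ _ _ _ (u c)) (h c)).
Qed.

End Pack.

(** * The retraction onto a stratum *)

Section EuclideanNeighbourhoodRetract.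
Variables (R : realType) (k' n : nat).
Notation k := k'.+1.
Notation D := (k + k)%N.
Notation A := (ambient R k n).
Variable X : set A.
Hypothesis hX : subcomplex X.
Variable j : nat.
Notation XX := (set_type X * set_type X)%type.
Notation T := (set_type (@antidomain R k' n X j)).
Notation I := (bool * 'I_n)%type.
Notation N := (packdim I D).
Notation W := 'rV[R]_N.
Let e := upole R D.
Implicit Types (B C : {set 'I_n}) (w : W).

Definition coords (p : XX) (c : I) : 'rV[R]_D := if c.1 then src p c.2 else dst p c.2.
Definition chart (p : T) : W := pack (coords (\val p)).

Lemma continuous_chart : continuous chart.
Proof.
move=> p; apply: (@cvg_pack R I D T (nbhs p) (nbhs_filter p)) => -[[] i]; rewrite /coords /=.
  apply: (@continuous_comp T XX 'rV[R]_D \val (fun p => src p i) p);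
      first exact: initial_continuous.
  exact: continuous_src.
apply: (@continuous_comp T XX 'rV[R]_D \val (fun p => dst p i) p); first exact: initial_continuous.
exact: continuous_dst.
Qed.

Lemma chart_src p i : unpack (chart p) (true, i) = src (\val p) i.
Proof. by rewrite packK. Qed.

Lemma chart_dst p i : unpack (chart p) (false, i) = dst (\val p) i.
Proof. by rewrite packK. Qed.

Lemma chart_inj : injective chart.
Proof.
move=> p q pq; apply/val_inj; rewrite [LHS]surjective_pairing [RHS]surjective_pairing.
congr (_, _); apply/val_inj; apply: funext => i; apply: (can_inj (@toRK R k)).
  by have := chart_src p i; rewrite pq chart_src => h; exact: esym h.
by have := chart_dst p i; rewrite pq chart_dst => h; exact: esym h.
Qed.

(** [T] carries an initial topology, and the coordinates of a point are recovered continuously from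
    its chart. *)
Lemma chart_cvg (p : T) (F : set_system T) (FF : Filter F) : chart @ F --> chart p -> F --> p.
Proof.
move=> h.
have cc c : (fun q => unpack (chart q) c) @ F --> unpack (chart p) c.
  exact: (@continuous_cvg _ _ _ F FF chart (fun w : W =>
      unpack w c) (chart p) (@continuous_unpack _ _ _ c _) h).
have aux (b : bool) : (fun q : T =>
    if b then (\val q).1 else (\val q).2) @ F --> (if b then (\val p).1 else (\val p).2).
  apply: (@cvg_initial _ _ _ _ F FF); apply: cvg_ptws => i.
  have E (q : T) : (set_val (if b then (\val q).1 else (\val q).2) : A) i = toC (unpack (chart q)
      (b, i)).
    by case: b; rewrite ?chart_src ?chart_dst [RHS]toRK.
  rewrite /= E; under eq_cvg do rewrite E.
  exact: (@continuous_cvg _ _ _ F FF _ (@toC R k) _ (@toC_continuous _ _ _) (cc (b, i))).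
apply: (@cvg_initial _ _ _ _ F FF id).
have := cvg_pair (aux true) (aux false).
rewrite /= (_ : (fun x : T => (_, _)) = set_val \o id); last by apply: funext => q;
    exact: esym (surjective_pairing _).
exact.
Qed.

Lemma chart_embedding : embedding chart.
Proof.
split; [exact: chart_inj|exact: continuous_chart|move=> O oO].
pose V := \bigcup_(V0 in [set V0 : set W | open V0 /\ chart @^-1` V0 `<=` O]) V0.
exists V; first by apply: bigcup_open => V0 [].
apply/seteqP; split=> [w [p Op <-]|w [[p _ <-] [V0 [_ sub] V0p]]]; last by exists p => //;
    exact: sub.
split; first by exists p.
have FF : Filter (filter_from (nbhs (chart p)) (fun O' => chart @^-1` O')).
  apply: filter_from_filter; first by exists setT; exact: filterT.
  by move=> P Q nP nQ; exists (P `&` Q) => //; exact: filterI.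
have cv : chart @ filter_from (nbhs (chart p)) (fun O' => chart @^-1` O') --> chart p.
  by move=> P nP; exists P.
have [P nP PO] := chart_cvg FF cv (open_nbhs_nbhs (conj oO Op)).
move: nP; rewrite nbhsE => -[V0 [oV0 V0p] V0P].
by exists V0 => //; split => // q /V0P /PO.
Qed.

Definition in_complex (J : {set 'I_n}) : bool := `[< @subtorus R k n J `<=` X >].

Definition symm (B : {set 'I_n}) (w : W) (c : I) : 'rV[R]_D :=
  if c.1 then unpack w (true, c.2)
  else if c.2 \in B then - unpack w (true, c.2) else unpack w (false, c.2).

Definition defect_at B w (JK : {set 'I_n} * {set 'I_n}) : R :=
  \sum_(i | i \notin JK.1) `|symm B w (true, i) - e| +
  \sum_(i | i \notin JK.2) `|symm B w (false, i) - e|.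

(* An l^1-distance of [symm B w] from X * X, cut off at 1. *)
Definition defect B w : R :=
  \big[Num.min/1]_(JK : {set 'I_n} * {set 'I_n} | in_complex JK.1 &&
      in_complex JK.2) defect_at B w JK.

Definition retract_coords B w (c : I) : 'rV[R]_D := normalize (collapse (defect B w) (symm B w c)).

Definition retract B w : W := pack (retract_coords B w).

(** The clauses ensure in turn that [B] is determined by [w], that the collapsing radius is below 1,
    that normalization is possible, and that no antipodal coordinate arises outside [B]. *)
Definition near_stratum B w : Prop :=
  [/\ forall i l, i \in B -> l \notin B ->
        `|unpack w (true, i) + unpack w (false, i)| < `|unpack w (true, l) + unpack w (false, l)|,
      defect B w < 1,
      forall c, collapse (defect B w) (symm B w c) != 0 &
      forall l, l \notin B -> retract_coords B w (true, l) + retract_coords B w (false, l) != 0].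

(** Distinct sets of equal size have elements i in B only and l in C only, for which the two first
    clauses contradict each other. *)
Lemma near_stratum_uniq B C w : #|B| = #|C| -> near_stratum B w -> near_stratum C w -> B = C.
Proof.
move=> BC [hB _ _ _] [hC _ _ _]; apply/eqP; rewrite eqEcard BC leqnn andbT.
apply/fintype.subsetP => i iB; apply/negPn/negP => iC.
have /subsetPn[l lC lB] : ~~ (C \subset B).
  apply/negP => CB; have /eqP CE : C == B by rewrite eqEcard CB BC leqnn.
  by rewrite CE iB in iC.
have := hB i l iB lB; have := hC l i lC iC.
by move=> h1 h2; have := lt_trans h1 h2; rewrite ltxx.
Qed.

Lemma continuous_symm B c : continuous (fun w => symm B w c).
Proof.
rewrite /symm; case: c => -[] i /=; first exact: continuous_unpack.
case: (i \in B); last exact: continuous_unpack.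
move=> w; have := @cvgN R _ _ (nbhs w) _ _ _ (@continuous_unpack R I D (true, i) w).
exact.
Qed.

Lemma continuous_defect B : continuous (defect B).
Proof.
have cd (c : I) : continuous (fun w => `|symm B w c - e|).
  move=> w; apply: (@continuous_comp W 'rV[R]_D R (fun w => symm B w c - e) Num.norm w);
      last exact: norm_continuous.
  by apply: (@cvgB R _ W (nbhs w) (nbhs_filter w)); [exact: continuous_symm|exact: cvg_cst].
have ca JK : continuous (fun w => defect_at B w JK).
  move=> w; apply: (@cvgD R _ W (nbhs w) (nbhs_filter w)).
    by apply: continuous_big => [|i _]; [exact: add_continuous|exact: cd].
  by apply: continuous_big => [|i _]; [exact: add_continuous|exact: cd].
apply: continuous_big => [|JK _]; last exact: ca.
exact: min_continuous.
Qed.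

Lemma cvg_retract_coords B w c : near_stratum B w ->
  (fun w => retract_coords B w c) @ w --> retract_coords B w c.
Proof.
move=> [_ _ h _]; apply: (@cvg_normalize R D W (nbhs w) (nbhs_filter w)); first exact: h.
apply: (@cvg_collapse R _ W (nbhs w) (nbhs_filter w));
    [exact: continuous_defect|exact: continuous_symm].
Qed.

Lemma cvg_retract B w : near_stratum B w -> retract B @ w --> retract B w.
Proof.
move=> h; apply: (@cvg_pack R I D W (nbhs w) (nbhs_filter w)) => c; exact: cvg_retract_coords.
Qed.

(** Finitely many strict inequalities between continuous functions; in the last clause continuity at
    [w] comes from the third one. *)
Lemma near_near_stratum B w : near_stratum B w -> nbhs w [set w' | near_stratum B w'].
Proof.
move=> hw; have [h1 h2 h3 h4] := hw.
have cnorm (f : W -> 'rV[R]_D) a : f @ w --> a -> (fun w => `|f w|) @ w --> `|a|.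
  by move=> fa; exact: (@continuous_cvg _ _ _ (nbhs w) (nbhs_filter w) f Num.norm a
      (@norm_continuous _ _ _) fa).
have cs (i : 'I_n) : (fun w : W => `|unpack w (true, i) + unpack w (false, i)|) @ w -->
    `|unpack w (true, i) + unpack w (false, i)|.
  apply: cnorm; apply: (@cvgD R _ W (nbhs w) (nbhs_filter w)); exact: continuous_unpack.
have pos (f : W -> R) (a : R) : f @ w --> f w -> a < f w -> nbhs w [set w' | a < f w'].
  by move=> fw af; exact: (@cvgr_gt R _ (nbhs w) (nbhs_filter w) _ _ fw _ af).
have n1 : nbhs w [set w' | forall i l, i \in B -> l \notin B ->
    `|unpack w' (true, i) + unpack w' (false, i)| < `|unpack w' (true, l) + unpack w' (false, l)|].
  have : nbhs w [set w' | forall il : 'I_n * 'I_n, il.1 \in B -> il.2 \notin B ->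
    `|unpack w' (true, il.1) + unpack w' (false, il.1)| < `|unpack w' (true,
        il.2) + unpack w' (false, il.2)|].
    apply: (@filter_forall _ _ (fun il => [set w' | il.1 \in B -> il.2 \notin B ->
      `|unpack w' (true, il.1) + unpack w' (false, il.1)| < `|unpack w' (true,
          il.2) + unpack w' (false, il.2)|]) (nbhs w)) => -[i l] /=.
    case: (boolP (i \in B)) => iB; last by apply: filterE.
    case: (boolP (l \in B)) => lB; first by apply: filterE.
    have := pos (fun w => `|unpack w (true, l) + unpack w (false, l)| - `|unpack w (true,
        i) + unpack w (false, i)|) 0 (cvgB (cs l) (cs i)).
    rewrite subr_gt0 => /(_ (nbhs_filter w) (h1 i l iB lB)); apply: filterS => w' /=;
        rewrite subr_gt0 //.
  by apply: filterS => w' /= h i l; exact: (h (i, l)).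
have n2 : nbhs w [set w' | defect B w' < 1].
  exact: (@cvgr_lt R _ (nbhs w) (nbhs_filter w) _ _ (continuous_defect (B := B) (x := w)) _ h2).
have nz (f : W -> 'rV[R]_D) : f @ w --> f w -> f w != 0 -> nbhs w [set w' | f w' != 0].
  move=> fw f0; have := pos (fun w => `|f w|) 0 (cnorm _ _ fw).
  rewrite normr_gt0 => /(_ f0); apply: (@filterS _ (nbhs w) (nbhs_filter w)) => w' /=.
  by rewrite normr_gt0.
have n3 : nbhs w [set w' | forall c, collapse (defect B w') (symm B w' c) != 0].
  apply: (@filter_forall _ _ (fun c =>
      [set w' | collapse (defect B w') (symm B w' c) != 0]) (nbhs w)) => c.
  apply: nz (h3 c); apply: (@cvg_collapse R _ W (nbhs w) (nbhs_filter w));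
      [exact: continuous_defect|exact: continuous_symm].
have n4 : nbhs w [set w' | forall l, l \notin B -> retract_coords B w' (true,
    l) + retract_coords B w' (false, l) != 0].
  apply: (@filter_forall _ _ (fun l =>
      [set w' | l \notin B -> retract_coords B w' (true, l) + retract_coords B w' (false,
      l) != 0]) (nbhs w)) => l.
  case: (boolP (l \in B)) => lB; first by apply: filterE.
  have := nz (fun w => retract_coords B w (true, l) + retract_coords B w (false, l));
      move=> /(_ (@cvgD R _ W (nbhs w) (nbhs_filter w) _ _ _ _ (@cvg_retract_coords B w _ hw)
      (@cvg_retract_coords B w _ hw)) (h4 l lB)).
  by apply: (@filterS _ (nbhs w) (nbhs_filter w)) => w' /=.
apply: (@filterS _ (nbhs w) (nbhs_filter w) _ _ _ (filterI (filterI n1 n2) (filterI n3 n4))).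
by move=> w' [[? ?] [? ?]]; split.
Qed.

Lemma in_complex_supp (x : set_type X) : in_complex (supp (\val x : A)).
Proof. by apply/asboolP; apply: (subcomplex_subtorus hX); exact: set_mem (valP x). Qed.

Lemma symm_chart (p : T) : symm (antiset (\val p)) (chart p) = unpack (chart p).
Proof.
apply: funext => -[[] i]; rewrite /symm //=; case: ifP => // /antisetP h.
by rewrite chart_dst chart_src h opprK.
Qed.

Lemma defect_ge0 B w : 0 <= defect B w.
Proof.
apply/bigmin_geP; split; first exact: ler01.
by move=> JK _; apply: addr_ge0; apply: sumr_ge0 => i _; exact: normr_ge0.
Qed.

Lemma defect_chart (p : T) : defect (antiset (\val p)) (chart p) = 0.
Proof.
apply/eqP; rewrite eq_le defect_ge0 andbT.
pose JK : {set 'I_n} * {set 'I_n} := (supp (\val (\val p).1 : A), supp (\val (\val p).2 : A)).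
have PJK : in_complex JK.1 && in_complex JK.2 by rewrite !in_complex_supp.
apply: (le_trans (@bigmin_le_cond _ _ _ 1 JK (fun JK => in_complex JK.1 && in_complex JK.2)
  (defect_at (antiset (\val p)) (chart p)) PJK));
      rewrite /defect_at symm_chart !big1 ?addr0 // => i;
      rewrite finset.in_set => /negPn/eqP/coordR_base E.
  by rewrite chart_dst /dst E subrr normr0.
by rewrite chart_src /src E subrr normr0.
Qed.

Lemma unpack_chart_sphere (p : T) c : usphere (unpack (chart p) c).
Proof.
case: c => -[] i; [rewrite chart_src; exact: (src_sphere hX)|rewrite chart_dst;
    exact: (dst_sphere hX)].
Qed.

Lemma retract_coords_chart (p : T) c : retract_coords (antiset (\val p)) (chart p) c = unpack
    (chart p) c.
Proof. by rewrite /retract_coords defect_chart collapse0 symm_chart normalize_id //;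
    exact: unpack_chart_sphere. Qed.

Lemma retract_chart (p : T) : retract (antiset (\val p)) (chart p) = chart p.
Proof. by rewrite /retract (funext (retract_coords_chart p)) unpackK. Qed.

Lemma near_stratum_chart (p : T) : near_stratum (antiset (\val p)) (chart p).
Proof.
split.
- move=> i l /antisetP h; rewrite finset.in_set !chart_src !chart_dst => hl.
  by rewrite h addNr normr0 normr_gt0 addr_eq0.
- by rewrite defect_chart ltr01.
- by move=> c; rewrite defect_chart collapse0 symm_chart; apply: usphere_neq0;
    exact: unpack_chart_sphere.
by move=> l; rewrite !retract_coords_chart chart_src chart_dst finset.in_set addr_eq0.
Qed.

(** Below 1 the minimum is not the cut-off value, so some pair attains it, and each term of its sum
    is at most the sum. *)
Lemma defect_attained B w : defect B w < 1 -> exists J K : {set 'I_n},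
  [/\ @subtorus R k n J `<=` X, @subtorus R k n K `<=` X,
      forall i, i \notin J -> `|symm B w (true, i) - e| <= defect B w &
      forall i, i \notin K -> `|symm B w (false, i) - e| <= defect B w].
Proof.
move=> d1; have [[[J K] /andP[/asboolP JX /asboolP KX] le]|no]
    := pselect (exists2 JK : {set 'I_n} * {set 'I_n},
    in_complex JK.1 && in_complex JK.2 & defect_at B w JK <= defect B w).
  exists J, K; split => // i iJ; apply: le_trans le; rewrite /defect_at.
    by rewrite (bigD1 i) //= -addrA lerDl; apply: addr_ge0; apply: sumr_ge0 => l _;
        exact: normr_ge0.
  by rewrite [leRHS]addrC (bigD1 i) //= -addrA lerDl; apply: addr_ge0; apply: sumr_ge0 => l _;
      exact: normr_ge0.
suff : defect B w < defect B w by rewrite ltxx.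
apply/bigmin_gtP; split=> // JK PJK; rewrite ltNge; apply/negP => le; apply: no; by exists JK.
Qed.

(** With the defect as radius, the coordinates outside [J] and [K] collapse exactly to the pole, so
    both points lie in [X]. Antipodality on [B] survives since collapsing and normalizing commute
    with the sign. *)
Lemma retract_range B w : #|B| = j -> near_stratum B w -> range chart (retract B w).
Proof.
move=> Bj hw; have [h1 h2 h3 h4] := hw; have [J [K [JX KX dJ dK]]] := defect_attained h2.
have sph c : usphere (retract_coords B w c) by apply: normalize_sphere; exact: h3.
pose pt (b : bool) : A := fun i => toC (retract_coords B w (b, i)).
have ptE b i : coordR (pt b) i = retract_coords B w (b, i) by rewrite /coordR toCK.
have X1 : X (pt true).
  apply: JX; apply/subtorusP => i; rewrite ptE; split => // iJ.
  by apply: normalize_collapse_pole => //; exact: dJ.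
have X2 : X (pt false).
  apply: KX; apply/subtorusP => i; rewrite ptE; split => // iK.
  by apply: normalize_collapse_pole => //; exact: dK.
pose p : XX := (inX hX (pt true), inX hX (pt false)).
have srcE i : src p i = retract_coords B w (true, i) by rewrite /src /= inXK // ptE.
have dstE i : dst p i = retract_coords B w (false, i) by rewrite /dst /= inXK // ptE.
have aB : antiset p = B.
  apply/setP => i; rewrite finset.in_set srcE dstE; case: (boolP (i \in B)) => iB.
    by rewrite /retract_coords /symm /= iB collapseN normalizeN opprK eqxx.
  by rewrite -addr_eq0; apply/negbTE; exact: h4.
have pj : p \in antidomain (X := X) j by apply: mem_set; rewrite /antidomain /= aB.
exists (exist _ p pj) => //; congr pack; apply: funext => -[[] i]; [exact: srcE|exact: dstE].
Qed.

Definition strata : set W := [set w | exists2 B : {set 'I_n}, #|B| = j & near_stratum B w].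

Definition stratum_retract (w : W) : W :=
  if [pick B : {set 'I_n} | (#|B| == j) && `[< near_stratum B w >]]
      is Some B then retract B w else w.

Lemma stratum_retractE B w : #|B| = j -> near_stratum B w -> stratum_retract w = retract B w.
Proof.
move=> Bj hB; rewrite /stratum_retract; case: pickP => [C /andP[/eqP Cj /asboolP hC]|/(_ B)].
  by rewrite (near_stratum_uniq (etrans Cj (esym Bj)) hC hB).
by rewrite Bj eqxx asboolT.
Qed.

Lemma antidomain_ENR : ENR R T.
Proof.
have oU : open strata.
  rewrite openE => w [B Bj hB]; apply: (@filterS _ (nbhs w) _ _ _ _ (near_near_stratum hB)).
  by move=> w' h; exists B.
exists N, chart; split; first exact: chart_embedding.
exists strata, stratum_retract; split=> //.
have card_p (p : T) : #|antiset (\val p)| = j by exact: set_mem (valP p).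
split.
- by move=> _ [p _ <-]; exists (antiset (\val p)); [exact: card_p|exact: near_stratum_chart].
- rewrite (continuous_open_subspace _ oU) => w /set_mem [B Bj hB].
  rewrite /continuous_at (stratum_retractE Bj hB).
  (* The same [B] serves for all nearby points, so the map is locally [retract B]. *)
  have E : nbhs w [set w' | retract B w' = stratum_retract w'].
    by apply: (@filterS _ (nbhs w) _ _ _ _ (near_near_stratum hB)) => w' h;
        exact/esym/stratum_retractE.
  exact: cvg_trans (near_eq_cvg E) (cvg_retract hB).
- by move=> _ [w [B Bj hB] <-]; rewrite (stratum_retractE Bj hB); exact: retract_range.
by move=> _ [p _ <-]; rewrite (stratum_retractE (card_p p) (near_stratum_chart p)) retract_chart.
Qed.

End EuclideanNeighbourhoodRetract.

(** * The optimal planner and the value of TC *)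

Lemma planner_exists (R : realType) (k' n : nat) (X : set (ambient R k'.+1 n)) :
  subcomplex X -> inhabited (motion_planner R (set_type X) (z X).+1).
Proof.
move=> hX; have h (i : 'I_(z X).+1) := local_rule_exists hX i.
pose s (i : 'I_(z X).+1) := s2val (cid2 (h i)).
have cs i : continuous (s i) by exact: (s2valP (cid2 (h i))).
have es i p : endpoints (s i p) = \val p by exact: (s2valP' (cid2 (h i))).
split; apply: (@MotionPlanner _ _ _ (fun i : 'I_(z X).+1 => @antidomain R k' n X i) s) => //.
- by move=> i l _ _ [p [pi pl]]; apply/val_inj; rewrite /= -pi -pl.
- apply/seteqP; split=> // p _.
  by exists (inord #|antiset p|) => //; rewrite /antidomain /= inordK // ltnS; exact: card_antiset.
by move=> i; exact: antidomain_ENR.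
Qed.

Theorem theorem3p4 (R : realType) (k n : nat) (hk : (0 < k)%N) (hn : (0 < n)%N)
    (X : set (ambient R k n)) (hX : subcomplex X) :
  (exists P : motion_planner R (set_type X) (z X).+1, optimal P) /\
  TC R (set_type X) = (z X).+1.
Proof.
case: k hk X hX => // k' _ X hX.
have [P] := planner_exists hX.
have oP : optimal P by move=> m' Q; exact: (planner_lower_bound hX Q).
split; first by exists P.
(* [get] returns the size of some optimal planner; two optimal planners have the same size, as each
   bounds the other. *)
have [Q oQ] : [set m | exists P : motion_planner R (set_type X) m, optimal P] (TC R (set_type X)).
  by rewrite /TC; apply: getPex; exists (z X).+1, P.
by apply/eqP; rewrite eqn_leq (oQ _ P) (oP _ Q).
Qed.
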